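(* Let $\mathcal O=(0,\pi)$, $x_c\in\mathbb R$, let $\rho,\widetilde\Psi$ be as in the context, let $x\in L^p(0,\pi)$ with $p\ge4$, and consider the noise-free equation $$ \begin{cases} dX(t)-\Delta\big(\rho\,\mathrm{sign}(X(t)-x_c)+\widetilde\Psi(X(t)-x_c)\big)dt\ni 0, & t\ge0,\\ \rho\,\mathrm{sign}(X(t)-x_c)+\widetilde\Psi(X(t)-x_c)\ni0 & \text{on }\partial(0,\pi),\\ X(0)=x, \end{cases} $$ where $X$ is the function such that $X-x_c$ is the unique solution, in the sense of the context, with initial datum $x-x_c$. Let $$\gamma:=\inf\left\{\frac{|y|_{L^1}}{|y|_{-1}}:\ y\in L^1(0,\pi),\ y\neq0\right\}>0,\qquad \tau_c=\inf\{t\ge0:\ |X(t)-x_c|_{-1}=0\}=\sup\{t\ge0:\ |X(t)-x_c|_{-1}>0\}.$$ Then $$\tau_c\le\frac{|x-x_c|_{-1}}{\rho\gamma}.$$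
   Context: Notation. $\langle\cdot,\cdot\rangle_2$ is the scalar product of $L^2(0,\pi)$ and also the duality with pivot space $L^2(0,\pi)$. $H=H^{-1}(0,\pi)=(H_0^1(0,\pi))'$ with scalar product $\langle u,v\rangle=\int_0^\pi((-\Delta)^{-1}u)(\xi)\,v(\xi)\,d\xi$ (Dirichlet Laplacian, $\Delta=d^2/d\xi^2$) and norm $|u|_{-1}=\langle u,u\rangle^{1/2}$; $L^1(0,\pi)\subset H$ continuously. $e_k(\xi)=\sqrt{2/\pi}\,\sin k\xi$ are the Dirichlet eigenfunctions of $-\Delta$. $\mathrm{sign}$ is the maximal monotone graph with $\mathrm{sign}\,r=r/|r|$ for $r\ne0$ and $\mathrm{sign}\,0=[-1,1]$. Conventions: $\inf\emptyset=+\infty$, $\sup\emptyset=0$. Standing assumption. $\Psi:\mathbb R\to2^{\mathbb R}$ has the form $\Psi(r)=\rho\,\mathrm{sign}\,r+\widetilde\Psi(r)$, $r\in\mathbb R$, where $0\in\Psi(0)$, $\rho>0$, $\widetilde\Psi:\mathbb R\to\mathbb R$ is Lipschitz, $\widetilde\Psi\in C^1(\mathbb R\setminus\{0\})$, and for some $\delta>0$, $\widetilde\Psi'(r)\ge\delta$ for all $r\in\mathbb R\setminus\{0\}$. Definition of solution (noise-free case). Let $y\in H$ and $T>0$. A continuous function $Z:[0,T]\to H$ is called a solution on $[0,T]$ with initial datum $y$ of $$dZ(t)-\Delta\Psi(Z(t))\,dt\ni0\ \text{ in }(0,\pi),\quad \Psi(Z(t))\ni0\ \text{ on }\partial(0,\pi),\quad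 Z(0)=y,$$ if for some $q\in[1,\infty)$, $Z\in L^q((0,T)\times(0,\pi))\cap L^2(0,T;H)$ and there exists $\eta\in L^q((0,T)\times(0,\pi))$ with $\eta\in\Psi(Z)$ a.e. in $(0,T)\times(0,\pi)$ such that for all $j\in\mathbb N$ and $t\in[0,T]$, $$\langle Z(t),e_j\rangle_2=\langle y,e_j\rangle_2+\int_0^t\int_0^\pi\eta(s,\xi)\Delta e_j(\xi)\,d\xi\,ds.$$ For $y\in L^p(0,\pi)$, $p\ge4$, there is a unique solution on $[0,T]$ for every $T>0$. In the claim, $Z=X-x_c$ and $y=x-x_c$.
   Formalization: The formal statement adds Ψ̃(0)=0 to the assumption 0∈Ψ(0); without it the bound fails, e.g. for Ψ̃(r)=r−ρ and x=x_c+e_1, where X−x_c=e^{−t}e_1 never vanishes. *)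

(* Defs.v *)
From HB Require Import structures.
From mathcomp Require Export all_boot all_order all_algebra.
From mathcomp Require Export all_classical all_reals all_analysis.
Export Order.TTheory GRing.Theory Num.Theory.
Export numFieldNormedType.Exports.

Set Implicit Arguments.
Unset Strict Implicit.
Unset Printing Implicit Defensive.

Local Open Scope classical_set_scope.
Local Open Scope ring_scope.

Notation leb R := (@lebesgue_measure R).
Notation leb2 R := (product_measure1 (leb R) (leb R)).

(* The restriction is extended by 0, so that only the values on D matter. *)
Definition Lp_on d (T : measurableType d) (R : realType)
    (mu : {measure set T -> \bar R}) (D : set T) (p : R) (f : T -> R) : Prop :=
  f \_ D \in Lfun mu p%:E.

Section Hminus1.
Context {R : realType}.

Definition OO : set R := `]0, pi[.

(* g is the weak derivative of v on (0, pi): in dimension one, v in H^1(0, pi)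
   means that v is absolutely continuous with derivative in L^2. *)
Definition weak_derivative (v g : R -> R) : Prop :=
  Lp_on (leb R) OO 2 g /\
  forall xi, 0 <= xi <= pi ->
    v xi = v 0 + \int[leb R]_(z in `]0, xi[) g z.

(* H^1_0(0, pi); the values of v outside [0, pi] are irrelevant. *)
Definition H10 : set (R -> R) :=
  [set v | (exists g, weak_derivative v g) /\ v 0 = 0 /\ v pi = 0].

Definition wder (v : R -> R) : R -> R := xget (cst 0) (weak_derivative v).

(* (u', v') in L^2: the scalar product of H^1_0 *)
Definition dirichlet (u v : R -> R) : R :=
  \int[leb R]_(xi in OO) (wder u xi * wder v xi).

(* H^{-1}(0, pi) = (H^1_0)': functionals that are linear and bounded on H10.
   Their values off H10 are irrelevant, so that equality in H^{-1} is the
   relation eqH below. Boundedness makes u v depend on v on [0, pi] only. *)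
Definition dual := (R -> R) -> R.

Definition Hm1 : set dual :=
  [set u | (forall (a : R) v w, H10 v -> H10 w ->
              u (fun xi => a * v xi + w xi) = a * u v + u w) /\
           (exists C : R, forall v, H10 v ->
              `|u v| <= C * Num.sqrt (dirichlet v v))].

Definition eqH (u w : dual) : Prop := forall v, H10 v -> u v = w v.

(* L^1(0, pi) as a subset of H^{-1}, through the pivot space L^2(0, pi) *)
Definition toH (f : R -> R) : dual :=
  fun v => \int[leb R]_(xi in OO) (f xi * v xi).

(* (-Delta)^{-1} u: the w in H^1_0 with - w'' = u in H^{-1}, where -w'' is the
   functional v |-> (w', v') *)
Definition inv_lap (u : dual) : R -> R :=
  xget (cst 0) [set w | H10 w /\ forall v, H10 v -> dirichlet w v = u v].

(* The integral of ((-Delta)^{-1} u) v is the duality pairing of v in H^{-1}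
   with (-Delta)^{-1} u in H^1_0. *)
Definition innerH (u v : dual) : R := v (inv_lap u).

Definition normH (u : dual) : R := Num.sqrt (innerH u u).

Definition subH (u v : dual) : dual := fun w => u w - v w.

Definition normL1 (y : R -> R) : R := \int[leb R]_(xi in OO) `|y xi|.

Definition gamma : R :=
  inf [set r | exists y : R -> R,
    [/\ Lp_on (leb R) OO 1 y,
        ~ {ae leb R, forall xi, OO xi -> y xi = 0} &
        r = normL1 y / normH (toH y)]].

Definition e_ (k : nat) (xi : R) : R := Num.sqrt (2 / pi) * sin (k%:R * xi).

End Hminus1.
Arguments dual : clear implicits.
Arguments gamma : clear implicits.

Section Equation.
Context {R : realType}.

Definition sign_graph (r : R) : set R :=
  if r == 0 then [set s | -1 <= s <= 1] else [set r / `|r|].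

Definition Psi_graph (rho : R) (Psit : R -> R) (r : R) : set R :=
  [set rho * s + Psit r | s in sign_graph r].

Definition cylinder (T : R) : set (R * R) := `]0, T[ `*` OO.

(* z is the function in L^q((0,T) x (0,pi)) that Z is identified with. *)
Definition represents (T : R) (z : R * R -> R) (Z : R -> dual R) : Prop :=
  {ae leb R, forall t, 0 < t < T ->
     Lp_on (leb R) OO 1 (fun xi => z (t, xi)) /\
     eqH (Z t) (toH (fun xi => z (t, xi)))}.

(* Z : [0, T] -> H^{-1} solves dZ - Delta Psi(Z) dt \ni 0, Psi(Z) \ni 0 on the
   boundary, Z(0) = y. The values of Z outside [0, T] are irrelevant; the
   boundary condition is encoded in the last item by the Dirichlet
   eigenfunctions e_ j (j >= 1). *)
Definition solution (Psi : R -> set R) (T : R) (y : dual R)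
    (Z : R -> dual R) : Prop :=
  (forall t, 0 <= t <= T -> Hm1 (Z t)) /\
  (forall t, 0 <= t <= T ->
     normH (subH (Z s) (Z t)) @[s --> within `[0, T] (nbhs t)] --> (0 : R)) /\
  Lp_on (leb R) `]0, T[ 2 (normH \o Z) /\
  exists q : R, 1 <= q /\
  exists z eta : R * R -> R,
    [/\ Lp_on (leb2 R) (cylinder T) q z,
        represents T z Z,
        Lp_on (leb2 R) (cylinder T) q eta,
        {ae leb2 R, forall w, cylinder T w -> Psi (z w) (eta w)} &
        forall (j : nat) (t : R), (0 < j)%N -> 0 <= t <= T ->
          Z t (e_ j) = y (e_ j) +
            \int[leb R]_(s in `]0, t[)
              \int[leb R]_(xi in OO) (eta (s, xi) * derive1n 2 (e_ j) xi)].

Definition unique_solution (Psi : R -> set R) (T : R) (y : dual R)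
    (Z : R -> dual R) : Prop :=
  solution Psi T y Z /\
  forall Z', solution Psi T y Z' -> forall t, 0 <= t <= T -> eqH (Z' t) (Z t).

Definition tau_inf (Z : R -> dual R) : \bar R :=
  ereal_inf [set t%:E | t in [set t : R | 0 <= t /\ normH (Z t) = 0]].

(* The point 0 encodes the convention that the supremum of the empty set is 0. *)
Definition tau_sup (Z : R -> dual R) : \bar R :=
  ereal_sup ([set 0%E] `|`
    [set t%:E | t in [set t : R | 0 <= t /\ 0 < normH (Z t)]]).

End Equation.

(* Main.v *)
(* Idea. Since solutions are unique, it is enough to construct one with the right
   decay. Let G = (-Delta)^{-1}. The implicit Euler scheme
   Z_{n+1} - Z_n = h Delta eta_{n+1}, eta_{n+1} in Psi(Z_{n+1}), tested against
   G Z_{n+1} gives |Z_{n+1}|_{-1}^2 + h (eta_{n+1}, Z_{n+1})_2 <=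
   |Z_n|_{-1} |Z_{n+1}|_{-1}, and (eta, Z)_2 >= rho |Z|_{L^1} >= rho gamma |Z|_{-1},
   so that |Z_n|_{-1} decreases at rate rho gamma until it vanishes. As the datum
   lies in L^2, Psi is a subgradient of a potential whose integral is finite
   initially and decreases along the scheme. This bounds the distance between
   the schemes of steps h and h/2 by O(h) for the squared norms of C([0,T]; H^{-1})
   and, by strong monotonicity, of L^2((0,T) x (0,pi)); hence the dyadic schemes
   converge. The eta only converge weakly: almost everywhere convergence is
   obtained for convex combinations of them, which are compatible with the graph
   Psi because Z_n converges almost everywhere. *)
From mathcomp Require Import ring lra measurable_realfun.
Require Import Defs.

Set Implicit Arguments.
Unset Strict Implicit.
Unset Printing Implicit Defensive.

Local Open Scope classical_set_scope.
Local Open Scope ring_scope.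

(** * Semi-inner product spaces *)

(** The weak formulation only tests with the eigenfunctions, so no chain rule for |Z(t)|_{-1}^2 is
    at hand for the given solution. On the scheme the decay is plain algebra, and a bound between
    norms survives the limit. In dimension one H^{-1} becomes concrete: |u|_{-1} is the L^2 norm of
    the derivative of G u, so elements of H^{-1} are handled as square integrable functions of mean
    zero, and completeness of H^{-1} is that of L^2. The O(h) comparison of two schemes rests on the
    dissipation bound sum |Z_{n+1} - Z_n|_{-1}^2 <= h E(y), E being the integrated potential: the
    error of one step is quadratic in the increment, so that the errors add up to O(h). With h = T
    2^{-m} the distances between consecutive schemes decay like 2^{-m/2}. Such a geometric rate
    gives convergence almost everywhere of the whole sequence, without subsequences, and for each t
    a limit in H^{-1} with an error uniform in t. *)

Section SemiInnerProduct.
Context {R : realType} {V : lmodType R}.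
Implicit Types (L : set V) (b : V -> V -> R) (x y z : V).

(** Functions are not identified almost everywhere, so [b] may vanish on nonzero vectors; and [V]
    will be the space of all functions, on which [b] is bilinear only within [L]. The instances are
    [ip] on [L2] and on [L2O], and the H^{-1} product [ih]. *)
Record semi_inner L b : Prop := SemiInner {
  si0 : L 0;
  siD : forall x y, L x -> L y -> L (x + y);
  siZ : forall a x, L x -> L (a *: x);
  si_sym : forall x y, L x -> L y -> b x y = b y x;
  si_addl : forall x y z, L x -> L y -> L z -> b (x + y) z = b x z + b y z;
  si_scalel : forall a x y, L x -> L y -> b (a *: x) y = a * b x y;
  si_ge0 : forall x, L x -> 0 <= b x x }.

Variables (L : set V) (b : V -> V -> R).
Hypothesis Hb : semi_inner L b.

Lemma siN x : L x -> L (- x).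
Proof. by move=> Lx; rewrite -scaleN1r; exact: (siZ Hb). Qed.

Lemma siB x y : L x -> L y -> L (x - y).
Proof. by move=> Lx Ly; apply: (siD Hb) => //; exact: siN. Qed.

Lemma si_oppl x y : L x -> L y -> b (- x) y = - b x y.
Proof. by move=> Lx Ly; rewrite -scaleN1r (si_scalel Hb)// mulN1r. Qed.

Lemma si_subl x y z : L x -> L y -> L z -> b (x - y) z = b x z - b y z.
Proof.
by move=> Lx Ly Lz; rewrite (si_addl Hb)// ?si_oppl//; exact: siN.
Qed.

Lemma si_addr x y z : L x -> L y -> L z -> b z (x + y) = b z x + b z y.
Proof.
move=> Lx Ly Lz; rewrite (si_sym Hb)// ?(si_addl Hb)//; last exact: (siD Hb).
by rewrite (si_sym Hb Lx)// (si_sym Hb Ly).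
Qed.

Lemma si_oppr x y : L x -> L y -> b y (- x) = - b y x.
Proof.
move=> Lx Ly; rewrite (si_sym Hb)//; last exact: siN.
by rewrite si_oppl// (si_sym Hb Lx).
Qed.

Lemma si_subr x y z : L x -> L y -> L z -> b z (x - y) = b z x - b z y.
Proof.
by move=> Lx Ly Lz; rewrite si_addr// ?si_oppr//; exact: siN.
Qed.

Lemma si_scaler a x y : L x -> L y -> b y (a *: x) = a * b y x.
Proof.
move=> Lx Ly; rewrite (si_sym Hb)//; last exact: (siZ Hb).
by rewrite (si_scalel Hb)// (si_sym Hb Lx).
Qed.

Lemma si_sqD x y : L x -> L y ->
  b (x + y) (x + y) = b x x + 2 * b x y + b y y.
Proof.
move=> Lx Ly; have Lxy := siD Hb Lx Ly.
rewrite (si_addl Hb)// !si_addr// (si_sym Hb Ly Lx); ring.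
Qed.

Lemma si_sqB x y : L x -> L y ->
  b (x - y) (x - y) = b x x - 2 * b x y + b y y.
Proof.
move=> Lx Ly; have Lxy := siB Lx Ly.
rewrite si_subl// !si_subr// (si_sym Hb Ly Lx); ring.
Qed.

Lemma si_sqZ a x : L x -> b (a *: x) (a *: x) = a ^+ 2 * b x x.
Proof.
move=> Lx; rewrite (si_scalel Hb)// ?si_scaler//; last exact: (siZ Hb).
by rewrite mulrA.
Qed.

Lemma si_sqN x : L x -> b (- x) (- x) = b x x.
Proof. by move=> Lx; rewrite -scaleN1r si_sqZ// sqrrN expr1n mul1r. Qed.

Lemma si_sqBC x y : L x -> L y -> b (x - y) (x - y) = b (y - x) (y - x).
Proof. by move=> Lx Ly; rewrite -si_sqN ?opprB//; exact: siB. Qed.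

Lemma si_cauchy_schwarz x y : L x -> L y -> b x y ^+ 2 <= b x x * b y y.
Proof.
move=> Lx Ly.
have H t : 0 <= b x x + 2 * t * b x y + t ^+ 2 * b y y.
  have := si_ge0 Hb (siD Hb Lx (siZ Hb t Ly)).
  rewrite si_sqD//; last exact: (siZ Hb).
  by rewrite si_sqZ// si_scaler// !mulrA.
have [y0|y0] := eqVneq (b y y) 0.
  rewrite y0 mulr0; have [->|u0] := eqVneq (b x y) 0; first by rewrite expr0n.
  (* With [b y y = 0] the expression is affine in t; this t gives it the value -1. *)
  have := H (- (b x x + 1) / (2 * b x y)); rewrite y0 mulr0 addr0.
  rewrite (_ : 2 * _ * _ = - (b x x + 1)); last by field.
  lra.
have yp : 0 < b y y by rewrite lt_def y0 (si_ge0 Hb).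
have := H (- b x y / b y y).
rewrite -(pmulr_rge0 _ yp).
rewrite (_ : b y y * _ = b x x * b y y - b x y ^+ 2) ?subr_ge0//.
by field.
Qed.

Definition snorm x := Num.sqrt (b x x).

Lemma snorm_ge0 x : 0 <= snorm x. Proof. exact: sqrtr_ge0. Qed.

Lemma sqr_snorm x : L x -> snorm x ^+ 2 = b x x.
Proof. by move=> Lx; rewrite sqr_sqrtr// (si_ge0 Hb). Qed.

Lemma snorm_cs x y : L x -> L y -> `|b x y| <= snorm x * snorm y.
Proof.
move=> Lx Ly; rewrite -ler_sqr ?nnegrE ?mulr_ge0 ?snorm_ge0//.
by rewrite real_normK ?num_real// exprMn !sqr_snorm// si_cauchy_schwarz.
Qed.

Lemma ler_snormD x y : L x -> L y -> snorm (x + y) <= snorm x + snorm y.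
Proof.
move=> Lx Ly; rewrite -ler_sqr ?nnegrE ?addr_ge0 ?snorm_ge0//.
rewrite sqr_snorm; last exact: (siD Hb).
rewrite si_sqD// sqrrD (sqr_snorm Lx) (sqr_snorm Ly).
have := le_trans (ler_norm _) (snorm_cs Lx Ly).
by rewrite -mulr_natl; lra.
Qed.

Lemma snormBC x y : L x -> L y -> snorm (x - y) = snorm (y - x).
Proof. by move=> Lx Ly; rewrite /snorm si_sqBC. Qed.

Lemma ler_snorm_trans x y z : L x -> L y -> L z ->
  snorm (x - z) <= snorm (x - y) + snorm (y - z).
Proof.
move=> Lx Ly Lz; rewrite (_ : x - z = (x - y) + (y - z)); last first.
  by rewrite addrA subrK.
by apply: ler_snormD; exact: siB.
Qed.

Lemma ler_snorm_dist x y : L x -> L y -> `|snorm x - snorm y| <= snorm (x - y).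
Proof.
move=> Lx Ly; have := ler_snormD (siB Lx Ly) Ly; have := ler_snormD (siB Ly Lx) Lx.
by rewrite !subrK (snormBC Ly Lx) ler_norml => ? ?; apply/andP; split; lra.
Qed.

Lemma si_sqD_le x y : L x -> L y -> b (x + y) (x + y) <= 2 * b x x + 2 * b y y.
Proof.
move=> Lx Ly; have := si_ge0 Hb (siB Lx Ly); rewrite si_sqB// si_sqD//; lra.
Qed.

Lemma si_sqB_le x y : L x -> L y -> b (x - y) (x - y) <= 2 * b x x + 2 * b y y.
Proof.
move=> Lx Ly; have := si_ge0 Hb (siD Hb Lx Ly); rewrite si_sqB// si_sqD//; lra.
Qed.

Lemma si_bound x y : L x -> L y -> 2 * b x y <= b x x + b y y.
Proof. by move=> Lx Ly; have := si_ge0 Hb (siB Lx Ly); rewrite si_sqB//; lra. Qed.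

Lemma si_geometric_tail (f : nat -> V) (C q : R) :
  (forall n, L (f n)) -> 0 <= C -> 0 < q < 1 ->
  (forall n, snorm (f n.+1 - f n) <= C * q ^+ n) ->
  forall m k, snorm (f (m + k)%N - f m) <= C / (1 - q) * q ^+ m.
Proof.
move=> Lf C0 /andP[q0 q1] Hf m k.
have q1' : 0 < 1 - q by rewrite subr_gt0.
(* The induction on k reproduces the partial geometric sum, not its limit. *)
suff : snorm (f (m + k)%N - f m) <= C / (1 - q) * (q ^+ m - q ^+ (m + k)).
  move=> /le_trans; apply; rewrite ler_wpM2l ?divr_ge0 ?(ltW q1')//.
  by rewrite lerBlDr lerDl exprn_ge0// ltW.
elim: k => [|k IH].
  rewrite addn0 !subrr mulr0 /snorm -(scale0r (0 : V)) si_sqZ; last exact: (si0 Hb).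
  by rewrite expr0n mul0r sqrtr0.
rewrite addnS (le_trans (ler_snorm_trans _ (Lf (m + k)%N) _))//.
apply: (le_trans (lerD (Hf _) IH)); rewrite le_eqVlt; apply/orP; left; apply/eqP.
rewrite exprS; field; exact: lt0r_neq0.
Qed.

End SemiInnerProduct.

(** Convex combinations, with dyadic weights, of the terms of index at least n. Midpoints are all
    that the parallelogram identity asks for, and a convex bound valid for every such term passes to
    the hull by induction. *)
Inductive mid_hull (R : realType) (V : lmodType R) (u : nat -> V) (n : nat) :
    V -> Prop :=
| mid_hull_term k : (n <= k)%N -> mid_hull u n (u k)
| mid_hull_mid x y : mid_hull u n x -> mid_hull u n y ->
    mid_hull u n (2^-1 *: (x + y)).

Section MidHull.
Context {R : realType} {V : lmodType R} (L : set V) (b : V -> V -> R).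
Hypothesis Hb : semi_inner L b.

Lemma mid_hullW (u : nat -> V) m n x : (m <= n)%N ->
  mid_hull u n x -> mid_hull u m x.
Proof.
move=> mn; elim=> [k nk|{}x y _ IHx _ IHy]; first exact/mid_hull_term/(leq_trans mn).
exact: mid_hull_mid.
Qed.

Lemma mid_hull_in (u : nat -> V) n x : (forall k, L (u k)) ->
  mid_hull u n x -> L x.
Proof.
by move=> Lu; elim=> [k _//|{}x y _ Lx _ Ly]; apply: (siZ Hb); exact: (siD Hb).
Qed.

(* Near-minimizers of the norm over the nested hulls form a Cauchy sequence by
   the parallelogram identity; this replaces weak compactness. *)
Lemma mid_hull_cauchy (u : nat -> V) (M : R) : (forall k, L (u k)) ->
  (forall k, b (u k) (u k) <= M) ->
  exists g : nat -> V, (forall n, mid_hull u n (g n)) /\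
    forall n, b (g n.+1 - g n) (g n.+1 - g n) <= 8 * 2^-1 ^+ n.
Proof.
move=> Lu uM.
pose S n := [set r | exists2 x, mid_hull u n x & r = b x x].
have S0 n : has_inf (S n).
  split; first by exists (b (u n) (u n)), (u n) => //; exact: mid_hull_term.
  by exists 0 => r [x xS ->]; exact/(si_ge0 Hb)/(mid_hull_in Lu xS).
pose d n := inf (S n).
have dle n x : mid_hull u n x -> d n <= b x x.
  by move=> xS; apply: ge_inf; [exact: (S0 n).2|exists x].
have dW m n : (m <= n)%N -> d m <= d n.
  move=> mn; apply: lb_le_inf; first exact: (S0 n).1.
  by move=> r [x xS ->]; apply: dle; exact: mid_hullW xS.
have supd : has_sup (range d).
  split; first by exists (d 0%N), 0%N.
  exists M => _ [n _ <-]; apply: le_trans (uM n).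
  exact/dle/mid_hull_term.
(* The hulls shrink, so the infima [d n] increase to l. Then [N n] is an index from which [d]
   exceeds l - 2^-n, and [g n] an element of that hull with squared norm below l + 2^-n. *)
pose l := sup (range d).
have eS n : (2^-1 : R) ^+ n.+1 <= 2^-1 ^+ n.
  by rewrite exprS ler_piMl ?exprn_ge0//; lra.
have e0 n : 0 < (2^-1 : R) ^+ n by rewrite exprn_gt0// invr_gt0.
have /choice[N HN] n : exists k, (n <= k)%N /\ l - 2^-1 ^+ n < d k.
  have [_ [k _ <-] lk] := sup_adherent (e0 n) supd.
  exists (maxn n k); split; first exact: leq_maxl.
  by apply: (lt_le_trans lk); apply: dW; exact: leq_maxr.
have /choice[g Hg] n : exists x, mid_hull u (N n) x /\ b x x < l + 2^-1 ^+ n.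
  have [_ [x xS ->] lx] := inf_adherent (e0 n) (S0 (N n)).
  exists x; split => //; apply: (lt_le_trans lx); rewrite lerD2r.
  by apply: ub_le_sup; [exact: supd.2|exists (N n)].
exists g; split => [n|n]; first exact: mid_hullW (HN n).1 (Hg n).1.
have Lg k : L (g k) := mid_hull_in Lu (Hg k).1.
(* The midpoint has squared norm at least l - 2^-n, so the parallelogram identity leaves 2 (l +
   2^-n) + 2 (l + 2^-n) - 4 (l - 2^-n) = 8 * 2^-n. *)
have hm : mid_hull u (minn (N n) (N n.+1)) (2^-1 *: (g n.+1 + g n)).
  apply: mid_hull_mid.
    exact: (mid_hullW (geq_minr _ _) (Hg _).1).
  exact: (mid_hullW (geq_minl _ _) (Hg _).1).
have := dle _ _ hm.
have : l - 2^-1 ^+ n <= d (minn (N n) (N n.+1)).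
  rewrite /minn; case: ifP => _; first exact/ltW/(HN n).2.
  apply: le_trans (ltW (HN n.+1).2).
  by rewrite lerD2l lerN2.
rewrite (si_sqZ Hb); last exact: (siD Hb).
rewrite (si_sqD Hb)// (si_sqB Hb)//.
have := (Hg n).2; have := (Hg n.+1).2; have := eS n.
have : (2^-1 : R) ^+ 2 = 4^-1 by field.
move=> ->; lra.
Qed.

End MidHull.

(** * Square integrable functions *)

Section L2.
Context d (T : measurableType d) (R : realType) (mu : {measure set T -> \bar R}).
Implicit Types f g h : T -> R.

Definition L2 : set (T -> R) := [set f | f \in Lfun mu 2%:E].
Definition ip f g : R := \int[mu]_x (f x * g x).

Lemma L2_measurable f : L2 f -> measurable_fun setT f.
Proof. by rewrite /L2/= inE => /andP[/[!inE]]. Qed.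

Lemma L2_integrable_sqr f : L2 f -> mu.-integrable setT (fun x => (f x ^+ 2)%:E).
Proof. exact: Lfun2_integrable_sqr. Qed.

Lemma L2I f : measurable_fun setT f ->
  (\int[mu]_x (f x ^+ 2)%:E < +oo)%E -> L2 f.
Proof.
move=> mf iff; rewrite /L2/= inE; apply/andP; split; rewrite inE//=.
rewrite /finite_norm unlock /Lnorm poweR_lty//.
rewrite (eq_integral (fun x => (f x ^+ 2)%:E))// => x _.
by rewrite /= powR_mulrn// real_normK// num_real.
Qed.

Lemma L2_le f g : measurable_fun setT f -> L2 g ->
  (forall x, f x ^+ 2 <= g x ^+ 2) -> L2 f.
Proof.
move=> mf Lg fg; apply: L2I => //.
have /integrableP[_] := L2_integrable_sqr Lg; apply: le_lt_trans.
apply: ge0_le_integral => //.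
- by move=> x _; rewrite lee_fin sqr_ge0.
- by apply/measurable_EFinP; exact: measurable_funX.
- apply: measurableT_comp => //; apply/measurable_EFinP.
  by apply: measurable_funX; exact: L2_measurable.
- by move=> x _; rewrite gee0_abs lee_fin ?sqr_ge0.
Qed.

Lemma L2_integrableM f g : L2 f -> L2 g ->
  mu.-integrable setT (EFin \o (fun x => f x * g x)).
Proof. by move=> Lf Lg; apply/Lfun1_integrable; exact: Lfun2_mul_Lfun1. Qed.

Lemma semi_inner_L2 : semi_inner L2 ip.
Proof.
have p1 : (1 <= 2%:E :> \bar R)%E by rewrite lee_fin ler1n.
have [H0 H1] := Lfun_submod_closed mu p1.
have HZ a f : L2 f -> L2 (a *: f).
  by move=> Lf; have := H1 a f 0 Lf H0; rewrite addr0.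
split => //.
- by move=> f g Lf Lg; have := H1 1 f g Lf Lg; rewrite scale1r.
- by move=> f g _ _; rewrite /ip; apply: eq_Rintegral => x _; rewrite mulrC.
- move=> f g h Lf Lg Lh; rewrite /ip.
  under eq_Rintegral do rewrite mulrDl.
  by rewrite RintegralD//; exact: L2_integrableM.
- move=> a f g Lf Lg; rewrite /ip.
  under eq_Rintegral do rewrite -mulrA.
  by rewrite RintegralZl//; exact: L2_integrableM.
- by move=> f _; apply: Rintegral_ge0 => x _; rewrite -expr2 sqr_ge0.
Qed.

Lemma L2_ip_fin f : L2 f -> (\int[mu]_x (f x ^+ 2)%:E = (ip f f)%:E)%E.
Proof.
move=> Lf; rewrite /ip /Rintegral fineK; last first.
  by apply: integrable_fin_num => //; exact: L2_integrableM.
by apply: eq_integral => x _; rewrite expr2.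
Qed.

Lemma le_ip f g h k : L2 f -> L2 g -> L2 h -> L2 k ->
  (forall x, f x * g x <= h x * k x) -> ip f g <= ip h k.
Proof. by move=> *; apply: le_Rintegral => //; exact: L2_integrableM. Qed.

Lemma ip_ae_eq0 f : L2 f -> ip f f = 0 -> {ae mu, forall x, f x = 0}.
Proof.
move=> Lf f0; have mf := L2_measurable Lf.
have mf2 : measurable_fun setT (fun x => (f x ^+ 2)%:E).
  by apply/measurable_EFinP; exact: measurable_funX.
have /(ae_eq_integral_abs _ measurableT mf2) : (\int[mu]_x `|(f x ^+ 2)%:E| = 0)%E.
  under eq_integral do rewrite gee0_abs ?lee_fin ?sqr_ge0//.
  by rewrite L2_ip_fin// f0.
apply: filterS => x /(_ I) /= [] /eqP.
by rewrite sqrf_eq0 => /eqP.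
Qed.

Lemma ae_eq_ip f f' g : L2 f -> L2 f' -> L2 g ->
  {ae mu, forall x, f x = f' x} -> ip f g = ip f' g.
Proof.
move=> Lf Lf' Lg H; congr fine; apply: ae_eq_integral => //.
- by have /integrableP[] := L2_integrableM Lf Lg.
- by have /integrableP[] := L2_integrableM Lf' Lg.
- by apply: filterS H => x /= -> _.
Qed.

End L2.

Section AlmostEverywhere.
Context d (T : measurableType d) (R : realType) (mu : {measure set T -> \bar R}).
Implicit Types P Q : T -> Prop.

Lemma ae_impl P Q : (forall x, P x -> Q x) ->
  {ae mu, forall x, P x} -> {ae mu, forall x, Q x}.
Proof. by move=> PQ; apply: filterS. Qed.

Lemma ae_and P Q : {ae mu, forall x, P x} -> {ae mu, forall x, Q x} ->
  {ae mu, forall x, P x /\ Q x}.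
Proof. by move=> HP HQ; apply: filterS2 HP HQ => x. Qed.

End AlmostEverywhere.

Section Completeness.
Context d (T : measurableType d) (R : realType) (mu : {measure set T -> \bar R}).
Implicit Types f g h : T -> R.

(* Borel-Cantelli in quantitative form. *)
Lemma ae_geometric_bound (g : nat -> T -> \bar R) (C q : R) : 0 < q < 1 ->
  (forall n, measurable_fun setT (g n)) -> (forall n x, (0 <= g n x)%E) ->
  (forall n, (\int[mu]_x g n x <= (C * q ^+ 2 ^+ n)%:E)%E) ->
  {ae mu, forall x, exists K : R, forall n, (g n x <= (K * q ^+ n)%:E)%E}.
Proof.
move=> /andP[q0 q1] mg g0 gC.
(* Half of the decay q^(2n) is spent here: the weighted functions still have a summable integral, so
   their sum is finite almost everywhere, and its value is the bound K. *)
pose h n x := ((q ^- n)%:E * g n x)%E.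
have qn0 n : 0 < q ^- n by rewrite invr_gt0 exprn_gt0.
have mh n : measurable_fun setT (h n) by exact: measurable_funeM.
have h0 n x : (0 <= h n x)%E by rewrite mule_ge0// lee_fin ltW.
have hC n : (\int[mu]_x h n x <= (C * q ^+ n)%:E)%E.
  rewrite ge0_integralZl//; last by rewrite lee_fin ltW.
  rewrite (le_trans (lee_wpmul2l _ (gC n))) ?lee_fin ?(ltW (qn0 n))//.
  by rewrite -exprM mul2n -addnn exprD mulrCA !mulrA mulrVK// unitfE gt_eqF ?exprn_gt0.
have C0 : 0 <= C.
  have := hC 0%N; rewrite expr0 mulr1 -lee_fin; apply: le_trans.
  by apply: integral_ge0 => x _; exact: h0.
have : mu.-integrable setT (fun x => \sum_(0 <= n <oo) h n x)%E.
  apply/integrableP; split; first exact: ge0_emeasurable_sum.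
  under eq_integral.
    move=> x _; rewrite gee0_abs; last exact: nneseries_ge0.
    over.
  rewrite integral_nneseries//.
  apply: (@le_lt_trans _ _ (C / (1 - q))%:E); last exact: ltry.
  apply: lime_le; first by apply: is_cvg_nneseries => n _ _; exact: integral_ge0.
  apply: nearW => N; apply: (@le_trans _ _ (\sum_(0 <= n < N) (C * q ^+ n)%:E)%E).
    by apply: lee_sum => n _; exact: hC.
  rewrite sumEFin lee_fin -mulr_sumr ler_wpM2l// big_mkord.
  have q1' : 0 < 1 - q by rewrite subr_gt0.
  rewrite -[leRHS]mul1r ler_pdivlMr//.
  have := subrX1 q N; have : 0 <= q ^+ N by rewrite exprn_ge0// ltW.
  move: (q ^+ N) (\sum_(i < N) _) => u v; lra.
move/integrable_ae => /(_ measurableT); apply: filterS => x /(_ I) hx.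
exists (fine (\sum_(0 <= n <oo) h n x)%E) => n.
have : (h n x <= \sum_(0 <= n <oo) h n x)%E.
  have := @nneseries_lim_ge _ (h ^~ x) xpredT 0 n.+1 (fun n _ _ => h0 n x).
  by apply: le_trans; rewrite big_nat_recr//= leeDr// sume_ge0.
rewrite -{1}(fineK hx) /h => H.
by rewrite EFinM muleC -lee_pdivrMl ?exprn_gt0.
Qed.

(** The sequence itself converges almost everywhere, because [ae_geometric_bound] makes the squared
    increments pointwise O(q^n). The rate in L^2 then follows from Fatou's lemma for |f_{m+n} -
    f_m|^2 as n grows. *)
Lemma L2_complete (f : nat -> T -> R) (C q : R) : 0 < q < 1 ->
  (forall n, L2 mu (f n)) ->
  (forall n, ip mu (f n.+1 - f n) (f n.+1 - f n) <= C * q ^+ 2 ^+ n) ->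
  exists g, [/\ L2 mu g,
    {ae mu, forall x, (f ^~ x) @ \oo --> g x} &
    forall n, ip mu (f n - g) (f n - g) <= C / (1 - q) ^+ 2 * q ^+ 2 ^+ n].
Proof.
move=> /andP[q0 q1] Lf fC; have Hs := @semi_inner_L2 _ _ _ mu.
have mf n := L2_measurable (Lf n).
have Ldf n : L2 mu (f n.+1 - f n) := siB Hs (Lf n.+1) (Lf n).
have C0 : 0 <= C.
  by have := le_trans (si_ge0 Hs (Ldf 0%N)) (fC 0%N); rewrite expr0 mulr1.
have Hsn n : snorm (ip mu) (f n.+1 - f n) <= Num.sqrt C * q ^+ n.
  rewrite -ler_sqr ?nnegrE ?mulr_ge0 ?sqrtr_ge0 ?exprn_ge0 ?(ltW q0)//.
  by rewrite (sqr_snorm Hs)// exprMn sqr_sqrtr// -(exprAC q 2 n).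
have tail m k : ip mu (f (m + k)%N - f m) (f (m + k)%N - f m) <=
    C / (1 - q) ^+ 2 * q ^+ 2 ^+ m.
  rewrite -(sqr_snorm Hs); last exact: (siB Hs).
  have := si_geometric_tail Hs Lf (sqrtr_ge0 C) _ Hsn m k.
  rewrite q0 q1 => /(_ isT) H.
  rewrite (le_trans (_ : _ <= (Num.sqrt C / (1 - q) * q ^+ m) ^+ 2))//.
    by rewrite ler_sqr ?nnegrE ?snorm_ge0// (le_trans (snorm_ge0 _ _) H).
  by rewrite (exprAC q 2 m) 2!exprMn sqr_sqrtr// exprVn.
pose G n x := ((f n.+1 x - f n x) ^+ 2)%:E.
(* Squared increments bounded by K q^n mean increments bounded by sqrt(K) p^n, which are
   summable. *)
pose p := Num.sqrt q.
have mG n : measurable_fun setT (G n).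
  apply/measurable_EFinP; apply: measurable_funX; exact: measurable_funB.
have aeb : {ae mu, forall x, exists K : R, forall n, (G n x <= (K * q ^+ n)%:E)%E}.
  apply: (@ae_geometric_bound _ C) => //; first by rewrite q0.
    by move=> n x; rewrite lee_fin sqr_ge0.
  by move=> n; rewrite (L2_ip_fin (Ldf n)) lee_fin.
have aec : {ae mu, forall x, cvgn (f ^~ x)}.
  apply: filterS aeb => x [K HK].
  have p0 : 0 < p by rewrite sqrtr_gt0.
  have p1 : p < 1 by rewrite -(sqrtr1 R) ltr_sqrt.
  have K0 : 0 <= K.
    have := HK 0%N; rewrite /G lee_fin expr0 mulr1; apply: le_trans; exact: sqr_ge0.
  have Hd n : `|f n.+1 x - f n x| <= geometric (Num.sqrt K) p n.
    rewrite /geometric/= -ler_sqr ?nnegrE ?mulr_ge0 ?sqrtr_ge0 ?exprn_ge0 ?(ltW p0)//.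
    rewrite real_normK ?num_real// exprMn sqr_sqrtr// -(exprAC p 2 n) sqr_sqrtr ?(ltW q0)//.
    by have := HK n; rewrite lee_fin.
  have cs : cvgn [normed series (fun n => f n.+1 x - f n x)].
    apply: (@series_le_cvg _ _ (geometric (Num.sqrt K) p)) => //.
    - by move=> n; exact: normr_ge0.
    - by move=> n; rewrite /geometric/= mulr_ge0 ?sqrtr_ge0 ?exprn_ge0 ?(ltW p0).
    - by apply: is_cvg_geometric_series; rewrite gtr0_norm.
  have := normed_cvg cs.
  rewrite (_ : series _ = (fun n => f n x - f 0%N x)); last first.
    by apply/funext => n; rewrite /series/= telescope_sumr.
  move=> c; have -> : f ^~ x = (fun n => (f n x - f 0%N x) + f 0%N x).
    by apply/funext => n; rewrite subrK.
  by apply: is_cvgD => //; exact: is_cvg_cst.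
have [N [mN N0 HN]] := aec.
(* Cutting off on a measurable null set that contains all points of divergence gives convergence
   everywhere, hence a measurable limit. *)
pose h n x := f n x * \1_(~` N) x.
have mh n : measurable_fun setT (h n).
  apply: measurable_funM => //; apply: measurable_indic; exact: measurableC.
have hf n x : ~ N x -> h n x = f n x.
  by move=> nx; rewrite /h indicE mem_set// mulr1.
have h0 n x : N x -> h n x = 0.
  by move=> nx; rewrite /h indicE memNset ?mulr0//; apply.
have ch x : cvgn (h ^~ x).
  have [nx|nx] := pselect (N x).
    rewrite (_ : h ^~ x = cst 0); first exact: is_cvg_cst.
    by apply/funext => n; rewrite h0.
  rewrite (_ : h ^~ x = f ^~ x); first by apply: contrapT => H; exact/nx/HN.
  by apply/funext => n; rewrite hf.
pose g x := limn (h ^~ x).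
have hg x : h ^~ x @ \oo --> g x by exact: ch.
have mg : measurable_fun setT g by apply: (measurable_fun_cvg mh) => x _; exact: hg.
have cfg x : ~ N x -> f ^~ x @ \oo --> g x.
  move=> nx; rewrite (_ : f ^~ x = h ^~ x)//.
  by apply/funext => n; rewrite hf.
have aefg : {ae mu, forall x, f ^~ x @ \oo --> g x}.
  by exists N; split => // x /= nc; apply: contrapT => nx; exact/nc/cfg.
have fat m : (\int[mu]_x ((f m x - g x) ^+ 2)%:E <=
    (C / (1 - q) ^+ 2 * q ^+ 2 ^+ m)%:E)%E.
  pose k n x := ((h (m + n)%N x - h m x) ^+ 2)%:E.
  have mk n : measurable_fun setT (k n).
    apply/measurable_EFinP; apply: measurable_funX; exact: measurable_funB.
  have -> : (\int[mu]_x ((f m x - g x) ^+ 2)%:E = \int[mu]_x limn_einf (k ^~ x))%E.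
    have -> : (fun x => limn_einf (k ^~ x)) = (fun x => ((h m x - g x) ^+ 2)%:E).
      apply/funext => x.
      have ck : k ^~ x @ \oo --> ((h m x - g x) ^+ 2)%:E.
        apply: cvg_EFin; first exact: nearW.
        have c1 : (fun n => h (m + n)%N x - h m x) @ \oo --> g x - h m x.
          apply: cvgB; last exact: cvg_cst.
          rewrite (_ : (fun n => h (m + n)%N x) = (fun n => h (n + m)%N x)).
            by have := hg x; rewrite -(cvg_shiftn m).
          by apply/funext => n; rewrite addnC.
        rewrite -sqrrN opprB expr2.
        apply: cvg_trans (cvgM c1 c1); apply: near_eq_cvg.
        by apply: nearW => n /=; rewrite expr2.
      by rewrite (cvg_limn_einf_sup ck).1.
    apply: ae_eq_integral => //.
    - apply/measurable_EFinP; apply: measurable_funX; exact: measurable_funB.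
    - apply/measurable_EFinP; apply: measurable_funX; exact: measurable_funB.
    - exists N; split => // x /= nc; apply: contrapT => nx; apply: nc => _.
      by rewrite hf.
  apply: le_trans (fatou mu measurableT mk _) _.
    by move=> n x _; rewrite lee_fin sqr_ge0.
  rewrite limn_einf_lim; apply: lime_le; first exact: is_cvg_einfs.
  apply: nearW => n; apply: (@le_trans _ _ (\int[mu]_x k n x)%E).
    by apply: ereal_inf_lbound; exists n => //=.
  apply: (@le_trans _ _ (\int[mu]_x ((f (m + n)%N x - f m x) ^+ 2)%:E)%E).
    apply: ge0_le_integral => //.
    - by move=> x _; rewrite lee_fin sqr_ge0.
    - apply/measurable_EFinP; apply: measurable_funX; exact: measurable_funB.
    - move=> x _; rewrite lee_fin /k; have [nx|nx] := pselect (N x).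
        by rewrite !h0// subrr expr0n sqr_ge0.
      by rewrite !hf.
  rewrite (@L2_ip_fin _ _ _ _ (f (m + n)%N - f m)) ?lee_fin//.
  exact: (siB Hs).
have Lg : L2 mu g.
  have Ld : L2 mu (f 0%N - g).
    apply: L2I; first exact: measurable_funB.
    by apply: le_lt_trans (fat 0%N) _; exact: ltry.
  by have := siB Hs (Lf 0%N) Ld; rewrite opprB addrC subrK.
exists g; split => // n.
have := fat n; rewrite (@L2_ip_fin _ _ _ _ (f n - g)) ?lee_fin//.
exact: (siB Hs).
Qed.

End Completeness.

(** * The Dirichlet Laplacian on (0, pi) *)

Lemma addfE (T : Type) (R : realType) (f g : T -> R) x : (f + g) x = f x + g x.
Proof. by []. Qed.

Lemma subfE (T : Type) (R : realType) (f g : T -> R) x : (f - g) x = f x - g x.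
Proof. by []. Qed.

Lemma scalefE (T : Type) (R : realType) (a : R) (f : T -> R) x :
  (a *: f) x = a * f x.
Proof. by []. Qed.

Lemma oppfE (T : Type) (R : realType) (f : T -> R) x : (- f) x = - f x.
Proof. by []. Qed.

Definition pointwiseE := (subfE, addfE, oppfE, scalefE).

Section Primitive.
Context {R : realType}.
Notation lam := (leb R).
Notation Itg f := (lam.-integrable setT (EFin \o (f : R -> R))).

Implicit Types f g h : R -> R.

(** Functions on (0, pi) are encoded as functions on the line that vanish elsewhere: integrals over
    [OO] become integrals over the line, and the L^2 theory of the line applies. *)
Definition supp0 f := forall x, ~ OO x -> f x = 0.
Definition L1O : set (R -> R) := [set f | Itg f /\ supp0 f].
Definition L2O : set (R -> R) := [set f | L2 lam f /\ supp0 f].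
Definition ind : R -> R := \1_OO.
Definition prim f (y : R) : R := \int[lam]_(z in `]0, y[) f z.

Lemma OOP (x : R) : OO x = (0 < x < pi) :> Prop.
Proof. by rewrite /OO/= in_itv. Qed.

Lemma measurable_OO : measurable (OO : set R).
Proof. exact: measurable_itv. Qed.

Lemma indE x : OO x -> ind x = 1.
Proof. by move=> xO; rewrite /ind indicE mem_set. Qed.

Lemma ind0 x : ~ OO x -> ind x = 0.
Proof. by move=> xO; rewrite /ind indicE memNset. Qed.

Lemma leb_OO : lam OO = (pi : R)%:E.
Proof. by rewrite /OO lebesgue_measure_itv/= lte_fin pi_gt0 oppr0 adde0. Qed.

Lemma measurable_ind : measurable_fun setT ind.
Proof. by apply: measurable_indic; exact: measurable_OO. Qed.

Lemma restrictE f x : (f \_ OO) x = f x * ind x.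
Proof.
rewrite patchE /ind indicE; case: ifPn => xO; first by rewrite mulr1.
by rewrite mulr0.
Qed.

Lemma supp0_restrict f : supp0 f -> f \_ OO = f.
Proof.
move=> f0; apply/funext => x; rewrite restrictE.
have [xO|xO] := pselect (OO x); first by rewrite indE// mulr1.
by rewrite f0// mul0r.
Qed.

Lemma restrict_supp0 f : supp0 (f \_ OO).
Proof. by move=> x xO; rewrite restrictE ind0// mulr0. Qed.

Lemma Rintegral_OO f : supp0 f -> \int[lam]_(x in OO) f x = \int[lam]_x f x.
Proof. by move=> f0; rewrite Rintegral_mkcond; under eq_Rintegral do rewrite supp0_restrict//. Qed.

Lemma integral_ind_sqr : (\int[lam]_x (ind x ^+ 2)%:E = (pi : R)%:E)%E.
Proof.
transitivity (\int[lam]_x (ind x)%:E)%E.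
  apply: eq_integral => x _; rewrite /ind indicE.
  by case: (_ \in _); rewrite ?expr1n ?expr0n.
by rewrite integral_indic ?setIT//; [exact: leb_OO|exact: measurable_OO].
Qed.

Lemma L2O_ind : L2O ind.
Proof.
split; last by move=> x; exact: ind0.
apply: L2I; first exact: measurable_ind.
by rewrite integral_ind_sqr ltry.
Qed.

Lemma ip_ind : ip lam ind ind = pi.
Proof.
by apply: EFin_inj; rewrite -(L2_ip_fin L2O_ind.1) integral_ind_sqr.
Qed.

Lemma semi_inner_L2O : semi_inner L2O (ip lam).
Proof.
have Hs := semi_inner_L2 lam; split.
- by split; [exact: si0 Hs|].
- move=> f g [Lf f0] [Lg g0]; split; first exact: (siD Hs).
  by move=> x xO; rewrite addfE f0// g0// addr0.
- move=> a f [Lf f0]; split; first exact: (siZ Hs).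
  by move=> x xO; rewrite scalefE f0// mulr0.
- by move=> f g [Lf _] [Lg _]; exact: (si_sym Hs).
- by move=> f g h [Lf _] [Lg _] [Lh _]; exact: (si_addl Hs).
- by move=> a f g [Lf _] [Lg _]; exact: (si_scalel Hs).
- by move=> f [Lf _]; exact: (si_ge0 Hs).
Qed.

Lemma L2O_measurable f : L2O f -> measurable_fun setT f.
Proof. by case=> Lf _; exact: L2_measurable Lf. Qed.

Lemma L2O_L1O f : L2O f -> L1O f.
Proof.
move=> [Lf f0]; split => //.
have := L2_integrableM Lf L2O_ind.1.
rewrite (_ : EFin \o _ = EFin \o f)//; apply/funext => x /=; congr EFin.
have [xO|xO] := pselect (OO x); first by rewrite indE// mulr1.
by rewrite f0// mul0r.
Qed.

Lemma L2O_bounded f (C : R) : measurable_fun setT f -> supp0 f ->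
  (forall x, `|f x| <= C) -> L2O f.
Proof.
move=> mf f0 fC; split => //.
have LC : L2 lam (C *: ind) := siZ (semi_inner_L2 lam) C L2O_ind.1.
apply: (L2_le _ LC) => [|x]; first exact: mf.
have [xO|xO] := pselect (OO x); last by rewrite f0// expr0n sqr_ge0.
rewrite scalefE indE// mulr1 -[leLHS]real_normK ?num_real//.
rewrite -[leRHS]real_normK ?num_real// ler_sqr ?nnegrE//.
by rewrite (le_trans (fC x))// ler_norm.
Qed.

Lemma integrable_lt f (y : R) : Itg f ->
  Itg (fun x => f x * (x < y)%R%:R).
Proof.
move=> intf; have /integrableP[/measurable_EFinP mf _] := intf.
have mlt : measurable_fun setT (fun x : R => (x < y)%R%:R : R).
  rewrite (_ : (fun _ => _) = \1_(`]-oo, y[ : set R)); first exact: measurable_indic.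
  by apply/funext => x; rewrite indicE mem_setE in_itv.
apply: le_integrable intf => //.
  by apply/measurable_EFinP; exact: measurable_funM.
by move=> x _ /=; rewrite lee_fin normrM ler_piMr// normr_nat; case: ltP => _; rewrite ?lexx ?ler01.
Qed.

(** The variable interval becomes a kernel on a fixed domain, to which linearity and Fubini's
    theorem apply. *)
Lemma primE f y : supp0 f -> prim f y = \int[lam]_x (f x * (x < y)%R%:R).
Proof.
move=> f0; rewrite /prim Rintegral_mkcond; apply: eq_Rintegral => x _.
rewrite patchE mem_setE in_itv/=; have [xO|xO] := pselect (OO x).
  move: xO; rewrite OOP => /andP[-> _] /=.
  by case: ifP => _; rewrite ?mulr1 ?mulr0.
by rewrite f0// mul0r; case: ifP.
Qed.

Lemma prim_pi f : supp0 f -> prim f pi = \int[lam]_x f x.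
Proof. by move=> f0; rewrite -(Rintegral_OO f0). Qed.

Lemma prim_le0 f y : y <= 0 -> prim f y = 0.
Proof. by move=> y0; rewrite /prim set_itv_ge ?Rintegral_set0// bnd_simp -leNgt. Qed.

Lemma prim_norm f y : L1O f -> `|prim f y| <= \int[lam]_x `|f x|.
Proof.
move=> [intf f0]; rewrite primE//.
have H := integrable_lt y intf.
apply: (le_trans (le_normr_Rintegral measurableT H)).
apply: le_Rintegral => //; [exact: integrable_norm H|exact: integrable_norm intf|].
by move=> x _; rewrite normrM ler_piMr// normr_nat; case: ltP => _; rewrite ?lexx ?ler01.
Qed.

Lemma primD f g y : L1O f -> L1O g -> prim (f + g) y = prim f y + prim g y.
Proof.
move=> [If f0] [Ig g0]; rewrite !primE//; last first.
  by move=> x xO; rewrite addfE f0// g0// addr0.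
under eq_Rintegral do rewrite mulrDl.
by rewrite RintegralD//; exact: integrable_lt.
Qed.

Lemma primZ a f y : L1O f -> prim (a *: f) y = a * prim f y.
Proof.
move=> [If f0]; rewrite !primE//; last first.
  by move=> x xO; rewrite scalefE f0// mulr0.
under eq_Rintegral do rewrite -mulrA.
by rewrite RintegralZl//; exact: integrable_lt.
Qed.

Let K f g (z : R * R) : R := g z.1 * f z.2 * (z.2 < z.1)%R%:R.

Let mK f g : measurable_fun setT f -> measurable_fun setT g ->
  measurable_fun setT (EFin \o K f g).
Proof.
move=> mf mg; apply/measurable_EFinP; apply: measurable_funM.
  by apply: measurable_funM; apply: measurableT_comp.
have mb : measurable_fun setT (fun z : R * R => z.2 < z.1).
  exact: measurable_fun_ltr.
rewrite (_ : (fun _ => _) = \1_([set z : R * R | z.2 < z.1])).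
  apply: measurable_indic; rewrite -[X in measurable X]setTI.
  exact: (mb measurableT [set true]).
apply/funext => z; rewrite indicE; congr (_ %:R).
by congr (nat_of_bool _); apply/idP/idP; rewrite inE.
Qed.

Let integrableK f g : Itg f -> Itg g ->
  (lam \x lam)%E.-integrable setT (EFin \o K f g).
Proof.
move=> If Ig; have /integrableP[/measurable_EFinP mf If'] := If.
have /integrableP[/measurable_EFinP mg Ig'] := Ig.
apply/integrable12ltyP; first exact: mK.
apply: (@le_lt_trans _ _ (\int[lam]_y (`|g y|%:E * \int[lam]_x `|f x|%:E))%E).
  apply: ge0_le_integral => //.
  - by move=> x _; exact: integral_ge0.
  - apply: (@measurable_fun_fubini_tonelli_F _ _ _ _ _ lam (abse \o (EFin \o K f g))).
      by apply: measurableT_comp => //; exact: mK.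
    by move=> z; exact: abse_ge0.
  - apply: emeasurable_funM => //; apply/measurable_EFinP; exact: measurableT_comp.
  - move=> x _; rewrite -ge0_integralZl//; last first.
      by apply/measurable_EFinP; exact: measurableT_comp.
    apply: ge0_le_integral => //.
    + apply/measurable_EFinP; apply: measurableT_comp => //.
      have := mK mf mg => /measurable_EFinP mKf.
      exact: (measurableT_comp mKf (@pair1_measurable _ _ _ _ x)).
    + apply/measurable_EFinP; apply: measurable_funM => //; exact: measurableT_comp.
    + move=> y _; rewrite -EFinM lee_fin /K/= !normrM ler_piMr ?mulr_ge0//.
      by rewrite normr_nat; case: ltP => _; rewrite ?lexx ?ler01.
rewrite ge0_integralZr//.
- by rewrite lte_mul_pinfty// ?integral_ge0// ge0_fin_numE ?integral_ge0.
- by apply/measurable_EFinP; exact: measurableT_comp.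
- exact: integral_ge0.
Qed.

Let inner_K f g (y : R) : L1O f ->
  (\int[lam]_x (K f g (y, x))%:E = (prim f y * g y)%:E)%E.
Proof.
move=> [If f0]; have Il := integrable_lt y If.
rewrite primE// -RintegralZr// /Rintegral fineK; last first.
  apply: integrable_fin_num => //.
  have := integrableZr measurableT (g y) Il.
  by under eq_fun do rewrite -EFinM.
by apply: eq_integral => x _; congr EFin; rewrite /K/=; ring.
Qed.

Lemma integrable_prim_mul f g : L1O f -> L1O g -> Itg (fun y => prim f y * g y).
Proof.
move=> Lf [Ig g0]; have [If _] := Lf.
have := integrable_fubini_F (integrableK If Ig).
by rewrite /fubini_F (_ : (fun _ => _) = EFin \o (fun y => prim f y * g y))//;
  apply/funext => y; exact: inner_K.
Qed.

Lemma integrable_gt f x : Itg f -> Itg (fun y => (x < y)%R%:R * f y).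
Proof.
move=> intf; have /integrableP[/measurable_EFinP mf _] := intf.
have mlt : measurable_fun setT (fun y : R => (x < y)%R%:R : R).
  rewrite (_ : (fun _ => _) = \1_(`]x, +oo[ : set R)); first exact: measurable_indic.
  by apply/funext => y; rewrite indicE mem_setE in_itv/= andbT.
apply: le_integrable intf => //.
  by apply/measurable_EFinP; exact: measurable_funM.
by move=> y _ /=; rewrite lee_fin normrM ler_piMl// normr_nat; case: ltP => _; rewrite ?lexx ?ler01.
Qed.

Lemma integral_gt f x : L1O f -> \int[lam]_y ((x < y)%R%:R * f y) = prim f pi - prim f x.
Proof.
move=> [If f0]; have Il := integrable_lt x If; have Ig := integrable_gt x If.
rewrite prim_pi// primE// -RintegralB//.
congr fine; apply: ae_eq_integral => //.
- by case/integrableP : Ig.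
- have := integrableB measurableT If Il.
  by under eq_fun do rewrite -EFinB; case/integrableP.
- exists [set x]; split => //; first exact: lebesgue_measure_set1.
  move=> y /=; apply: contra_notP => /eqP yx _; congr EFin.
  have [xy|yx'|xy] := ltgtP x y.
  + by rewrite mul1r mulr0 subr0.
  + by rewrite mul0r mulr1 subrr.
  + by rewrite xy eqxx in yx.
Qed.

(** Fubini's theorem on the triangle x < y for g(y) f(x): integrating in x yields [prim f y * g y],
    integrating in y yields f(x) times the integral of g over (x, pi). No differentiability enters,
    so integrable f and g are allowed. *)
Lemma integration_by_parts_prim f g : L1O f -> L1O g ->
  \int[lam]_y (prim f y * g y) = \int[lam]_x (f x * (prim g pi - prim g x)).
Proof.
move=> Lf Lg; have [If f0] := Lf; have [Ig g0] := Lg.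
congr fine; transitivity (\int[lam]_y \int[lam]_x (K f g (y, x))%:E)%E.
  by apply: eq_integral => y _; rewrite inner_K.
rewrite (Fubini (integrableK If Ig)).
apply: eq_integral => x _; have Il := integrable_gt x Ig.
rewrite -integral_gt// -RintegralZl// /Rintegral fineK; last first.
  apply: integrable_fin_num => //.
  have := integrableZl measurableT (f x) Il.
  by under eq_fun do rewrite -EFinM.
by apply: eq_integral => y _; congr EFin; rewrite /K/=; ring.
Qed.

(** The primitive at y is the scalar product of g with an indicator of squared norm at most pi, the
    length of the interval. *)
Lemma prim_cauchy_schwarz g y : L2O g -> prim g y ^+ 2 <= pi * ip lam g g.
Proof.
move=> Lg; have [L2g g0] := Lg.
pose k := \1_(`]0, y[ `&` OO) : R -> R.
have Lk : L2O k.
  apply: (@L2O_bounded _ 1).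
  - by apply: measurable_indic; apply: measurableI => //; exact: measurable_OO.
  - by move=> x xO; rewrite /k indicE memNset// => -[].
  - by move=> x; rewrite /k indicE normr_nat; case: (_ \in _).
have -> : prim g y = ip lam g k.
  rewrite /prim Rintegral_mkcond; apply: eq_Rintegral => x _.
  rewrite patchE /k indicE in_setI; have [xO|xO] := pselect (OO x).
    by rewrite (mem_set xO) andbT; case: ifP; rewrite ?mulr1 ?mulr0.
  by rewrite g0// mul0r; case: ifP.
apply: le_trans (si_cauchy_schwarz semi_inner_L2O Lg Lk) _.
rewrite mulrC ler_wpM2r ?(si_ge0 semi_inner_L2O)// -ip_ind.
apply: le_ip; [exact: Lk.1|exact: Lk.1|exact: L2O_ind.1|exact: L2O_ind.1|].
move=> x; rewrite /k /ind !indicE in_setI.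
by case: (_ \in OO); case: (_ \in _); rewrite ?mulr0 ?mulr1 ?ler01.
Qed.

(** Lebesgue differentiation: since g is supported in (0, pi), its primitive from -oo vanishes also
    below 0 and beyond pi, and the derivative of that primitive is g almost everywhere. *)
Lemma prim_eq0_ae g : L1O g -> (forall y, 0 <= y <= pi -> prim g y = 0) ->
  {ae lam, forall x, g x = 0}.
Proof.
move=> [Ig g0] H.
have := @FTC1 R g -oo%O.
have Ha y : lam.-integrable [set` Interval -oo%O (BRight y)] (EFin \o g).
  exact: integrableS Ig.
have Hl : locally_integrable [set: R] g.
  by have := integrable_locally measurableT Ig; rewrite patch_setT.
move=> /(_ Ha Hl); set F := (fun _ => _) => HF.
suff F0 : F = cst 0.
  move: HF; rewrite F0 /=; apply: ae_impl => x /(_ (ltNyr _))[_].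
  by rewrite derive1_cst => <-.
apply/funext => y; rewrite /F/=.
rewrite -Rintegral_itv_bndo_bndc; last by apply: integrableS Ig.
have gy : \int[lam]_(t in [set` Interval -oo%O (BLeft y)]) g t = prim g y.
  rewrite primE// Rintegral_mkcond; apply: eq_Rintegral => t _.
  by rewrite patchE mem_setE in_itv/=; case: ifP; rewrite ?mulr1 ?mulr0.
rewrite gy; have [y0|y0] := leP y 0; first exact: prim_le0.
have [ypi|ypi] := leP y pi; first by apply: H; rewrite ltW.
rewrite -[RHS](H pi) ?pi_ge0 ?lexx// !primE//; apply: eq_Rintegral => t _.
have [tO|tO] := pselect (OO t); last by rewrite g0// !mul0r.
by move: tO; rewrite OOP => /andP[_ tpi]; rewrite tpi (lt_trans tpi ypi).
Qed.

End Primitive.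

(** * The Green operator and its derivative *)

Section GreenOperator.
Context {R : realType}.
Notation lam := (leb R).
Notation Itg f := (lam.-integrable setT (EFin \o (f : R -> R))).
Notation HsO := (@semi_inner_L2O R).
Implicit Types f g h : R -> R.

(* DG f is the derivative of the solution Gop f of -w'' = f, w(0) = w(pi) = 0:
   it is -f integrated once, plus the constant that makes its mean vanish. *)
Definition mean f : R := (\int[lam]_y (prim f y * ind y)) / pi.
Definition DG f (y : R) : R := (mean f - prim f y) * ind y.
Definition Gop f (y : R) : R := prim (DG f) y * ind y.

Lemma L1O_ind : L1O (ind : R -> R). Proof. exact/L2O_L1O/L2O_ind. Qed.

Lemma primO_L2O f : L1O f -> L2O (fun y => prim f y * ind y).
Proof.
move=> Lf; apply: (@L2O_bounded _ _ (\int[lam]_x `|f x|)).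
- by have /integrableP[/measurable_EFinP] := integrable_prim_mul Lf L1O_ind.
- by move=> x xO; rewrite ind0// mulr0.
- move=> x; rewrite normrM (le_trans _ (prim_norm x Lf))// ler_piMr//.
  by rewrite /ind indicE normr_nat; case: (_ \in _).
Qed.

Lemma DGE f : DG f = mean f *: ind - (fun y => prim f y * ind y).
Proof. by apply/funext => y; rewrite subfE scalefE /DG mulrBl. Qed.

Lemma DG_L2O f : L1O f -> L2O (DG f).
Proof.
move=> Lf; rewrite DGE; apply: (siB HsO); last exact: primO_L2O.
by apply: (siZ HsO); exact: L2O_ind.
Qed.

Lemma int_ind : \int[lam]_x (ind x : R) = pi.
Proof.
rewrite -[RHS](@ip_ind R); apply: eq_Rintegral => x _.
by rewrite /ind indicE; case: (_ \in _); rewrite ?mulr1 ?mulr0.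
Qed.

Lemma int_DG f : L1O f -> \int[lam]_x DG f x = 0.
Proof.
move=> Lf; have [Ii _] := L1O_ind; have [If _] := L2O_L1O (primO_L2O Lf).
transitivity (\int[lam]_x (mean f * ind x - prim f x * ind x)).
  by apply: eq_Rintegral => x _; rewrite /DG mulrBl.
rewrite RintegralB//; last first.
  by have := integrableZl measurableT (mean f) Ii; under eq_fun do rewrite -EFinM.
rewrite RintegralZl// int_ind /mean divfK ?subrr//.
by rewrite gt_eqF// pi_gt0.
Qed.

Lemma prim_DG_pi f : L1O f -> prim (DG f) pi = 0.
Proof. by move=> Lf; rewrite prim_pi ?int_DG//; exact: (DG_L2O Lf).2. Qed.

Lemma Gop_L2O f : L1O f -> L2O (Gop f).
Proof. by move=> Lf; apply/primO_L2O/L2O_L1O/DG_L2O. Qed.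

Lemma L1OZ a f : L1O f -> L1O (a *: f).
Proof.
move=> [If f0]; split; last by move=> x xO; rewrite scalefE f0// mulr0.
by have := integrableZl measurableT a If; under eq_fun do rewrite -EFinM.
Qed.

Lemma DGD f g : L1O f -> L1O g -> DG (f + g) = DG f + DG g.
Proof.
move=> Lf Lg; have [If _] := L2O_L1O (primO_L2O Lf).
have [Ig _] := L2O_L1O (primO_L2O Lg).
have mD : mean (f + g) = mean f + mean g.
  rewrite /mean -mulrDl -RintegralD//; congr (_ / _).
  by apply: eq_Rintegral => x _; rewrite primD// mulrDl.
by apply/funext => y; rewrite addfE /DG mD primD//; ring.
Qed.

Lemma DGZ a f : L1O f -> DG (a *: f) = a *: DG f.
Proof.
move=> Lf; have [If _] := L2O_L1O (primO_L2O Lf).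
have mZ : mean (a *: f) = a * mean f.
  rewrite /mean mulrA -RintegralZl//; congr (_ / _).
  by apply: eq_Rintegral => x _; rewrite primZ// mulrA.
by apply/funext => y; rewrite scalefE /DG mZ primZ//; ring.
Qed.

Lemma DGB f g : L1O f -> L1O g -> DG (f - g) = DG f - DG g.
Proof.
move=> Lf Lg; rewrite DGD//; last by rewrite -scaleN1r; exact: L1OZ.
by rewrite -(scaleN1r g) DGZ// scaleN1r.
Qed.

Lemma GopD f g : L1O f -> L1O g -> Gop (f + g) = Gop f + Gop g.
Proof.
move=> Lf Lg; apply/funext => y; rewrite addfE /Gop DGD// primD ?mulrDl//.
  exact/L2O_L1O/DG_L2O.
exact/L2O_L1O/DG_L2O.
Qed.

Lemma GopZ a f : L1O f -> Gop (a *: f) = a *: Gop f.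
Proof.
move=> Lf; apply/funext => y; rewrite scalefE /Gop DGZ// primZ ?mulrA//.
exact/L2O_L1O/DG_L2O.
Qed.

Lemma GopB f g : L1O f -> L1O g -> Gop (f - g) = Gop f - Gop g.
Proof.
move=> Lf Lg; rewrite GopD//; last by rewrite -scaleN1r; exact: L1OZ.
by rewrite -(scaleN1r g) GopZ// scaleN1r.
Qed.

(** This is (w', v')_2 = (f, v)_2 for w = G f and v = [prim g] in H^1_0. The constant [mean f] is
    orthogonal to g, which has mean zero, and the boundary term is [prim g pi]. *)
Lemma ip_DG f g : L1O f -> L2O g -> prim g pi = 0 ->
  ip lam (DG f) g = \int[lam]_x (f x * prim g x).
Proof.
move=> Lf Lg gpi; have Lp := primO_L2O Lf.
have L1g := L2O_L1O Lg.
have LmI : L2O (mean f *: ind) by apply: (siZ HsO); exact: L2O_ind.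
rewrite DGE (si_subl HsO)// (si_scalel HsO)//; last exact: L2O_ind.
have gi x : ind x * g x = g x.
  have [xO|xO] := pselect (OO x); first by rewrite indE// mul1r.
  by rewrite L1g.2// mulr0.
have -> : ip lam ind g = 0.
  by rewrite -gpi prim_pi ?L1g.2//; [apply: eq_Rintegral => x _|exact: L1g.2].
rewrite mulr0 sub0r.
have -> : ip lam (fun y => prim f y * ind y) g = \int[lam]_y (prim f y * g y).
  by apply: eq_Rintegral => x _; rewrite -mulrA gi.
rewrite integration_by_parts_prim// gpi.
have H := integrable_prim_mul L1g Lf.
have -> : \int[lam]_x (f x * (0 - prim g x)) = \int[lam]_x (-1 * (prim g x * f x)).
  by apply: eq_Rintegral => x _; ring.
rewrite RintegralZl// mulN1r opprK.
by apply: eq_Rintegral => x _; rewrite mulrC.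
Qed.

Lemma ip_DG_DG f h : L1O f -> L1O h ->
  ip lam (DG f) (DG h) = \int[lam]_x (f x * Gop h x).
Proof.
move=> Lf Lh; rewrite ip_DG//; [|exact: DG_L2O|exact: prim_DG_pi].
apply: eq_Rintegral => x _; rewrite /Gop.
have [xO|xO] := pselect (OO x); first by rewrite indE// mulr1.
by rewrite Lf.2// !mul0r.
Qed.

Lemma ip_Gop f h : L2O f -> L2O h -> ip lam f (Gop h) = ip lam (DG f) (DG h).
Proof. by move=> /L2O_L1O Lf /L2O_L1O Lh; rewrite ip_DG_DG. Qed.

(** Poincare inequality: one factor pi comes from the pointwise bound [prim_cauchy_schwarz], the
    other from integrating it over (0, pi). *)
Lemma Gop_poincare f : L1O f ->
  ip lam (Gop f) (Gop f) <= pi ^+ 2 * ip lam (DG f) (DG f).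
Proof.
move=> Lf; have LD := DG_L2O Lf; have LG := Gop_L2O Lf.
have D0 := si_ge0 HsO LD.
pose c := Num.sqrt (pi * ip lam (DG f) (DG f)).
have LcI : L2O (c *: ind) by apply: (siZ HsO); exact: L2O_ind.
apply: (@le_trans _ _ (ip lam (c *: ind) (c *: ind))).
  apply: le_ip; [exact: LG.1|exact: LG.1|exact: LcI.1|exact: LcI.1|].
  move=> x; rewrite scalefE /Gop -!expr2 !exprMn ler_wpM2r ?sqr_ge0//.
  by rewrite sqr_sqrtr ?prim_cauchy_schwarz// mulr_ge0 ?pi_ge0.
rewrite (si_sqZ HsO) ?ip_ind; last exact: L2O_ind.
by rewrite sqr_sqrtr ?mulr_ge0 ?pi_ge0// mulrAC -expr2.
Qed.

Lemma prim_ae_eq f g : L1O f -> L1O g -> {ae lam, forall x, f x = g x} ->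
  prim f = prim g.
Proof.
move=> [If f0] [Ig g0] fg; apply/funext => y; rewrite !primE//.
congr fine; apply: ae_eq_integral => //.
- by have /integrableP[] := integrable_lt y If.
- by have /integrableP[] := integrable_lt y Ig.
- by apply: ae_impl fg => x -> _.
Qed.

Lemma DG_ae_eq f g : L1O f -> L1O g -> {ae lam, forall x, f x = g x} -> DG f = DG g.
Proof. by move=> Lf Lg fg; rewrite /DG /mean (prim_ae_eq Lf Lg fg). Qed.

Lemma Gop_ae_eq f g : L1O f -> L1O g -> {ae lam, forall x, f x = g x} ->
  Gop f = Gop g.
Proof. by move=> Lf Lg fg; rewrite /Gop (DG_ae_eq Lf Lg fg). Qed.

(** The embedding of L^1 into H^{-1}: pair f with G f, whose supremum is at most sqrt(pi) |DG f|,
    and cancel one factor |DG f|. It is the source of the positivity of [gamma]. *)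
Lemma snorm_DG_le f : L1O f ->
  snorm (ip lam) (DG f) <= Num.sqrt pi * \int[lam]_x `|f x|.
Proof.
move=> Lf; have LD := DG_L2O Lf; set n := snorm _ _.
have n0 : 0 <= n := snorm_ge0 _ _.
have n2 : n ^+ 2 = ip lam (DG f) (DG f) by rewrite (sqr_snorm HsO).
have [->|nn0] := eqVneq n 0.
  by rewrite mulr_ge0 ?sqrtr_ge0// Rintegral_ge0.
have np : 0 < n by rewrite lt_def nn0.
rewrite -(ler_pM2r np) -expr2 n2 ip_DG//; last exact: prim_DG_pi.
have -> : Num.sqrt pi * (\int[lam]_x `|f x|) * n = Num.sqrt pi * n * \int[lam]_x `|f x|.
  by rewrite mulrAC.
have L1D := L2O_L1O LD.
have Ia : Itg (fun x => `|f x|) by exact: integrable_norm Lf.1.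
have If : Itg (fun x => f x * prim (DG f) x).
  by have := integrable_prim_mul L1D Lf; under eq_fun do rewrite mulrC.
rewrite -RintegralZl//; apply: le_Rintegral => //.
  by have := integrableZl measurableT (Num.sqrt pi * n) Ia; under eq_fun do rewrite -EFinM.
move=> x _; rewrite (le_trans (ler_norm _))// normrM mulrC ler_wpM2r//.
rewrite -ler_sqr ?nnegrE ?mulr_ge0 ?sqrtr_ge0// real_normK ?num_real//.
by rewrite exprMn n2 sqr_sqrtr ?pi_ge0// prim_cauchy_schwarz.
Qed.

Lemma prim_continuous f y : L1O f -> 0 <= y <= pi -> forall e, 0 < e ->
  exists2 r, 0 < r & forall z, 0 <= z <= pi -> `|y - z| < r -> `|prim f y - prim f z| < e.
Proof.
move=> [If f0] yI e e0.
have Ip : lam.-integrable `[0, pi] (EFin \o f) by exact: integrableS If.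
have pE z : \int[lam]_(t in `[0, z]) f t = prim f z.
  rewrite -Rintegral_itv_bndo_bndc; last by exact: integrableS If.
  by rewrite -Rintegral_itv_obnd_cbnd//; exact: integrableS If.
have /subspace_continuousP/(_ y) := parameterized_integral_continuous (pi_ge0 R) Ip.
rewrite /= in_itv/= yI => /(_ isT) /cvgrPdist_lt /(_ e e0).
move/nbhs_ballP => [r /= r0 H]; exists r => // z zI yz.
by rewrite -!pE; apply: (H z yz); rewrite /= in_itv/= zI.
Qed.

(** If DG f vanishes, [prim f] equals the constant [mean f] almost everywhere, then everywhere on
    [0, pi] by continuity; its value at 0 makes the constant 0. *)
Lemma DG_eq0 f : L1O f -> ip lam (DG f) (DG f) = 0 -> {ae lam, forall x, f x = 0}.
Proof.
move=> Lf D0; have LD := DG_L2O Lf.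
have Hc : {ae lam, forall y, OO y -> prim f y = mean f}.
  have := ip_ae_eq0 LD.1 D0; apply: ae_impl => y + yO.
  by rewrite /DG indE// mulr1 => /eqP; rewrite subr_eq0 => /eqP.
have [N [mN N0 HN]] := Hc.
(* A null set contains no interval, so points with [prim f z = mean f] lie arbitrarily close to y,
   also at the end points. *)
have near_c (y r : R) : 0 <= y <= pi -> 0 < r ->
    exists z, [/\ OO z, `|y - z| < r & prim f z = mean f].
  move=> /andP[y0 ypi] r0; apply: contrapT => nex.
  pose a := Num.max 0 (y - r); pose b := Num.min pi (y + r).
  have ab : a < b.
    rewrite /a /b gt_max !lt_min; have := pi_gt0 R.
    by move=> ?; apply/andP; split; apply/andP; split; lra.
  have sub : `]a, b[ `<=` N.
    move=> z /=; rewrite in_itv/= gt_max lt_min => /andP[/andP[z0 zr] /andP[zpi zr']].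
    apply: HN => /= Hz; apply: nex; exists z.
    have zO : OO z by rewrite OOP z0.
    by split => //; [rewrite ltr_norml; apply/andP; split; lra|exact: Hz].
  have : (lam `]a, b[ <= lam N)%E by apply: le_measure => //; rewrite inE.
  by rewrite N0 lebesgue_measure_itv/= lte_fin ab -EFinD lee_fin subr_le0 leNgt ab.
have pc y : 0 <= y <= pi -> prim f y = mean f.
  move=> yI; apply/eqP; rewrite -subr_eq0 -normr_eq0; apply/eqP.
  apply/eqP; rewrite eq_le normr_ge0 andbT; apply/ler_addgt0Pr => e e0.
  have [r r0 H] := prim_continuous Lf yI e0.
  have [z [zO yz <-]] := near_c y r yI r0.
  rewrite add0r ltW// H//.
  by move: zO; rewrite OOP => /andP[z0 zpi]; rewrite !ltW.
have m0 : mean f = 0.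
  by rewrite -(pc 0) ?lexx ?pi_ge0// prim_le0.
by apply: prim_eq0_ae => // y /pc ->.
Qed.

End GreenOperator.

(** * The spaces H^1_0 and H^{-1}, and the constant gamma *)

Section SobolevSpace.
Context {R : realType}.
Notation lam := (leb R).
Notation HsO := (@semi_inner_L2O R).
Implicit Types f g v w : R -> R.

Lemma Lp_on2P f : Lp_on lam OO 2 f <-> L2O (f \_ OO).
Proof. by split => [Lf|[]//]; split => //; exact: restrict_supp0. Qed.

Lemma Lp_on1P f : Lp_on lam OO 1 f <-> L1O (f \_ OO).
Proof.
rewrite /Lp_on; split => [/Lfun1_integrable If|[If _]].
  by split => //; exact: restrict_supp0.
exact/Lfun1_integrable.
Qed.

Lemma prim_restrict f y : y <= pi -> prim (f \_ OO) y = prim f y.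
Proof.
move=> ypi; apply: eq_Rintegral => x; rewrite inE/= in_itv/= => /andP[x0 xy].
by rewrite restrictE indE ?mulr1// OOP x0 (lt_le_trans xy).
Qed.

Definition wd v := wder v \_ OO.

Lemma H10_elim v : H10 v -> [/\ L2O (wd v), prim (wd v) pi = 0 &
  forall y, 0 <= y <= pi -> v y = prim (wd v) y].
Proof.
move=> [[g gv] [v0 vpi]].
have [Lw wE] : weak_derivative v (wder v) by exact: xgetPex (ex_intro _ g gv).
have vE y : 0 <= y <= pi -> v y = prim (wd v) y.
  by move=> yI; rewrite wE// v0 add0r prim_restrict//; case/andP: yI.
split => //; first exact/Lp_on2P.
by rewrite -vE ?vpi// lexx pi_ge0.
Qed.

(** [wder] chooses one weak derivative, which is determined only up to null sets; [prim_eq0_ae] is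
    that uniqueness. *)
Lemma H10_intro g v : L2O g -> prim g pi = 0 ->
  (forall y, 0 <= y <= pi -> v y = prim g y) ->
  H10 v /\ {ae lam, forall x, wd v x = g x}.
Proof.
move=> Lg gpi vE.
have pi0 : (0 : R) <= pi := pi_ge0 R.
have v0 : v 0 = 0 by rewrite vE ?lexx// prim_le0.
have Hv : H10 v.
  split; last by split => //; rewrite vE ?lexx ?pi0.
  exists g; split; first by apply/Lp_on2P; rewrite supp0_restrict//; exact: Lg.2.
  by move=> y yI; rewrite v0 add0r vE.
split => //; have [Lw _ wE] := H10_elim Hv.
have Ld := siB HsO Lw Lg.
have := @prim_eq0_ae R (wd v - g) (L2O_L1O Ld); move=> H.
apply: ae_impl (H _) => [x /eqP|y yI].
  by rewrite subfE subr_eq0 => /eqP.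
rewrite -scaleN1r primD ?primZ; [|exact: L2O_L1O..|]; last first.
  by apply: L1OZ; exact: L2O_L1O.
by rewrite -wE// vE// mulN1r subrr.
Qed.

Lemma prim0 y : prim (0 : R -> R) y = 0.
Proof. by rewrite -(scale0r ind) primZ ?mul0r//; exact: L1O_ind. Qed.

Lemma H10_0 : H10 (cst 0 : R -> R).
Proof.
have [] // := @H10_intro 0 (cst 0) (si0 HsO).
  exact: prim0.
by move=> y _; rewrite prim0.
Qed.

Lemma H10_lin (a : R) v w : H10 v -> H10 w ->
  H10 (fun x => a * v x + w x) /\
  {ae lam, forall x, wd (fun x => a * v x + w x) x = a * wd v x + wd w x}.
Proof.
move=> /H10_elim[Lv vpi vE] /H10_elim[Lw wpi wE].
have Lav : L2O (a *: wd v) by apply: (siZ HsO).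
have L := siD HsO Lav Lw.
have pE y : prim (a *: wd v + wd w) y = a * prim (wd v) y + prim (wd w) y.
  by rewrite primD ?primZ//; exact: L2O_L1O.
apply: (H10_intro L) => [|y yI]; first by rewrite pE vpi wpi mulr0 addr0.
by rewrite pE vE// wE.
Qed.

Lemma dirichletE v w : dirichlet v w = ip lam (wd v) (wd w).
Proof.
rewrite /dirichlet Rintegral_mkcond; apply: eq_Rintegral => x _.
rewrite /wd !restrictE mulrACA; congr (_ * _).
by rewrite /ind indicE; case: (_ \in _); rewrite ?mulr1 ?mulr0.
Qed.

Lemma toH_restrict f : toH (f \_ OO) = toH f :> dual R.
Proof.
apply/funext => v; apply: eq_Rintegral => x xO; rewrite restrictE indE ?mulr1//.
exact: set_mem.
Qed.

Lemma toHE f v : L1O f -> H10 v -> toH f v = ip lam (DG f) (wd v).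
Proof.
move=> Lf /H10_elim[Lv vpi vE]; rewrite ip_DG// -Rintegral_OO; last first.
  by move=> x xO; rewrite Lf.2// mul0r.
apply: eq_Rintegral => x /set_mem; rewrite OOP => /andP[x0 xpi].
by rewrite vE// !ltW.
Qed.

(* g is the derivative of (-Delta)^{-1} u, so that |u|_{-1} = |g|_{L^2}. *)
Definition represented (u : dual R) g :=
  [/\ L2O g, prim g pi = 0 & forall v, H10 v -> u v = ip lam g (wd v)].

(** [prim g] solves -w'' = u, so the solution w chosen by [inv_lap] has the defining property too.
    It is compared with [prim g] through pairings only: u(w) = (g, w')_2 = u(prim g) = |g|^2. *)
Lemma normH_represented (u : dual R) g : represented u g ->
  normH u = snorm (ip lam) g.
Proof.
move=> [Lg gpi uE].
have [Hw0 ae0] := @H10_intro g (prim g) Lg gpi (fun _ _ => erefl).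
have [Lw0 _ _] := H10_elim Hw0.
have ip0 k : L2O k -> ip lam k (wd (prim g)) = ip lam k g.
  move=> Lk; rewrite (si_sym HsO)// (si_sym HsO Lk Lg).
  exact: (ae_eq_ip Lw0.1 Lg.1 Lk.1).
pose S := [set w | H10 w /\ forall v, H10 v -> dirichlet w v = u v].
have Sw0 : S (prim g).
  split => // v Hv; have [Lv _ _] := H10_elim Hv.
  by rewrite dirichletE uE// (si_sym HsO)// ip0// (si_sym HsO).
have [Hw wE] : S (inv_lap u) by exact: xgetPex (ex_intro _ _ Sw0).
have [Lw _ _] := H10_elim Hw.
rewrite /normH /innerH /snorm uE//; congr Num.sqrt.
by rewrite (si_sym HsO)// -ip0// -dirichletE wE// uE// ip0.
Qed.

Lemma represented_toH f : L1O f -> represented (toH f) (DG f).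
Proof.
move=> Lf; split; [exact: DG_L2O|exact: prim_DG_pi|].
by move=> v Hv; rewrite toHE.
Qed.

Lemma represented_sub (u u' : dual R) g g' : represented u g -> represented u' g' ->
  represented (subH u u') (g - g').
Proof.
move=> [Lg gpi gE] [Lg' gpi' gE']; split.
- exact: (siB HsO).
- rewrite -scaleN1r primD ?primZ ?gpi ?gpi' ?mulr0 ?addr0//; try exact: L2O_L1O.
  by apply: L1OZ; exact: L2O_L1O.
- by move=> v Hv; have [Lv _ _] := H10_elim Hv; rewrite /subH gE// gE'// (si_subl HsO).
Qed.

Lemma represented_Hm1 (u : dual R) g : represented u g -> Hm1 u.
Proof.
move=> [Lg gpi uE]; split.
  move=> a v w Hv Hw; have [Hl lE] := H10_lin a Hv Hw.
  have [Lv _ _] := H10_elim Hv; have [Lw _ _] := H10_elim Hw.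
  have [Ll _ _] := H10_elim Hl.
  have Lav : L2O (a *: wd v) by apply: (siZ HsO).
  rewrite !uE// -(si_scaler HsO)// -(si_addr HsO)//.
  rewrite (si_sym HsO)// [RHS](si_sym HsO)//; last exact: (siD HsO).
  by apply: (ae_eq_ip Ll.1 _ Lg.1) => //; exact: (siD HsO Lav Lw).1.
exists (snorm (ip lam) g) => v Hv; have [Lv _ _] := H10_elim Hv.
by rewrite uE// dirichletE; exact: (snorm_cs HsO).
Qed.

Lemma eqH_normH (u w : dual R) : eqH u w -> normH u = normH w.
Proof.
move=> uw; have E : inv_lap u = inv_lap w.
  rewrite /inv_lap; congr xget; apply/seteqP; split => v [Hv vE]; split => // z Hz.
    by rewrite -uw// vE.
  by rewrite uw// vE.
rewrite /normH /innerH E uw// /inv_lap; set S := (S in xget _ S).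
have [[v Sv]|nS] := pselect (exists v, S v).
  by have [] := @xgetPex _ (cst 0) S (ex_intro _ v Sv).
(* The functionals agree on [H10] only. Without a solution, [xget] returns the zero function, which
   lies in [H10] as well. *)
rewrite xgetPN; first exact: H10_0.
by move=> v Sv; apply: nS; exists v.
Qed.

Lemma normL1E f : L1O f -> normL1 f = \int[lam]_x `|f x|.
Proof. by move=> Lf; rewrite /normL1 Rintegral_OO// => x xO; rewrite Lf.2// normr0. Qed.

Lemma normL1_restrict f : normL1 (f \_ OO) = normL1 f.
Proof.
by apply: eq_Rintegral => x /set_mem xO; rewrite restrictE indE// mulr1.
Qed.

Let gamma_elem f : L1O f -> ~ {ae lam, forall x, f x = 0} -> 0 < snorm (ip lam) (DG f).
Proof.
move=> Lf nf; rewrite lt_def snorm_ge0 andbT; apply/eqP => s0; apply: nf.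
apply: DG_eq0 => //.
by rewrite -(sqr_snorm HsO) ?s0 ?expr0n//; exact: DG_L2O.
Qed.

Let ae_restrict f : {ae lam, forall x, (f \_ OO) x = 0} ->
  {ae lam, forall x, OO x -> f x = 0}.
Proof. by apply: ae_impl => x + xO; rewrite restrictE indE// mulr1. Qed.

Lemma gamma_gt0 : 0 < gamma R.
Proof.
have spi : 0 < Num.sqrt (pi : R) by rewrite sqrtr_gt0 pi_gt0.
apply: (@lt_le_trans _ _ (Num.sqrt pi)^-1); first by rewrite invr_gt0.
apply: lb_le_inf.
  (* The set of quotients must be nonempty for its infimum to inherit the bound 1 / sqrt(pi); the
     indicator of (0, pi) is a member. *)
  exists (normL1 (ind : R -> R) / normH (toH ind)), ind; split => //.
    by apply/Lp_on1P; rewrite supp0_restrict; [exact: L1O_ind|exact: L2O_ind.2].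
  move=> [N [mN N0 HN]].
  have : (lam OO <= lam N)%E.
    apply: le_measure; rewrite ?inE//; first exact: measurable_OO.
    move=> x xO; apply: HN => /= /(_ xO); rewrite indE// => /eqP.
    by rewrite oner_eq0.
  by rewrite N0 leb_OO lee_fin leNgt pi_gt0.
move=> r [y [/Lp_on1P Ly ny ->]].
have yp := gamma_elem Ly (fun H => ny (ae_restrict H)).
rewrite -normL1_restrict -toH_restrict normL1E//.
rewrite (normH_represented (represented_toH Ly)).
rewrite ler_pdivlMr// mulrC ler_pdivrMr// mulrC; exact: snorm_DG_le.
Qed.

Lemma gamma_le f : L1O f -> gamma R * snorm (ip lam) (DG f) <= \int[lam]_x `|f x|.
Proof.
move=> Lf; have [s0|s0] := eqVneq (snorm (ip lam) (DG f)) 0.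
  by rewrite s0 mulr0 Rintegral_ge0.
have sp : 0 < snorm (ip lam) (DG f) by rewrite lt_def s0 snorm_ge0.
rewrite -ler_pdivlMr//; apply: ge_inf.
  exists 0 => r [y [_ _ ->]].
  by rewrite divr_ge0 ?sqrtr_ge0// Rintegral_ge0.
exists f; split.
- by apply/Lp_on1P; rewrite supp0_restrict//; exact: Lf.2.
- move=> H; move/eqP : s0; apply.
  have f0 : {ae lam, forall x, f x = 0}.
    apply: ae_impl H => x Hx; have [/Hx//|xO] := pselect (OO x).
    by rewrite Lf.2.
  have L0 : L1O (0 : R -> R) by exact/L2O_L1O/(si0 HsO).
  rewrite (DG_ae_eq Lf L0 f0) -(scale0r (0 : R -> R)) DGZ// scale0r /snorm.
  by rewrite -(scale0r (0 : R -> R)) (si_sqZ HsO) ?expr0n ?mul0r ?sqrtr0//; exact: (si0 HsO).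
- by rewrite normL1E// (normH_represented (represented_toH Lf)).
Qed.

End SobolevSpace.

(** * The Dirichlet eigenfunctions as test functions *)

Section Eigenfunctions.
Context {R : realType}.
Notation lam := (leb R).
Notation HsO := (@semi_inner_L2O R).
Implicit Types f g : R -> R.

Lemma prim_derive (F f : R -> R) y : (forall x : R, is_derive x (1 : R) F (f x)) ->
  continuous (f : R -> R) -> 0 <= y <= pi -> prim (fun x => f x * ind x) y = F y - F 0.
Proof.
move=> dF cf /andP[y0 ypi].
have -> : prim (fun x => f x * ind x) y = prim f y.
  rewrite -(prim_restrict f ypi); congr (prim _ y); apply/funext => x.
  by rewrite restrictE.
move: y0; rewrite le_eqVlt => /predU1P[<-|y0]; first by rewrite subrr prim_le0.
have cF : continuous F.
  move=> x; apply: differentiable_continuous; apply/derivable1_diffP.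
  exact: ex_derive.
have cy : {within `[0, y], continuous f} by exact: continuous_subspaceT.
have Iy : lam.-integrable `[0, y] (EFin \o f).
  by apply: continuous_compact_integrable => //; exact: segment_compact.
have dO : derivable_oo_LRcontinuous F 0 y.
  split => [x _| |]; first exact: ex_derive.
  - by apply: cvg_at_right_filter; exact: cF.
  - by apply: cvg_at_left_filter; exact: cF.
have dE : {in `]0, y[, derive1 F =1 f}.
  by move=> x _; rewrite derive1E (@derive_val _ _ _ _ _ _ _ (dF x)).
have := continuous_FTC2 y0 cy dO dE.
rewrite /prim => H.
rewrite Rintegral_itv_obnd_cbnd; last first.
  by apply: integrableS Iy => //; exact: subset_itv_oo_cc.
rewrite Rintegral_itv_bndo_bndc; last first.
  by apply: integrableS Iy => //; exact: subset_itv_co_cc.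
by rewrite /Rintegral H.
Qed.

Variable j : nat.
Let c : R := Num.sqrt (2 / pi).
Definition e1 (x : R) : R := Num.sqrt (2 / pi) * j%:R * cos (j%:R * x).
Definition e2 (x : R) : R := - (Num.sqrt (2 / pi) * j%:R ^+ 2 * sin (j%:R * x)).

Let is_derive_scale (x : R) : is_derive x (1 : R) ( *%R (j%:R : R)) j%:R.
Proof.
have H := is_deriveZ (j%:R : R) (is_derive_id x (1 : R)).
by apply: (is_derive_eq H); rewrite /GRing.scale/= mulr1.
Qed.

Lemma is_derive_e (x : R) : is_derive x (1 : R) (e_ j : R -> R) (e1 x).
Proof.
have H := is_deriveZ c (is_derive1_comp (is_derive_sin (j%:R * x)) (is_derive_scale x)).
by apply: (is_derive_eq H); rewrite /e1 /c /GRing.scale/=; ring.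
Qed.

Lemma is_derive_e1 (x : R) : is_derive x (1 : R) e1 (e2 x).
Proof.
have H := is_deriveZ (c * j%:R) (is_derive1_comp (is_derive_cos (j%:R * x)) (is_derive_scale x)).
by apply: (is_derive_eq H); rewrite /e2 /GRing.scale/= /c; ring.
Qed.

Lemma derive2_e x : derive1n 2 (e_ j) x = e2 x.
Proof.
have -> : derive1n 2 (e_ j) = (derive1 (derive1 (e_ j)) : R -> R) by [].
have -> : derive1 (e_ j) = e1.
  by apply/funext => y; rewrite derive1E (@derive_val _ _ _ _ _ _ _ (is_derive_e y)).
by rewrite derive1E (@derive_val _ _ _ _ _ _ _ (is_derive_e1 x)).
Qed.

Lemma continuous_e1 : continuous e1.
Proof.
move=> x; apply: differentiable_continuous; apply/derivable1_diffP.
by have [] := is_derive_e1 x.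
Qed.

Lemma continuous_e2 : continuous e2.
Proof.
move=> x; apply: cvgN; apply: cvgM; first exact: cvg_cst.
apply: (@cvg_comp _ _ _ (fun y : R => j%:R * y) sin); last exact: continuous_sin.
by apply: cvgM; [exact: cvg_cst|exact: cvg_id].
Qed.

Definition e1O x := e1 x * ind x.
Definition e2O x := e2 x * ind x.

Lemma e1O_L2O : L2O e1O.
Proof.
apply: (@L2O_bounded _ _ (Num.sqrt (2 / pi) * j%:R)).
- by apply: measurable_funM; [exact: continuous_measurable_fun continuous_e1|exact: measurable_ind].
- by move=> x xO; rewrite /e1O ind0// mulr0.
- move=> x; rewrite /e1O /e1 2!normrM /ind indicE.
  rewrite (ger0_norm (mulr_ge0 (sqrtr_ge0 _) (ler0n _ _))).
  rewrite -[leRHS]mulr1 -mulrA ler_wpM2l ?mulr_ge0 ?sqrtr_ge0//.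
  rewrite mulr_ile1 ?normr_ge0//; last by case: (_ \in _); rewrite ?normr1 ?normr0.
  by rewrite ler_norml cos_geN1 cos_le1.
Qed.

Lemma e2O_bound x : `|e2O x| <= Num.sqrt (2 / pi) * j%:R ^+ 2.
Proof.
rewrite /e2O /e2 normrM normrN normrM /ind indicE.
rewrite (ger0_norm (mulr_ge0 (sqrtr_ge0 _) (sqr_ge0 _))).
rewrite -[leRHS]mulr1 -mulrA ler_wpM2l ?mulr_ge0 ?sqrtr_ge0 ?sqr_ge0//.
rewrite mulr_ile1 ?normr_ge0//; last by case: (_ \in _); rewrite ?normr1 ?normr0.
by rewrite ler_norml sin_geN1 sin_le1.
Qed.

Lemma e2O_L2O : L2O e2O.
Proof.
apply: (L2O_bounded _ _ e2O_bound).
- by apply: measurable_funM; [exact: continuous_measurable_fun continuous_e2|exact: measurable_ind].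
- by move=> x xO; rewrite /e2O ind0// mulr0.
Qed.

Lemma prim_e1O y : 0 <= y <= pi -> prim e1O y = e_ j y.
Proof.
move=> yI; rewrite (prim_derive is_derive_e continuous_e1 yI).
by rewrite /e_ mulr0 sin0 mulr0 subr0.
Qed.

Lemma e_pi : e_ j pi = 0 :> R.
Proof.
rewrite /e_ (_ : sin _ = 0) ?mulr0//.
by elim: j => [|n IH]; rewrite ?mul0r ?sin0// -natr1 mulrDl mul1r sinDpi IH oppr0.
Qed.

Lemma H10_e : H10 (e_ j : R -> R) /\ {ae lam, forall x, wd (e_ j) x = e1O x}.
Proof.
apply: H10_intro e1O_L2O _ _ => [|y yI]; last by rewrite prim_e1O.
by rewrite prim_e1O ?e_pi// lexx pi_ge0.
Qed.

Lemma ip_wd_e g : L2O g -> ip lam g (wd (e_ j)) = ip lam g e1O.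
Proof.
move=> Lg; have [He ae] := H10_e; have [Lw _ _] := H10_elim He.
rewrite (si_sym HsO)// (si_sym HsO Lg e1O_L2O).
exact: (ae_eq_ip Lw.1 e1O_L2O.1 Lg.1).
Qed.

(** Integration by parts; the boundary value of e_j' at pi drops out because [DG f] has mean zero.
    Applied to an increment of the scheme it turns the H^{-1} pairing with e_j into the pairing of
    the flux with the second derivative of e_j, as in the definition of [solution]. *)
Lemma ip_e1O_DG f : L1O f -> ip lam (DG f) e1O = - ip lam (Gop f) e2O.
Proof.
move=> Lf; have LD := DG_L2O Lf.
have -> : ip lam (Gop f) e2O = \int[lam]_y (prim (DG f) y * e2O y).
  apply: eq_Rintegral => x _; rewrite /Gop /e2O -mulrA; congr (_ * _).
  by rewrite mulrCA /ind indicE; case: (_ \in _); rewrite ?mulr1 ?mulr0.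
rewrite integration_by_parts_prim; [|exact: L2O_L1O LD|exact: L2O_L1O e2O_L2O].
have -> : \int[lam]_x (DG f x * (prim e2O pi - prim e2O x)) =
    ip lam (DG f) (e1 pi *: ind - e1O).
  apply: eq_Rintegral => x _; have [xO|xO] := pselect (OO x); last first.
    by rewrite LD.2// !mul0r.
  congr (_ * _); rewrite subfE scalefE /e1O indE// !mulr1.
  move: xO; rewrite OOP => /andP[x0 xpi].
  rewrite !(prim_derive is_derive_e1 continuous_e2) ?lexx ?pi_ge0 ?ltW//.
  ring.
have LcI : L2O (e1 pi *: ind) by apply: (siZ HsO); exact: L2O_ind.
rewrite (si_subr HsO)//; last exact: e1O_L2O.
rewrite (si_scaler HsO)//; last exact: L2O_ind.
have -> : ip lam (DG f) ind = 0.
  rewrite -[RHS](int_DG Lf); apply: eq_Rintegral => x _.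
  have [xO|xO] := pselect (OO x); first by rewrite indE// mulr1.
  by rewrite LD.2// mul0r.
by rewrite mulr0 sub0r opprK.
Qed.

End Eigenfunctions.

(** * Scalar maximal monotone graphs *)

Section ScalarGraph.
Context {R : realType}.
Implicit Types (rho c L r e s : R) (phi : R -> R).

Definition strongly_monotone c phi :=
  forall a b, c * (a - b) ^+ 2 <= (phi a - phi b) * (a - b).

Definition lip L phi := forall a b : R, `|phi a - phi b| <= L * `|a - b|.

Lemma lip_ge0 L phi : lip L phi -> 0 <= L.
Proof.
move=> /(_ 1 0) H; have := le_trans (normr_ge0 _) H.
by rewrite subr0 normr1 mulr1.
Qed.

Lemma lip_continuous L phi : lip L phi -> continuous phi.
Proof.
move=> lL x; have L0 := lip_ge0 lL; apply/cvgrPdist_lt => e e0.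
have L1 : 0 < L + 1 by rewrite ltr_wpDl.
near=> y; apply: le_lt_trans (lL x y) _.
apply: (@le_lt_trans _ _ ((L + 1) * `|x - y|)); first by rewrite ler_wpM2r// lerDl.
rewrite -ltr_pdivlMl// mulrC; near: y.
apply/nbhs_ballP; exists (e / (L + 1)) => /=; first by rewrite divr_gt0.
by move=> z /=; rewrite mulrC.
Unshelve. all: by end_near. Qed.

(** A description without a case distinction at 0, in a form that linear arithmetic can use. *)
Lemma sign_graphP r s : sign_graph r s <-> -1 <= s <= 1 /\ s * r = `|r|.
Proof.
rewrite /sign_graph; case: ifPn => [/eqP ->|r0] /=.
  by rewrite mulr0 normr0; split => [|[]].
have nr : `|r| != 0 by rewrite normr_eq0.
split => [->|[sI sr]].
  split; last first.
    by rewrite mulrAC -expr2 -real_normK ?num_real// expr2 mulfK.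
  by rewrite -ler_norml normf_div normr_id divff.
apply: (mulIf r0); rewrite sr mulrAC -expr2 -[r ^+ 2]real_normK ?num_real//.
by rewrite expr2 mulfK.
Qed.

Lemma Psi_graphP rho phi r e : Psi_graph rho phi r e <->
  exists s, [/\ -1 <= s <= 1, s * r = `|r| & e = rho * s + phi r].
Proof.
rewrite /Psi_graph/=; split => [[s /sign_graphP[sI sr] <-]|[s [sI sr ->]]].
  by exists s.
by exists s => //; apply/sign_graphP.
Qed.

Lemma sign_mono r s r' s' : -1 <= s <= 1 -> s * r = `|r| ->
  -1 <= s' <= 1 -> s' * r' = `|r'| -> 0 <= (s - s') * (r - r').
Proof.
move=> sI sr sI' sr'.
have : s * r' <= `|r'|.
  by rewrite (le_trans (ler_norm _))// normrM ler_piMl// ler_norml.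
have : s' * r <= `|r|.
  by rewrite (le_trans (ler_norm _))// normrM ler_piMl// ler_norml.
lra.
Qed.

Lemma Psi_graph_mono rho c phi r e r' e' : 0 <= rho -> strongly_monotone c phi ->
  Psi_graph rho phi r e -> Psi_graph rho phi r' e' ->
  c * (r - r') ^+ 2 <= (e - e') * (r - r').
Proof.
move=> rho0 /(_ r r') H /Psi_graphP[s [sI sr ->]] /Psi_graphP[s' [sI' sr' ->]].
have := mulr_ge0 rho0 (sign_mono sI sr sI' sr'); lra.
Qed.

(** Psi may be multivalued, but by strong monotonicity its inverse is single-valued (take e = e')
    and Lipschitz with constant 1/c. *)
Lemma Psi_graph_lip rho c phi r e r' e' : 0 <= rho -> 0 < c ->
  strongly_monotone c phi ->
  Psi_graph rho phi r e -> Psi_graph rho phi r' e' ->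
  `|r - r'| <= c^-1 * `|e - e'|.
Proof.
move=> rho0 c0 mphi H H'; have := Psi_graph_mono rho0 mphi H H'.
rewrite ler_pdivlMl// => M.
have [->|n0] := eqVneq `|r - r'| 0; first by rewrite mulr0.
have np : 0 < `|r - r'| by rewrite lt_def n0 normr_ge0.
rewrite -(ler_pM2r np) -mulrA -expr2 real_normK ?num_real// (le_trans M)//.
by rewrite -normrM ler_norm.
Qed.

Lemma Psi_graph_growth rho L phi r e : 0 <= rho -> lip L phi -> phi 0 = 0 ->
  Psi_graph rho phi r e -> `|e| <= rho + L * `|r|.
Proof.
move=> rho0 lL phi0 /Psi_graphP[s [sI _ ->]].
apply: (le_trans (ler_normD _ _)); apply: lerD.
  by rewrite normrM (ger0_norm rho0) ler_piMr// ler_norml.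
by have := lL r 0; rewrite phi0 !subr0.
Qed.

Lemma Psi_graph_coercive rho c phi r e : 0 <= c -> strongly_monotone c phi ->
  phi 0 = 0 -> Psi_graph rho phi r e -> rho * `|r| <= e * r.
Proof.
move=> c0 /(_ r 0) + phi0 /Psi_graphP[s [_ sr ->]].
rewrite phi0 !subr0 mulrDl -mulrA sr => H; rewrite lerDl.
by apply: le_trans H; rewrite mulr_ge0// sqr_ge0.
Qed.

Lemma strongly_monotone_surj c phi : 0 < c -> strongly_monotone c phi ->
  continuous phi -> phi 0 = 0 -> forall y, exists r, phi r = y.
Proof.
(* Strong monotonicity against 0 gives phi(M) >= c M = |y| and phi(-M) <= -|y|, so the intermediate
   value theorem applies on [-M, M]. *)
move=> c0 mphi cphi phi0 y; pose M := `|y| / c.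
have M0 : 0 <= M by rewrite divr_ge0// ltW.
have [M00|Mn0] := eqVneq M 0.
  exists 0; rewrite phi0; apply/eqP; rewrite eq_sym -normr_eq0.
  by move/eqP : M00; rewrite /M mulf_eq0 invr_eq0 (gt_eqF c0) orbF.
have Mp : 0 < M by rewrite lt_def Mn0.
have cM : c * M = `|y| by rewrite /M mulrC divfK// gt_eqF.
have pM : `|y| <= phi M.
  have := mphi M 0; rewrite phi0 !subr0 expr2 mulrA cM.
  by rewrite ler_pM2r.
have pN : phi (- M) <= - `|y|.
  have := mphi (- M) 0; rewrite phi0 !subr0 sqrrN expr2 mulrA cM.
  by rewrite mulrN -mulNr ler_pM2r// lerNr.
have [] := @IVT R phi (- M) M y.
- by rewrite ge0_cp.
- exact: continuous_subspaceT.
- rewrite ge_min le_max; apply/andP; split; apply/orP.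
    by left; rewrite (le_trans pN)// lerNl ler_normr lexx orbT.
  by right; rewrite (le_trans _ pM)// ler_norm.
- by move=> r _ <-; exists r.
Qed.

(** Surjectivity of the graph: for e > rho solve phi(r) = e - rho, for e < -rho solve phi(r) = e +
    rho, and the vertical segment at 0 covers the values between. *)
Lemma graph_inverse rho c phi : 0 < rho -> 0 < c -> strongly_monotone c phi ->
  continuous phi -> phi 0 = 0 -> exists b : R -> R, forall e, Psi_graph rho phi (b e) e.
Proof.
move=> rho0 c0 mphi cphi phi0.
suff H e : exists r, Psi_graph rho phi r e by have /choice[b Hb] := H; exists b.
have sgn r : 0 <= phi r * r.
  have := mphi r 0; rewrite phi0 !subr0; apply: le_trans.
  by rewrite mulr_ge0 ?sqr_ge0// ltW.
have surj := strongly_monotone_surj c0 mphi cphi phi0.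
have [re|re] := ltP rho e.
  have [r pr] := surj (e - rho); exists r; apply/Psi_graphP; exists 1.
  split; [lra| |rewrite pr; lra].
  rewrite mul1r ger0_norm// -(@pmulr_rge0 _ (e - rho)) ?subr_gt0//.
  by rewrite -pr.
have [er|er] := ltP e (- rho).
  have [r pr] := surj (e + rho); exists r; apply/Psi_graphP; exists (- 1).
  split; [lra| |rewrite pr; lra].
  rewrite mulN1r ler0_norm// -(@nmulr_rge0 _ (e + rho)) -?ltrBrDr ?sub0r//.
  by rewrite -pr.
exists 0; apply/Psi_graphP; exists (e / rho); split.
- by rewrite ler_pdivlMr// ler_pdivrMr// mulN1r mul1r er.
- by rewrite mulr0 normr0.
- by rewrite phi0 addr0 mulrC divfK// gt_eqF.
Qed.

End ScalarGraph.

(** * The convex primitive of a monotone function *)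

Section Potential.
Context {R : realType} (phi : R -> R) (L : R).
Hypotheses (lL : lip L phi) (phi0 : phi 0 = 0).
Hypothesis mphi : {homo phi : x y / x <= y}.
Notation lam := (leb R).

Let I a b : R := \int[lam]_(t in `]a, b]) phi t.

Let phi_int a b : lam.-integrable `]a, b] (EFin \o phi).
Proof.
apply: (@integrableS _ _ _ lam `[a, b]) => //; first exact: subset_itv_oc_cc.
apply: continuous_compact_integrable; first exact: segment_compact.
by apply: continuous_subspaceT; exact: lip_continuous lL.
Qed.

Let I_add a m b : a <= m -> m <= b -> I a b = I a m + I m b.
Proof.
move=> am mb; rewrite /I (@itv_bndbnd_setU _ _ _ (BRight m)) ?bnd_simp//.
rewrite Rintegral_setU//; first by rewrite -itv_bndbnd_setU ?bnd_simp.
apply/disj_setPS => y [/=]; rewrite !in_itv/= => /andP[_ ym] /andP[my _].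
by move: (lt_le_trans my ym); rewrite ltxx.
Qed.

Let cst_int (k a b : R) : a <= b -> \int[lam]_(t in `]a, b]) k = k * (b - a).
Proof.
move=> ab; rewrite Rintegral_cst//; congr (_ * _).
transitivity (fine (lam `]a, b]%classic)) => //.
rewrite lebesgue_measure_itv/= lte_fin.
by case: ltgtP ab => //= ->; rewrite subrr.
Qed.

Let I_le a b : a <= b -> phi a * (b - a) <= I a b <= phi b * (b - a).
Proof.
move=> ab; rewrite -!cst_int//.
have ci k : lam.-integrable `]a, b] (EFin \o cst k).
  apply: (@integrableS _ _ _ lam `[a, b]) => //; first exact: subset_itv_oc_cc.
  apply: continuous_compact_integrable; first exact: segment_compact.
  by apply: continuous_subspaceT => ?; exact: cvg_cst.
apply/andP; split; apply: le_Rintegral => //; try exact: ci.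
  by move=> x /=; rewrite in_itv/= => /andP[ax xb]; apply: mphi; exact: ltW.
by move=> x /=; rewrite in_itv/= => /andP[ax xb]; exact: mphi.
Qed.

(** The oriented integral of phi from 0 to r: one of the two intervals is empty, whatever the sign
    of r. *)
Definition potential r := I 0 r - I r 0.

Let I_ge a b : b <= a -> I a b = 0.
Proof. by move=> ba; rewrite /I set_itv_ge ?Rintegral_set0// bnd_simp -leNgt. Qed.

Let potB a b : a <= b -> potential b - potential a = I a b.
Proof.
move=> ab; rewrite /potential; have [a0|a0] := leP 0 a.
  rewrite (I_ge a0) (I_ge (le_trans a0 ab)) (I_add a0 ab); lra.
have [b0|b0] := leP b 0.
  rewrite (I_ge b0) (I_ge (ltW a0)) (I_add ab b0); lra.
rewrite (I_ge (ltW b0)) (I_ge (ltW a0)) (I_add (ltW a0) (ltW b0)); lra.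
Qed.

Lemma potential_subgradient r r' : potential r - potential r' <= phi r * (r - r').
Proof.
have [rr|rr] := leP r r'.
  by have := I_le rr; have := potB rr; lra.
by have := I_le (ltW rr); have := potB (ltW rr); lra.
Qed.

Lemma potential0 : potential 0 = 0.
Proof. by rewrite /potential subrr. Qed.

Lemma potential_ge0 r : 0 <= potential r.
Proof. by have := potential_subgradient 0 r; rewrite phi0 potential0; lra. Qed.

Lemma potential_le r : potential r <= L * r ^+ 2.
Proof.
have := potential_subgradient r 0; rewrite potential0 !subr0 => /le_trans; apply.
rewrite (le_trans (ler_norm _))// normrM -[r ^+ 2]real_normK ?num_real// expr2 mulrA.
by rewrite ler_wpM2r//; have := lL r 0; rewrite phi0 !subr0.
Qed.

(** The subgradient inequality in both directions makes the potential locally Lipschitz, hence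
    continuous. *)
Lemma measurable_potential : measurable_fun setT potential.
Proof.
apply: continuous_measurable_fun => x; have L0 := lip_ge0 lL.
have H y : `|x - y| <= 1 -> `|potential x - potential y| <= L * (`|x| + 1) * `|x - y|.
  move=> xy; have := potential_subgradient x y; have := potential_subgradient y x.
  have := lL x 0; have := lL y 0; rewrite phi0 !subr0 => ply plx.
  have yx : `|y| <= `|x| + 1.
    rewrite -(subrK x y) addrC (le_trans (ler_normD _ _))// lerD2l distrC//.
  have bx : `|phi x| <= L * (`|x| + 1).
    by rewrite (le_trans plx)// ler_wpM2l// lerDl.
  have by' : `|phi y| <= L * (`|x| + 1).
    by rewrite (le_trans ply)// ler_wpM2l.
  have : phi y * (x - y) >= - (L * (`|x| + 1) * `|x - y|).
    rewrite lerNl -mulNr (le_trans (ler_norm _))// normrM normrN ler_wpM2r//.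
  have : phi x * (x - y) <= L * (`|x| + 1) * `|x - y|.
    by rewrite (le_trans (ler_norm _))// normrM ler_wpM2r.
  rewrite ler_norml => ? ? ? ?; apply/andP; split; lra.
apply/cvgrPdist_lt => e e0; pose K := L * (`|x| + 1) + 1.
have K0 : 0 < K by rewrite ltr_wpDl// mulr_ge0// addr_ge0.
near=> y.
have xy1 : `|x - y| <= 1.
  by apply/ltW; near: y; apply/nbhs_ballP; exists 1 => //=.
apply: le_lt_trans (H y xy1) _; apply: (@le_lt_trans _ _ (K * `|x - y|)).
  by rewrite ler_wpM2r// lerDl.
rewrite -ltr_pdivlMl// mulrC; near: y.
apply/nbhs_ballP; exists (e / K) => /=; first by rewrite divr_gt0.
by move=> z /=; rewrite mulrC.
Unshelve. all: by end_near. Qed.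

End Potential.

Section Convert.
Context {R : realType} (f : R -> R) (delta : R).
Hypotheses (f_lip : lipschitz f) (delta0 : 0 < delta).
Hypothesis f_der : forall r, r != 0 -> derivable f r 1.
Hypothesis f_delta : forall r, r != 0 -> delta <= derive1 f r.

Lemma lipschitz_lip : exists L, lip L f.
Proof.
have [M [_ HM]] := f_lip.
exists (M + 1) => a b; have := HM (M + 1); rewrite ltrDl ltr01 => /(_ isT (a, b)).
by rewrite /=; apply.
Qed.

Let slope a b : a < b -> (b <= 0 \/ 0 <= a) -> delta * (b - a) <= f b - f a.
Proof.
move=> ab H0; have [L lL] := lipschitz_lip.
have n0 x : x \in `]a, b[ -> x != 0.
  rewrite in_itv/= => /andP[ax xb]; apply/eqP => x0.
  by case: H0; rewrite leNgt -x0 ?xb ?ax.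
have [||c cI ->] := @MVT R f (derive1 f) a b ab.
- move=> x /n0 x0; apply: DeriveDef; first exact: f_der.
  by rewrite derive1E.
- by apply: continuous_subspaceT; exact: lip_continuous lL.
- by apply: ler_wpM2r; [rewrite subr_ge0 ltW|apply: f_delta; exact: n0].
Qed.

(** The function may have a corner at 0, so the mean value theorem is used on each side of 0 and an
    interval around 0 is split there. *)
Lemma derive_strongly_monotone : strongly_monotone delta f.
Proof.
have inc a b : a < b -> delta * (b - a) <= f b - f a.
  move=> ab; have [b0|b0] := leP b 0; first by apply: slope => //; left.
  have [a0|a0] := leP 0 a; first by apply: slope => //; right.
  have := slope a0 (or_introl (lexx 0)); have := slope b0 (or_intror (lexx 0)).
  lra.
move=> a b; case: (ltgtP a b) => [ab|ba|->]; last by rewrite !subrr expr0n !mulr0.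
  have := inc _ _ ab; have : 0 < b - a by rewrite subr_gt0.
  by move=> ? ?; nra.
have := inc _ _ ba; have : 0 < a - b by rewrite subr_gt0.
by move=> ? ?; nra.
Qed.

End Convert.

(** The form in which the limits in m are taken later: an estimate with a geometric error for every
    m. *)
Lemma geometric_le0 (R : realType) (x C q : R) : 0 < q < 1 ->
  (forall n, x <= C * q ^+ n) -> x <= 0.
Proof.
move=> /andP[q0 q1] H.
have c : (fun n => C * q ^+ n) @ \oo --> C * 0.
  by apply: cvgM; [exact: cvg_cst|apply: cvg_expr; rewrite gtr0_norm].
rewrite -(mulr0 C) -(cvg_lim _ c)//.
by apply: limr_ge; [apply/cvg_ex; eexists; exact: c|exact: nearW].
Qed.

(** * The implicit Euler scheme *)

Section Resolvent.
Context {R : realType}.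
Notation lam := (leb R).
Notation HsO := (@semi_inner_L2O R).

Lemma L2O_complete (f : nat -> R -> R) (C q : R) : 0 < q < 1 ->
  (forall n, L2O (f n)) ->
  (forall n, ip lam (f n.+1 - f n) (f n.+1 - f n) <= C * q ^+ 2 ^+ n) ->
  exists g, L2O g /\
    forall n, ip lam (f n - g) (f n - g) <= C / (1 - q) ^+ 2 * q ^+ 2 ^+ n.
Proof.
move=> qI Lf fC; have [g [Lg _ gC]] := L2_complete qI (fun n => (Lf n).1) fC.
have Hs := semi_inner_L2 lam.
have Lgi : L2O (fun x => g x * ind x).
  split; last by move=> x xO; rewrite ind0// mulr0.
  apply: (L2_le _ Lg) => [|x].
    by apply: measurable_funM; [exact: L2_measurable Lg|exact: measurable_ind].
  rewrite exprMn ler_piMr ?sqr_ge0// /ind indicE.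
  by case: (_ \in _); rewrite ?expr1n ?expr0n ?ler01.
exists (fun x => g x * ind x); split => // n; apply: le_trans (gC n).
have L1 := siB Hs (Lf n).1 Lgi.1; have L2 := siB Hs (Lf n).1 Lg.
apply: le_ip => // x; rewrite !subfE -!expr2.
have [xO|xO] := pselect (OO x); first by rewrite indE// mulr1.
by rewrite ind0// mulr0 (Lf n).2// subrr expr0n sqr_ge0.
Qed.

Lemma L2O_lip_comp (b : R -> R) (K : R) (f : R -> R) : 0 <= K ->
  (forall x y, `|b x - b y| <= K * `|x - y|) -> b 0 = 0 -> L2O f ->
  L2O (fun x => b (f x)).
Proof.
move=> K0 bK b0 Lf; have LK := siZ HsO K Lf.
split; last by move=> x xO; rewrite Lf.2.
have mb : measurable_fun setT b.
  by apply: continuous_measurable_fun; exact: (lip_continuous (L := K)).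
apply: (L2_le _ LK.1) => [|x].
  exact: (measurableT_comp mb (L2_measurable Lf.1)).
rewrite scalefE -[leLHS]real_normK ?num_real// -[leRHS]real_normK ?num_real//.
rewrite ler_sqr ?nnegrE ?normr_ge0// normrM (ger0_norm K0).
by have := bK (f x) 0; rewrite b0 !subr0.
Qed.

Lemma le_ip_sq (f g : R -> R) (K : R) : L2O f -> L2O g -> 0 <= K ->
  (forall x, `|f x| <= K * `|g x|) -> ip lam f f <= K ^+ 2 * ip lam g g.
Proof.
move=> Lf Lg K0 H; have LK := siZ HsO K Lg; rewrite -(si_sqZ HsO)//.
apply: le_ip; [exact: Lf.1|exact: Lf.1|exact: LK.1|exact: LK.1|move=> x].
rewrite !scalefE -!expr2 -[leLHS]real_normK ?num_real// -[leRHS]real_normK ?num_real//.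
by rewrite ler_sqr ?nnegrE ?normr_ge0// normrM (ger0_norm K0).
Qed.

Variables (rho delta L : R) (phi : R -> R).
Hypotheses (rho0 : 0 < rho) (delta0 : 0 < delta).
Hypotheses (mphi : strongly_monotone delta phi) (lphi : lip L phi) (phi0 : phi 0 = 0).
Variables (h : R) (f : R -> R).
Hypotheses (h0 : 0 < h) (Lf : L2O f).

Let kap : R := (pi ^+ 2)^-1.
Let tau : R := kap * h.

Let kap0 : 0 < kap. Proof. by rewrite invr_gt0 exprn_gt0// pi_gt0. Qed.
Let tau0 : 0 < tau. Proof. by rewrite mulr_gt0. Qed.

Let Fstep (v : R -> R) : R -> R := v - kap *: (Gop v - Gop f).

Let Fstep_L2O v : L2O v -> L2O (Fstep v).
Proof.
move=> Lv; apply: (siB HsO) => //; apply: (siZ HsO); apply: (siB HsO).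
  exact/Gop_L2O/L2O_L1O.
exact/Gop_L2O/L2O_L1O.
Qed.

(* v - kap G v does not increase the norm as kap |G v|^2 <= 2 (G v, v). *)
Let Fstep_nonexpansive v w : L2O v -> L2O w ->
  ip lam (Fstep v - Fstep w) (Fstep v - Fstep w) <= ip lam (v - w) (v - w).
Proof.
move=> Lv Lw; have Ld := siB HsO Lv Lw; have Ld1 := L2O_L1O Ld.
have LG := Gop_L2O Ld1; have LkG : L2O (kap *: Gop (v - w)) by exact: (siZ HsO).
have -> : Fstep v - Fstep w = (v - w) - kap *: Gop (v - w).
  apply/funext => x; rewrite GopB ?subfE; [|exact: L2O_L1O..].
  rewrite /Fstep !(subfE, scalefE).
  move: (Gop v x) (Gop w x) (Gop f x) (v x) (w x) => a b c d e; ring.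
rewrite (si_sqB HsO)// (si_scaler HsO)// (si_sqZ HsO)// ip_Gop//.
have := Gop_poincare Ld1; have := si_ge0 HsO (DG_L2O Ld1).
set D := ip lam (DG _) _ => D0 GD.
suff : kap ^+ 2 * ip lam (Gop (v - w)) (Gop (v - w)) <= kap * D.
  by have := mulr_ge0 (ltW kap0) D0; lra.
rewrite expr2 -mulrA ler_pM2l// mulrC ler_pdivrMr ?exprn_gt0 ?pi_gt0//.
by rewrite mulrC.
Qed.

(** The inclusion h eta + G Z = G f, eta in Psi(Z), is multiplied by kap and Z is added: Z + tau
    Psi(Z) contains [Fstep Z], that is, Z = J(Fstep Z) with J the inverse of id + tau Psi. J
    contracts by 1 / (1 + tau delta), and [Fstep] is nonexpansive because kap = pi^-2 matches the
    Poincare constant, so Banach's iteration converges for every h. *)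
Lemma resolvent : exists Z, L2O Z /\
  forall x, Psi_graph rho phi (Z x) ((Gop f x - Gop Z x) / h).
Proof.
have cphi := lip_continuous lphi.
have rho0' := ltW rho0.
(* id + tau Psi is again a graph of the same kind, with [tau * rho] and [phi1] as data. *)
pose phi1 r := r + tau * phi r.
have [J HJ] : exists J : R -> R, forall v, Psi_graph (tau * rho) phi1 (J v) v.
  apply: (@graph_inverse _ _ 1 phi1); rewrite ?mulr_gt0//.
  - move=> a b; rewrite mul1r /phi1.
    have := mphi a b; have := mulr_ge0 (ltW delta0) (sqr_ge0 (a - b)) => d0 H.
    have : 0 <= tau * ((phi a - phi b) * (a - b)).
      by rewrite mulr_ge0 ?(ltW tau0)// (le_trans d0 H).
    lra.
  - move=> r; apply: cvgD; first exact: cvg_id.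
    by apply: cvgM; [exact: cvg_cst|exact: cphi].
  - by rewrite /phi1 phi0 mulr0 addr0.
have [b Hb] := graph_inverse rho0 delta0 mphi cphi phi0.
have G00 : Psi_graph rho phi 0 0.
  apply/Psi_graphP; exists 0.
  by rewrite phi0 !mulr0 normr0 addr0 lerN10 ler01.
have blip x y : `|b x - b y| <= delta^-1 * `|x - y|.
  exact: (Psi_graph_lip rho0' delta0 mphi (Hb x) (Hb y)).
have b0 : b 0 = 0.
  apply/eqP; rewrite -subr_eq0 -normr_le0.
  have := Psi_graph_lip rho0' delta0 mphi (Hb 0) G00.
  by rewrite subr0 subrr normr0 mulr0.
pose th := (1 + tau * delta)^-1.
have td : 0 < 1 + tau * delta by rewrite ltr_wpDr// mulr_ge0 ?ltW.
have th0 : 0 < th by rewrite invr_gt0.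
have th1 : th < 1 by rewrite invf_lt1// ltrDl mulr_gt0.
have mphi1 : strongly_monotone (1 + tau * delta) phi1.
  move=> a c; have := mphi a c; rewrite -(ler_pM2l tau0) /phi1; lra.
have Jlip x y : `|J x - J y| <= th * `|x - y|.
  by apply: (Psi_graph_lip _ td mphi1 (HJ x) (HJ y)); rewrite mulr_ge0// ltW.
have J0 : J 0 = 0.
  apply/eqP; rewrite -subr_eq0 -normr_le0.
  have G01 : Psi_graph (tau * rho) phi1 0 0.
    apply/Psi_graphP; exists 0.
    by rewrite /phi1 phi0 !mulr0 normr0 !addr0 lerN10 ler01.
  have := Psi_graph_lip (mulr_ge0 (ltW tau0) rho0') td mphi1 (HJ 0) G01.
  by rewrite subr0 subrr normr0 mulr0.
pose T v : R -> R := fun x => J (Fstep v x).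
have T_L2O v : L2O v -> L2O (T v).
  by move=> Lv; apply: (L2O_lip_comp (ltW th0) Jlip J0); exact: Fstep_L2O.
have T_contr v w : L2O v -> L2O w ->
    ip lam (T v - T w) (T v - T w) <= th ^+ 2 * ip lam (v - w) (v - w).
  move=> Lv Lw; have LF := siB HsO (Fstep_L2O Lv) (Fstep_L2O Lw).
  have LT := siB HsO (T_L2O _ Lv) (T_L2O _ Lw).
  apply: (@le_trans _ _ (th ^+ 2 * ip lam (Fstep v - Fstep w) (Fstep v - Fstep w))).
    by apply: le_ip_sq => //; [exact: ltW|move=> x; rewrite !subfE; exact: Jlip].
  by rewrite ler_wpM2l ?sqr_ge0// Fstep_nonexpansive.
pose V n := iter n T (0 : R -> R).
have LV n : L2O (V n) by elim: n => [|n IH]; [exact: (si0 HsO)|exact: T_L2O].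
pose C := ip lam (V 1%N - V 0%N) (V 1%N - V 0%N).
have VC n : ip lam (V n.+1 - V n) (V n.+1 - V n) <= C * th ^+ 2 ^+ n.
  elim: n => [|n IH]; first by rewrite expr0 mulr1.
  apply: (le_trans (T_contr _ _ (LV n.+1) (LV n))).
  by rewrite (exprS _ n) mulrCA ler_wpM2l ?sqr_ge0.
have [W [LW WC]] := L2O_complete (introT andP (conj th0 th1)) LV VC.
set C' := C / _ in WC.
have LTW := T_L2O _ LW; have LdW := siB HsO LTW LW.
have TW0 : ip lam (T W - W) (T W - W) = 0.
  apply/eqP; rewrite eq_le (si_ge0 HsO LdW) andbT.
  apply: (@geometric_le0 _ _ (4 * C') (th ^+ 2)).
    by rewrite exprn_gt0// expr_lt1// ?ltW.
  move=> n; have LVn := LV n; have LVS := LV n.+1.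
  have L1 := siB HsO LTW LVS; have L2 := siB HsO LVS LW.
  have -> : T W - W = (T W - V n.+1) + (V n.+1 - W) by rewrite addrA subrK.
  apply: (le_trans (si_sqD_le HsO L1 L2)).
  have h1 : ip lam (T W - V n.+1) (T W - V n.+1) <= C' * th ^+ 2 ^+ n.
    rewrite (si_sqBC HsO)//; apply: (le_trans (T_contr _ _ LVn LW)).
    apply: le_trans (WC n); rewrite ler_piMl ?(si_ge0 HsO)//; first exact: (siB HsO).
    by rewrite expr_le1// ltW.
  have h2 : ip lam (V n.+1 - W) (V n.+1 - W) <= C' * th ^+ 2 ^+ n.
    apply: (le_trans (WC n.+1)); rewrite (exprS _ n) mulrCA ler_piMl//.
      by apply: le_trans (WC n); rewrite (si_ge0 HsO)//; exact: (siB HsO).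
    by rewrite expr_le1// ltW.
  lra.
have TWae := ip_ae_eq0 LdW.1 TW0.
have L1W := L2O_L1O LW; have L1f := L2O_L1O Lf.
pose eta : R -> R := h^-1 *: (Gop f - Gop W).
have Leta : L2O eta by apply: (siZ HsO); apply: (siB HsO); exact: Gop_L2O.
(* The fixed point W satisfies the inclusion almost everywhere only. Recomputing it from its flux by
   b, the inverse of Psi, changes W on a null set, hence not G W, and makes the inclusion hold at
   every point. *)
pose Z x := b (eta x).
have LZ : L2O Z.
  by apply: (L2O_lip_comp _ blip b0 Leta); rewrite invr_ge0 ltW.
have ZW : {ae lam, forall x, Z x = W x}.
  suff ZW (x : R) : (T W - W) x = 0 -> Z x = W x by exact: (@ae_impl _ _ _ lam _ _ ZW TWae).
  rewrite subfE => /eqP; rewrite subr_eq0 => /eqP TWx.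
  have := HJ (Fstep W x); rewrite -/(T W x) TWx => /Psi_graphP[s [sI sr E]].
  have HW : Psi_graph rho phi (W x) (eta x).
    apply/Psi_graphP; exists s; split => //.
    move: E; rewrite /Fstep /eta !(subfE, scalefE) /phi1 /tau.
    have hn : h != 0 by rewrite gt_eqF.
    have kn : kap != 0 by rewrite gt_eqF.
    move: kap kn (Gop f x) (Gop W x) (W x) (phi (W x)) => k kn a b' w p E.
    have E' : k * (a - b') = k * h * (rho * s + p) by lra.
    apply: (mulfI (mulf_neq0 kn hn)); rewrite -E'; field.
    by rewrite hn.
  have := Psi_graph_lip rho0' delta0 mphi (Hb (eta x)) HW.
  by rewrite subrr normr0 mulr0 normr_le0 subr_eq0 => /eqP.
exists Z; split => // x.
rewrite (Gop_ae_eq (L2O_L1O LZ) L1W ZW).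
by have := Hb (eta x); rewrite /Z {2}/eta !(subfE, scalefE) mulrC.
Qed.

End Resolvent.

Section EulerScheme.
Context {R : realType}.
Notation lam := (leb R).
Notation HsO := (@semi_inner_L2O R).

(* The scalar product of H^{-1} on L^2 functions. *)
Definition ih (f g : R -> R) : R := ip lam (DG f) (DG g).

Lemma semi_inner_ih : semi_inner (@L2O R) ih.
Proof.
split.
- exact: (si0 HsO).
- by move=> f g; exact: (siD HsO).
- by move=> a f; exact: (siZ HsO).
- by move=> f g /L2O_L1O Lf /L2O_L1O Lg; apply: (si_sym HsO); exact: DG_L2O.
- move=> f g k /L2O_L1O Lf /L2O_L1O Lg /L2O_L1O Lk.
  by rewrite /ih DGD// (si_addl HsO)//; exact: DG_L2O.
- move=> a f g /L2O_L1O Lf /L2O_L1O Lg.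
  by rewrite /ih DGZ// (si_scalel HsO)//; exact: DG_L2O.
- by move=> f /L2O_L1O Lf; apply: (si_ge0 HsO); exact: DG_L2O.
Qed.
Notation Hih := semi_inner_ih.

Variables (rho delta L : R) (phi : R -> R).
Hypotheses (rho0 : 0 < rho) (delta0 : 0 < delta).
Hypotheses (mphi : strongly_monotone delta phi) (lphi : lip L phi) (phi0 : phi 0 = 0).

(* Z_{n+1} - Z_n = h Delta eta_{n+1}, inverted as eta_{n+1} = G (Z_n - Z_{n+1}) / h,
   which carries the boundary condition. *)
Definition flux h (Z : nat -> R -> R) n : R -> R :=
  h^-1 *: (Gop (Z n) - Gop (Z n.+1)).

(** The inclusion is imposed at every point, which [resolvent] provides, so that no null sets
    accumulate over the steps. *)
Definition euler h y (Z : nat -> R -> R) :=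
  [/\ Z 0%N = y, forall n, L2O (Z n) &
      forall n x, Psi_graph rho phi (Z n.+1 x) (flux h Z n x)].

Lemma euler_exists h y : 0 < h -> L2O y -> exists Z, euler h y Z.
Proof.
move=> h0 Ly.
have /choice[S HS] (f : R -> R) : exists Z, L2O f -> L2O Z /\
    forall x, Psi_graph rho phi (Z x) ((Gop f x - Gop Z x) / h).
  have [Lf|nf] := pselect (L2O f); last by exists 0.
  by have [Z HZ] := resolvent rho0 delta0 mphi lphi phi0 h0 Lf; exists Z.
pose Z n := iter n S y.
have LZ n : L2O (Z n) by elim: n => // n /HS[].
exists Z; split => // n x; have [_ /(_ x)] := HS _ (LZ n).
by rewrite mulrC.
Qed.

(** The convex function of which the elements of Psi(r) are subgradients. *)
Definition energy (r : R) := rho * `|r| + potential phi r.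
Definition Energy f : R := \int[lam]_x energy (f x).

Let phi_homo : {homo phi : x y / x <= y}.
Proof.
move=> x y; rewrite le_eqVlt => /predU1P[->//|xy].
have := mphi y x; have yx : 0 < y - x by rewrite subr_gt0.
move=> H; have : 0 <= (phi y - phi x) * (y - x).
  by apply: le_trans H; rewrite mulr_ge0 ?sqr_ge0 ?ltW.
by rewrite pmulr_lge0// subr_ge0.
Qed.

Lemma energy_ge0 r : 0 <= energy r.
Proof. by rewrite addr_ge0 ?mulr_ge0 ?(ltW rho0)// (potential_ge0 lphi phi0 phi_homo). Qed.

Lemma energy_subgradient r r' e : Psi_graph rho phi r e ->
  energy r - energy r' <= e * (r - r').
Proof.
move=> /Psi_graphP[s [sI sr ->]].
have := potential_subgradient lphi phi_homo r r'.
have : s * r' <= `|r'|.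
  by rewrite (le_trans (ler_norm _))// normrM ler_piMl// ler_norml.
rewrite /energy -sr => H1 H2; have := ler_wpM2l (ltW rho0) H1; lra.
Qed.

Lemma energy_integrable f : L2O f -> lam.-integrable setT (EFin \o (fun x => energy (f x))).
Proof.
move=> Lf; have mf := L2O_measurable Lf; have L0 := lip_ge0 lphi.
have [I1 _] := L2O_L1O Lf; have I2 := L2_integrableM Lf.1 Lf.1.
have I1' := integrableZl measurableT rho (integrable_norm I1).
have I2' := integrableZl measurableT L I2.
have I3 : lam.-integrable setT
    (EFin \o (fun x => rho * `|f x| + L * (f x * f x))).
  have := integrableD measurableT I1' I2'.
  by under eq_fun do rewrite -!EFinM -EFinD.
apply: le_integrable I3 => //.
  apply/measurable_EFinP; apply: measurable_funD.
    by apply: measurable_funM => //; exact: measurableT_comp.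
  exact: (measurableT_comp (measurable_potential lphi phi0 phi_homo)).
move=> x _ /=; rewrite lee_fin (ger0_norm (energy_ge0 _)).
rewrite ger0_norm; last first.
  apply: addr_ge0; first exact: mulr_ge0 (ltW rho0) _.
  by apply: mulr_ge0 => //; rewrite -expr2 sqr_ge0.
by rewrite lerD2l -expr2; exact: potential_le.
Qed.

Lemma Energy_ge0 f : 0 <= Energy f.
Proof. by apply: Rintegral_ge0 => x _; exact: energy_ge0. Qed.

Section OneScheme.
Variables (h : R) (y : R -> R) (Z : nat -> R -> R).
Hypotheses (h0 : 0 < h) (HZ : euler h y Z).

Definition incr n : R -> R := Z n.+1 - Z n.

Lemma euler_L2O n : L2O (Z n). Proof. by case: HZ. Qed.
Let LZ := euler_L2O.
Lemma incr_L2O n : L2O (incr n). Proof. exact: (siB HsO). Qed.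
Let Ld := incr_L2O.

Lemma addr_incr n : Z n + incr n = Z n.+1.
Proof. by rewrite /incr addrC subrK. Qed.

Lemma fluxE n : flux h Z n = - h^-1 *: Gop (incr n).
Proof.
apply/funext => x; rewrite /flux /incr GopB; [|exact: L2O_L1O..].
rewrite !(scalefE, subfE); move: (Gop _ x) (Gop _ x) => a b; ring.
Qed.

Lemma flux_L2O n : L2O (flux h Z n).
Proof. by rewrite fluxE; apply: (siZ HsO); exact/Gop_L2O/L2O_L1O. Qed.
Let Le := flux_L2O.

(** The discrete equation tested with G f. It is used with f the increment (dissipation), the new
    value (decay) and the difference of two schemes (refinement). *)
Lemma ih_incr n f : L2O f -> ih (incr n) f = - h * ip lam (flux h Z n) f.
Proof.
move=> Lf; have LG := Gop_L2O (L2O_L1O (Ld n)).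
rewrite fluxE (si_scalel HsO)// (si_sym HsO LG Lf) ip_Gop//.
rewrite mulrA mulrNN divff ?gt_eqF// mul1r; apply: (si_sym HsO); exact/DG_L2O/L2O_L1O.
Qed.

(** The flux is a subgradient at the new value, so |Z_{n+1} - Z_n|_{-1}^2 = -h (eta_{n+1}, Z_{n+1} -
    Z_n)_2 is at most h times the loss of energy, which telescopes. *)
Lemma sum_incr n : \sum_(i < n) ih (incr i) (incr i) <= h * Energy y.
Proof.
suff H : \sum_(i < n) ih (incr i) (incr i) + h * Energy (Z n) <= h * Energy y.
  by apply: le_trans H; rewrite lerDl mulr_ge0 ?(ltW h0)// Energy_ge0.
elim: n => [|n IH]; first by rewrite big_ord0 add0r; have [-> _ _] := HZ.
rewrite big_ord_recr/=; apply: le_trans IH; rewrite -addrA lerD2l.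
rewrite ih_incr//.
have : Energy (Z n.+1) - Energy (Z n) <= ip lam (flux h Z n) (incr n).
  rewrite /Energy -RintegralB//; try exact: energy_integrable.
  apply: le_Rintegral => //.
  - have := integrableB measurableT (energy_integrable (LZ n.+1)) (energy_integrable (LZ n)).
    by under eq_fun do rewrite -EFinB.
  - exact: L2_integrableM (Le n).1 (Ld n).1.
  - by move=> x _; rewrite /incr subfE; apply: energy_subgradient; have [_ _] := HZ.
rewrite -(ler_pM2l h0).
move: (Energy (Z n.+1)) (Energy (Z n)) (ip lam _ _) => a b c; lra.
Qed.

Lemma ih_incr_le n : ih (incr n) (incr n) <= h * Energy y.
Proof.
apply: le_trans (sum_incr n.+1); rewrite big_ord_recr/= lerDr.
by apply: sumr_ge0 => i _; exact: (si_ge0 Hih).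
Qed.

Lemma euler_holder n l : ih (Z (n + l)%N - Z n) (Z (n + l)%N - Z n) <=
  l%:R * (h * Energy y).
Proof.
suff H : ih (Z (n + l)%N - Z n) (Z (n + l)%N - Z n) <=
    l%:R * \sum_(n <= i < n + l) ih (incr i) (incr i).
  apply: (le_trans H); rewrite ler_wpM2l//.
  apply: le_trans (sum_incr (n + l)); rewrite -(big_mkord xpredT (fun i => ih (incr i) (incr i))).
  rewrite (@big_cat_nat _ _ _ n 0)//= ?leq_addr// lerDr.
  by apply: sumr_ge0 => i _; exact: (si_ge0 Hih).
elim: l => [|l IH].
  by rewrite addn0 subrr mul0r -(scale0r (0 : R -> R)) (si_sqZ Hih) ?expr0n ?mul0r//; exact: (si0 Hih).
rewrite addnS big_nat_recr ?leq_addr//=.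
set S := \sum_(_ <= i < _) _ in IH *.
have S0 : 0 <= S by apply: sumr_ge0 => i _; exact: (si_ge0 Hih).
set b := ih (incr (n + l)) _.
have b0 : 0 <= b by exact: (si_ge0 Hih).
have Lx : L2O (Z (n + l)%N - Z n) by exact: (siB HsO).
have -> : Z (n + l).+1 - Z n = (Z (n + l)%N - Z n) + incr (n + l).
  by rewrite /incr [RHS]addrC addrA subrK.
rewrite (si_sqD Hih)//.
have [l0|l0] := eqVneq l 0%N.
  have -> : ih (Z (n + l)%N - Z n) (incr (n + l)) = 0.
    rewrite l0 addn0 subrr -(scale0r (0 : R -> R)) (si_scalel Hih) ?mul0r//.
    exact: (si0 Hih).
  have l1 : l.+1%:R = 1 :> R by rewrite l0.
  have l00 : l%:R = 0 :> R by rewrite l0.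
  move: IH; rewrite mulr0 addr0 l1 l00 mul0r mul1r => X0.
  by rewrite lerD2r (le_trans X0).
have lp : 0 < l%:R :> R by rewrite ltr0n lt0n.
(* Young's inequality weighted by l: with X the displacement over l steps and d the next increment,
   2 l (X, d) <= |X|^2 + l^2 |d|^2. Cancelling l is why l = 0 was treated apart. *)
have LlD : L2O (l%:R *: incr (n + l)) by exact: (siZ HsO).
have := si_bound Hih Lx LlD; rewrite (si_scaler Hih)// (si_sqZ Hih)// -/b.
move: (ih _ _) (ih _ _) IH => u X IH H; rewrite -natr1.
clearbody S b.
suff : 2 * u <= S + l%:R * b by lra.
by rewrite -(ler_pM2l lp); lra.
Qed.

(** The norm of the new value is divided out of the tested equation; the maximum with 0 covers the
    case in which it vanishes. *)
Lemma euler_decay n : snorm ih (Z n.+1) <=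
  Num.max 0 (snorm ih (Z n) - h * (rho * gamma R)).
Proof.
set a := snorm ih (Z n.+1); have a0 : 0 <= a := snorm_ge0 _ _.
rewrite le_max; have [->|an0] := eqVneq a 0; first by rewrite lexx.
apply/orP; right; have ap : 0 < a by rewrite lt_def an0.
rewrite -(ler_pM2l ap) -expr2 (sqr_snorm Hih)//.
have E : ih (Z n.+1) (Z n.+1) = ih (Z n) (Z n.+1) + ih (incr n) (Z n.+1).
  by rewrite -(si_addl Hih (LZ n) (Ld n) (LZ n.+1)) addr_incr.
rewrite E ih_incr//.
have := le_trans (ler_norm _) (snorm_cs Hih (LZ n) (LZ n.+1)); rewrite -/a.
have : rho * (gamma R * a) <= ip lam (flux h Z n) (Z n.+1).
  apply: (@le_trans _ _ (rho * \int[lam]_x `|Z n.+1 x|)).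
    by rewrite ler_pM2l//; exact/gamma_le/L2O_L1O.
  have I1 := integrable_norm (L2O_L1O (LZ n.+1)).1.
  rewrite -RintegralZl//; apply: le_Rintegral => //.
  - by have := integrableZl measurableT rho I1; under eq_fun do rewrite -EFinM.
  - exact: L2_integrableM (Le n).1 (LZ n.+1).1.
  - move=> x _; apply: (Psi_graph_coercive (ltW delta0) mphi phi0).
    by have [_ _] := HZ.
rewrite -(ler_pM2l h0); clearbody a.
move: (snorm ih (Z n)) (ih _ _) (ip _ _ _) (gamma R) => b u v g; lra.
Qed.

Lemma euler_weak j n : ip lam (DG (Z n)) (e1O j) =
  ip lam (DG y) (e1O j) + \sum_(i < n) h * ip lam (flux h Z i) (e2O j).
Proof.
elim: n => [|n IH]; first by rewrite big_ord0 addr0; have [-> _ _] := HZ.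
rewrite big_ord_recr/= addrA -IH.
rewrite -addr_incr.
have L1 := L2O_L1O (LZ n); have L1d := L2O_L1O (Ld n).
rewrite DGD// (si_addl HsO); [|exact: DG_L2O..|exact: e1O_L2O].
congr (_ + _); rewrite ip_e1O_DG// fluxE (si_scalel HsO).
- by rewrite mulrA mulrN divff ?mulN1r// gt_eqF.
- exact: Gop_L2O.
- exact: e2O_L2O.
Qed.

End OneScheme.
End EulerScheme.

(** Write |x'|^2 = |x|^2 + 2 (d, x') - |d|^2 with (d, x') = (d, w) - (d, c), and use -2 (d, c) -
    |d|^2 <= |c|^2. Here w is the vector on which monotonicity acts, and c its distance from x'. *)
Lemma si_step (R : realType) (V : lmodType R) (L : set V) (b : V -> V -> R)
    (Hb : semi_inner L b) (x x' w d c : V) : L x -> L w -> L d -> L c ->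
  x' = x + d -> x' = w - c -> b x' x' <= b x x + 2 * b d w + b c c.
Proof.
move=> Lx Lw Ld Lc xE wE; have Lx' : L x' by rewrite wE; exact: (siB Hb).
have -> : b x x = b x' x' - 2 * b d x' + b d d.
  have -> : x = x' - d by rewrite xE addrK.
  by rewrite (si_sqB Hb)// (si_sym Hb Lx' Ld).
have -> : b d x' = b d w - b d c by rewrite wE (si_subr Hb).
by have := si_ge0 Hb (siD Hb Ld Lc); rewrite (si_sqD Hb)//; lra.
Qed.

(** * Comparison of the schemes of steps h and h/2 *)

Section Refinement.
Context {R : realType}.
Notation lam := (leb R).
Notation HsO := (@semi_inner_L2O R).
Notation Hih := (@semi_inner_ih R).

Variables (rho delta L : R) (phi : R -> R).
Hypotheses (rho0 : 0 < rho) (delta0 : 0 < delta).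
Hypotheses (mphi : strongly_monotone delta phi) (lphi : lip L phi) (phi0 : phi 0 = 0).
Variables (h : R) (y : R -> R) (Z z : nat -> R -> R).
Hypotheses (h0 : 0 < h).
Hypotheses (HZ : euler rho phi h y Z) (Hz : euler rho phi (h / 2) y z).

Let h20 : 0 < h / 2. Proof. by rewrite divr_gt0. Qed.
Let LZ := euler_L2O HZ.
Let Lz := euler_L2O Hz.
Let Ld n : L2O (incr Z n) := incr_L2O HZ n.
Let Ldz n : L2O (incr z n) := incr_L2O Hz n.
Let J0 : 0 <= Energy rho phi y := Energy_ge0 rho0 delta0 mphi lphi phi0 y.

Let sum_half (a : nat -> R) n : (forall i, 0 <= a i) ->
  \sum_(k < n) a k./2 <= 2 * \sum_(i < n) a i.
Proof.
move=> a0; apply: (@le_trans _ _ (\sum_(k < n.*2) a k./2)).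
  rewrite -!(big_mkord xpredT (fun k => a k./2)).
  rewrite (@big_cat_nat _ _ _ n 0 n.*2)//= -?addnn ?leq_addr// lerDl.
  by apply: sumr_ge0.
rewrite le_eqVlt; apply/orP; left; apply/eqP; elim: n => [|n IH].
  by rewrite !big_ord0 mulr0.
rewrite doubleS !big_ord_recr/= IH uphalf_double doubleK; ring.
Qed.

Let half_alg (a b : R) : 2^-1 * (- h * a) - - (h / 2) * b = - (h / 2) * (a - b).
Proof. ring. Qed.

(* The piecewise linear interpolation of Z at the nodes of the finer grid. *)
Let P k : R -> R := Z k./2 + ((odd k)%:R / 2) *: incr Z k./2.
Let D k : R -> R := P k - z k.
Let W k : R -> R := Z (k./2).+1 - z k.+1.

Let LP k : L2O (P k). Proof. by apply: (siD HsO) => //; exact: (siZ HsO). Qed.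
Let LD k : L2O (D k). Proof. exact: (siB HsO). Qed.
Let LW k : L2O (W k). Proof. exact: (siB HsO). Qed.

Let P_even k : ~~ odd k -> P k = Z k./2.
Proof. by move=> /negbTE ok; rewrite /P ok mul0r scale0r addr0. Qed.

Let P_odd k : odd k -> P k = Z k./2 + 2^-1 *: incr Z k./2.
Proof. by move=> ok; rewrite /P ok mul1r. Qed.

Let PS k : P k.+1 = P k + 2^-1 *: incr Z k./2.
Proof.
have [ok|ok] := boolP (odd k); last first.
  have okS : odd k.+1 by rewrite /= ok.
  rewrite (P_odd okS) (P_even ok) (_ : k.+1./2 = k./2)//.
  by rewrite -[LHS]/(uphalf k) uphalf_half (negbTE ok).
have okS : ~~ odd k.+1 by rewrite /= ok.
rewrite (P_even okS) (P_odd ok) (_ : k.+1./2 = (k./2).+1).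
  apply/funext => x; rewrite !pointwiseE /incr !subfE.
  move: (Z _ x) (Z _ x) => a b; lra.
by rewrite -[LHS]/(uphalf k) uphalf_half ok.
Qed.

(** The increment of D is driven by -(h/2) times the difference of the two fluxes. These belong to
    Psi at the two new values, whose difference is W, so monotonicity yields delta |W|^2. D at k+1
    equals W for odd k and misses it by half a coarse increment for even k, whence the factor
    1/4. *)
Let step k : ih (D k.+1) (D k.+1) + h * delta * ip lam (W k) (W k) <=
  ih (D k) (D k) + 4^-1 * ih (incr Z k./2) (incr Z k./2).
Proof.
set d := incr Z k./2; have Ldd : L2O d := Ld k./2.
pose dD : R -> R := 2^-1 *: d - incr z k.
have Lhd : L2O (2^-1 *: d) := siZ HsO _ Ldd.
have LdD : L2O dD := siB HsO Lhd (Ldz k).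
pose c : R := (~~ odd k)%:R / 2.
have Lcd : L2O (c *: d) := siZ HsO _ Ldd.
have LF := flux_L2O HZ k./2; have Lf := flux_L2O Hz k.
have E4 : ih dD (W k) = - (h / 2) * ip lam (flux h Z k./2 - flux (h / 2) z k) (W k).
  rewrite /dD (si_subl Hih Lhd (Ldz k) (LW k)) (si_scalel Hih _ Ldd (LW k)).
  rewrite (ih_incr h0 HZ _ (LW k)) (ih_incr h20 Hz _ (LW k)).
  rewrite (si_subl HsO LF Lf (LW k)).
  exact: half_alg.
have ES : D k.+1 = D k + dD.
  rewrite /D /dD PS -/d /incr; apply/funext => x.
  rewrite !pointwiseE.
  move: (P k x) (d x) (z k x) (z k.+1 x) => p q a b; ring.
have c_odd : odd k -> c = 0 by move=> ok; rewrite /c ok mul0r.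
have c_even : ~~ odd k -> c = 2^-1 by move=> ok; rewrite /c ok mul1r.
have EW : D k.+1 = W k - c *: d.
  rewrite /D PS -/d /W; apply/funext => x.
  have [ok|ok] := boolP (odd k).
    rewrite (P_odd ok) -/d (c_odd ok) !pointwiseE /d /incr subfE.
    move: (Z _ x) (Z _ x) (z _ x) => a b e; lra.
  rewrite (P_even ok) (c_even ok) !pointwiseE /d /incr subfE.
  by move: (Z _ x) (Z _ x) (z _ x) => a b e; lra.
have E5 : delta * ip lam (W k) (W k) <=
    ip lam (flux h Z k./2 - flux (h / 2) z k) (W k).
  rewrite -(si_scalel HsO)//.
  apply: le_ip; [exact: (siZ HsO delta (LW k)).1|exact: (LW k).1|exact: (siB HsO LF Lf).1|exact: (LW k).1|].
  move=> x; rewrite scalefE -mulrA -expr2 /W !subfE.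
  have [_ _ GZ] := HZ; have [_ _ Gz] := Hz.
  exact: (Psi_graph_mono (ltW rho0) mphi (GZ _ x) (Gz _ x)).
have c2 : c ^+ 2 * ih d d <= 4^-1 * ih d d.
  rewrite ler_wpM2r ?(si_ge0 Hih)// /c.
  case: (odd k) => /=; first by rewrite mul0r expr0n invr_ge0.
  by rewrite mul1r exprVn -natrX.
have E1 := si_step Hih (LD k) (LW k) LdD Lcd ES EW.
move: (ler_wpM2l (ltW h0) E5) E1 c2; rewrite E4 (si_sqZ Hih _ Ldd).
move: (ih (D k) _) (ih (D k.+1) _) (c ^+ 2) (ih d d) (ip _ _ _)
  (ip _ _ _) => a1 a2 a4 a5 a6 a7.
clear E4 E5 ES EW; lra.
Qed.

Let D0 : ih (D 0) (D 0) = 0.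
Proof.
have -> : D 0%N = 0 *: y.
  have [Z0 _ _] := HZ; have [z0 _ _] := Hz.
  by rewrite /D P_even//= Z0 z0 subrr scale0r.
have Ly : L2O y by have [<- _ _] := HZ.
by rewrite (si_sqZ Hih)// expr0n mul0r.
Qed.

Let total K : ih (D K) (D K) + h * delta * \sum_(k < K) ip lam (W k) (W k) <=
  2^-1 * (h * Energy rho phi y).
Proof.
suff H : ih (D K) (D K) + h * delta * \sum_(k < K) ip lam (W k) (W k) <=
    4^-1 * \sum_(k < K) ih (incr Z k./2) (incr Z k./2).
  apply: (le_trans H).
  have := sum_half K (fun i => si_ge0 Hih (Ld i)).
  have := sum_incr rho0 delta0 mphi lphi phi0 h0 HZ K.
  move: (\sum_(i < K) _) (\sum_(k < K) _) (h * _) => a b c; lra.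
elim: K => [|K IH]; first by rewrite !big_ord0 D0 !mulr0 addr0.
rewrite !big_ord_recr/= !mulrDr.
have := step K; move: IH.
move: (h * delta * _) (h * delta * _) (4^-1 * _) (4^-1 * _) (ih _ _) (ih _ _).
by move=> a1 a2 a3 a4 a5 a6; lra.
Qed.

Lemma refinement_L2 K :
  \sum_(k < K) h / 2 * ip lam (Z (uphalf k.+1) - z k.+1) (Z (uphalf k.+1) - z k.+1) <=
  h * (Energy rho phi y / delta).
Proof.
rewrite -mulr_sumr.
have -> : \sum_(i < K) ip lam (Z (uphalf i.+1) - z i.+1) (Z (uphalf i.+1) - z i.+1) =
    \sum_(i < K) ip lam (W i) (W i) by [].
have := total K; have := si_ge0 Hih (LD K).
have S0 : 0 <= \sum_(k < K) ip lam (W k) (W k).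
  by apply: sumr_ge0 => k _; exact: (si_ge0 HsO).
move: (ih _ _) (\sum_(k < K) _) S0 (Energy _ _ _) J0 => a S S0 J Jp a0 H.
rewrite -(ler_pM2r delta0).
have -> : h * (J / delta) * delta = h * J by field; rewrite gt_eqF.
have := mulr_ge0 (ltW h0) Jp; have := mulr_ge0 (mulr_ge0 (ltW h0) (ltW delta0)) S0.
lra.
Qed.

(** [uphalf k] is the coarse index in force at the fine node k. The coarse value there differs from
    the interpolation P by half an increment at odd nodes, again of squared norm O(h). *)
Lemma refinement_Hm1 k : ih (Z (uphalf k) - z k) (Z (uphalf k) - z k) <=
  2 * (h * Energy rho phi y).
Proof.
pose c : R := (odd k)%:R / 2.
have Lcd : L2O (c *: incr Z k./2) := siZ HsO _ (Ld _).
have -> : Z (uphalf k) - z k = D k + c *: incr Z k./2.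
  apply/funext => x; rewrite /D /c; have [ok|ok] := boolP (odd k).
    have -> : uphalf k = (k./2).+1 by rewrite uphalf_half ok.
    rewrite (P_odd ok) mul1r !pointwiseE /incr subfE.
    move: (Z _ x) (Z _ x) (z _ x) => a b e; lra.
  have -> : uphalf k = k./2 by rewrite uphalf_half (negbTE ok).
  rewrite (P_even ok) !pointwiseE.
  by move: (Z _ x) (z _ x) (incr _ _ x) => a b e; rewrite !mul0r addr0.
apply: (le_trans (si_sqD_le Hih (LD k) Lcd)); rewrite (si_sqZ Hih)//.
have c2 : c ^+ 2 <= 4^-1.
  rewrite /c; case: (odd k) => /=; last by rewrite mul0r expr0n invr_ge0.
  by rewrite mul1r exprVn -natrX.
have := ih_incr_le rho0 delta0 mphi lphi phi0 h0 HZ k./2.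
have := ler_wpM2r (si_ge0 Hih (Ld k./2)) c2.
have := total k.
have : 0 <= h * delta * \sum_(k0 < k) ip lam (W k0) (W k0).
  rewrite mulr_ge0 ?mulr_ge0 ?(ltW h0) ?(ltW delta0)//.
  by apply: sumr_ge0 => i _; exact: (si_ge0 HsO).
have := mulr_ge0 (ltW h0) J0.
move: (h * Energy rho phi y) (h * delta * _) (ih _ _) (ih _ _) (c ^+ 2) => a1 a2 a3 a4 a5; lra.
Qed.

End Refinement.

(** * Functions that are piecewise constant in time *)

Section TimeGrid.
Context {R : realType}.
Implicit Types (h t : R) (k n : nat).

(** Rounding up: for k h < t <= (k+1) h the index is k+1, the implicit value, to which the flux of
    the step belongs. The time 0 keeps the index 0. *)
Definition idx h t : nat := `|Num.ceil (t / h)|%N.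

Lemma idx_bounds h t : 0 < h -> 0 <= t -> t <= (idx h t)%:R * h < t + h.
Proof.
move=> h0 t0; have th : 0 <= t / h by rewrite divr_ge0// ltW.
have c0 : 0 <= Num.ceil (t / h) by rewrite ceil_ge0 (lt_le_trans _ th)// ltrN10.
have E : (idx h t)%:R = (Num.ceil (t / h))%:~R :> R.
  by rewrite /idx natr_absz ger0_norm.
rewrite E; apply/andP; split; first by rewrite -ler_pdivrMr// ceil_ge.
rewrite -ltr_pdivlMr// mulrDl divff ?gt_eqF//.
by rewrite -ltrBlDr -[X in _ - X]/(1%:~R) -rmorphB; exact: ceilB1_lt.
Qed.

Lemma idx_unique h t n : 0 < h -> 0 <= t -> t <= n%:R * h < t + h -> idx h t = n.
Proof.
move=> h0 t0 /andP[n1 n2]; have /andP[i1 i2] := idx_bounds h0 t0.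
have H (a b : nat) : t <= a%:R * h -> b%:R * h < t + h -> (b <= a)%N.
  move=> ta bt; rewrite -ltnS -(ltr_nat R) -natr1 -(ltr_pM2r h0) mulrDl mul1r.
  by apply: (lt_le_trans bt); rewrite lerD2r.
by apply/eqP; rewrite eqn_leq !H.
Qed.

Lemma idx0 h : 0 < h -> idx h 0 = 0%N.
Proof. by move=> h0; apply: idx_unique; rewrite ?mul0r ?add0r ?lexx. Qed.

Lemma idx_uphalf h t : 0 < h -> 0 <= t -> idx h t = uphalf (idx (h / 2) t).
Proof.
move=> h0 t0; have h20 : 0 < h / 2 by rewrite divr_gt0.
have /andP[i1 i2] := idx_bounds h20 t0; move: (idx _ t) i1 i2 => k i1 i2.
apply: idx_unique => //.
have kE : k%:R = 2 * (uphalf k)%:R - (odd k)%:R :> R.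
  have E : (k + odd k = 2 * uphalf k)%N.
    by rewrite uphalf_half mulnDr !mul2n -{1}(odd_double_half k) addnAC addnn.
  by rewrite -natrM -E natrD addrK.
rewrite kE in i1 i2; case: (odd k) i1 i2 => /= i1 i2; apply/andP; split; lra.
Qed.

Lemma idx_itv h k t : 0 < h -> k%:R * h < t <= k.+1%:R * h -> idx h t = k.+1.
Proof.
move=> h0 /andP[t1 t2]; have k0 : 0 <= k%:R * h by rewrite mulr_ge0// ltW.
apply: idx_unique => //; first exact: le_trans k0 (ltW t1).
by rewrite t2/= -natr1 mulrDl mul1r ltrD2r.
Qed.

Lemma idx_le h t n : 0 < h -> 0 <= t -> t <= n%:R * h -> (idx h t <= n)%N.
Proof.
move=> h0 t0 tn; have /andP[_ i2] := idx_bounds h0 t0.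
rewrite -ltnS -(ltr_nat R) -natr1 -(ltr_pM2r h0) mulrDl mul1r.
by apply: (lt_le_trans i2); rewrite lerD2r.
Qed.

Lemma idx_mono h s t : 0 < h -> 0 <= s -> s <= t -> (idx h s <= idx h t)%N.
Proof.
move=> h0 s0 st; apply: idx_le => //.
have /andP[i1 _] := idx_bounds h0 (le_trans s0 st); exact: le_trans i1.
Qed.

End TimeGrid.

Lemma si_suml (R : realType) (V : lmodType R) (L : set V) (b : V -> V -> R)
    (Hb : semi_inner L b) n (x : 'I_n -> V) y :
  (forall i, L (x i)) -> L y ->
  L (\sum_(i < n) x i) /\ b (\sum_(i < n) x i) y = \sum_(i < n) b (x i) y.
Proof.
move=> Lx Ly; elim: n x Lx => [|n IH] x Lx.
  rewrite !big_ord0; split; first exact: (si0 Hb).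
  by rewrite -(scale0r y) (si_scalel Hb)// mul0r.
rewrite !big_ord_recr/=; have [L1 <-] := IH _ (fun i => Lx (widen_ord (leqnSn n) i)).
by split; [exact: (siD Hb)|exact: (si_addl Hb)].
Qed.

Section Tensor.
Context {R : realType}.
Notation lam := (leb R).
Notation lam2 := (leb2 R).
Notation Hs := (semi_inner_L2 lam).
Notation Hs2 := (semi_inner_L2 lam2).
Implicit Types f g : R -> R.

Definition tens f g (w : R * R) : R := f w.1 * g w.2.

Lemma measurable_tens f g : measurable_fun setT f -> measurable_fun setT g ->
  measurable_fun setT (tens f g).
Proof. by move=> mf mg; apply: measurable_funM; exact: measurableT_comp. Qed.

Lemma integral_tens_ge0 f g : measurable_fun setT f -> measurable_fun setT g ->
  (forall x, 0 <= f x) -> (forall x, 0 <= g x) ->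
  (\int[lam2]_w (tens f g w)%:E = (\int[lam]_x (f x)%:E) * (\int[lam]_x (g x)%:E))%E.
Proof.
move=> mf mg f0 g0.
rewrite (@fubini_tonelli1 _ _ _ _ _ lam lam (EFin \o tens f g)); last 2 first.
- by apply/measurable_EFinP; exact: measurable_tens.
- by move=> w; rewrite lee_fin mulr_ge0.
rewrite -ge0_integralZr//; last 3 first.
- exact/measurable_EFinP.
- by move=> x _; rewrite lee_fin.
- by apply: integral_ge0 => x _; rewrite lee_fin.
apply: eq_integral => x _; rewrite -ge0_integralZl//.
- exact/measurable_EFinP.
- by move=> y _; rewrite lee_fin.
- by rewrite lee_fin.
Qed.

Lemma L2_tens f g : L2 lam f -> L2 lam g -> L2 lam2 (tens f g).
Proof.
move=> Lf Lg; have mf := L2_measurable Lf; have mg := L2_measurable Lg.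
apply: L2I; first exact: measurable_tens.
have -> : (\int[lam2]_w (tens f g w ^+ 2)%:E =
    \int[lam2]_w (tens (fun x => f x ^+ 2) (fun x => g x ^+ 2) w)%:E)%E.
  by apply: eq_integral => w _; rewrite /tens exprMn.
rewrite integral_tens_ge0 ?(L2_ip_fin Lf) ?(L2_ip_fin Lg) ?ltry//; try exact: measurable_funX.
- by move=> x; exact: sqr_ge0.
- by move=> x; exact: sqr_ge0.
Qed.

Lemma integrable_tens f g : lam.-integrable setT (EFin \o f) ->
  lam.-integrable setT (EFin \o g) -> lam2.-integrable setT (EFin \o tens f g).
Proof.
move=> /integrableP[/measurable_EFinP mf If] /integrableP[/measurable_EFinP mg Ig].
apply/integrableP; split; first by apply/measurable_EFinP; exact: measurable_tens.
have -> : (\int[lam2]_w `|(EFin \o tens f g) w| =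
    \int[lam2]_w (tens (fun x => `|f x|) (fun x => `|g x|) w)%:E)%E.
  by apply: eq_integral => w _; rewrite /tens/= normrM.
rewrite integral_tens_ge0//; try exact: measurableT_comp.
by rewrite lte_mul_pinfty// ?integral_ge0// ge0_fin_numE ?integral_ge0.
Qed.

Lemma ip_tens f g f' g' : L2 lam f -> L2 lam g -> L2 lam f' -> L2 lam g' ->
  ip lam2 (tens f g) (tens f' g') = ip lam f f' * ip lam g g'.
Proof.
move=> Lf Lg Lf' Lg'; have I1 := L2_integrableM Lf Lf'; have I2 := L2_integrableM Lg Lg'.
have I12 := integrable_tens I1 I2.
transitivity (\int[lam2]_w (tens (fun x => f x * f' x) (fun x => g x * g' x) w)).
  by apply: eq_Rintegral => w _; rewrite /tens mulrACA.
rewrite {1}/Rintegral -integral12_prod_meas1//.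
rewrite -[ip lam f f' * _]RintegralZr//; congr fine; apply: eq_integral => x _.
rewrite /ip -RintegralZl// /Rintegral fineK//.
apply: integrable_fin_num => //.
have := integrableZl measurableT (f x * f' x) I2.
by under eq_fun do rewrite -EFinM.
Qed.

Definition itv_ind (a b : R) : R -> R := \1_(`]a, b]).

Lemma itv_indE a b x : itv_ind a b x = (a < x <= b)%R%:R.
Proof. by rewrite /itv_ind indicE mem_setE in_itv. Qed.

Lemma L2_itv_ind a b : L2 lam (itv_ind a b).
Proof.
apply: L2I; first exact: measurable_indic.
have -> : (\int[lam]_x (itv_ind a b x ^+ 2)%:E = \int[lam]_x (itv_ind a b x)%:E)%E.
  by apply: eq_integral => x _; rewrite itv_indE; case: (_ && _); rewrite ?expr1n ?expr0n.
rewrite integral_indic ?setIT//.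
have : (lam `]a, b] < +oo)%E.
  by rewrite lebesgue_measure_itv/=; case: ifP => _; rewrite -?EFinD ltry.
exact.
Qed.

Lemma int_itv_ind a b : a <= b -> \int[lam]_x itv_ind a b x = b - a.
Proof.
move=> ab; rewrite /Rintegral integral_indic ?setIT//.
transitivity (fine (lam `]a, b]%classic)) => //.
rewrite lebesgue_measure_itv/= lte_fin.
by case: ltgtP ab => //= ->; rewrite subrr.
Qed.

Lemma int_itv_ind0 a b : b <= a -> \int[lam]_x itv_ind a b x = 0.
Proof.
move=> ba; transitivity (\int[lam]_x ((fun=> 0 : R) x)); last first.
  by rewrite /Rintegral integral0.
apply: eq_Rintegral => x _; rewrite itv_indE.
by case: ltP => //= ax; rewrite leNgt (le_lt_trans ba ax).
Qed.

Lemma ip_itv_ind a b c d : a <= b -> c <= d -> b <= c ->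
  ip lam (itv_ind a b) (itv_ind c d) = 0.
Proof.
move=> ab cd bc; transitivity (\int[lam]_x ((fun=> 0 : R) x)); last first.
  by rewrite /Rintegral integral0.
apply: eq_Rintegral => x _; rewrite !itv_indE.
case: (ltP c x) => [cx|_]; last by rewrite mulr0.
by rewrite (leNgt x b) (le_lt_trans bc cx) andbF mul0r.
Qed.

Lemma ip_itv_ind_id a b : a <= b -> ip lam (itv_ind a b) (itv_ind a b) = b - a.
Proof.
move=> ab; rewrite -int_itv_ind//; apply: eq_Rintegral => x _.
by rewrite itv_indE; case: (_ && _); rewrite ?mulr1 ?mulr0.
Qed.

Lemma ip_itv_ind_min a b t : 0 <= a ->
  ip lam (itv_ind a b) (itv_ind 0 t) = \int[lam]_x itv_ind a (Num.min b t) x.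
Proof.
move=> a0; apply: eq_Rintegral => x _; rewrite !itv_indE le_min.
case: (ltP a x) => [ax|_]; last by rewrite mul0r.
by rewrite (le_lt_trans a0 ax)/=; case: (x <= b); case: (x <= t); rewrite ?mulr0 ?mulr1.
Qed.

Section Step.
Variables (h : R) (N : nat).
Hypothesis h0 : 0 < h.

Definition cell k : R -> R := itv_ind (k%:R * h) (k.+1%:R * h).

(** Written as a finite sum of products, so that measurability and scalar products reduce to one
    variable; the shift to [k.+1] is the implicit value on the cell. *)
Definition stepf (a : nat -> R -> R) : R * R -> R :=
  \sum_(k < N) tens (cell k) (a k.+1).

Let cell_le k : k%:R * h <= k.+1%:R * h.
Proof. by rewrite ler_pM2r// ler_nat. Qed.

Lemma stepfE a w : 0 < w.1 <= N%:R * h -> stepf a w = a (idx h w.1) w.2.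
Proof.
move=> /andP[w0 wN]; set n := idx h w.1.
have nN : (n <= N)%N by apply: idx_le => //; exact: ltW.
have /andP[i1 i2] := idx_bounds h0 (ltW w0); rewrite -/n in i1 i2.
have n0 : (0 < n)%N.
  by rewrite lt0n; apply/eqP => n0; move: i1; rewrite n0 mul0r leNgt w0.
have nN' : (n.-1 < N)%N by rewrite prednK.
have cn : n.-1%:R * h < w.1 <= n.-1.+1%:R * h.
  rewrite prednK// i1 andbT -(ltrD2r h).
  by rewrite -[X in _ + X]mul1r -mulrDl natr1 prednK.
have -> : stepf a w = \sum_(k < N) cell k w.1 * a k.+1 w.2.
  by rewrite /stepf fct_sumE.
rewrite (bigD1 (Ordinal nN'))//= big1 ?addr0.
  by rewrite /cell itv_indE cn mul1r prednK.
move=> k kn; rewrite /cell itv_indE.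
have [ck|_] := boolP (k%:R * h < w.1 <= k.+1%:R * h); last by rewrite mul0r.
have E1 := idx_itv h0 ck.
by case/eqP: kn; apply/val_inj => /=; rewrite /n E1.
Qed.

Lemma L2_stepf a : (forall k, L2 lam (a k)) -> L2 lam2 (stepf a).
Proof.
move=> La; have Lt (k : 'I_N) : L2 lam2 (tens (cell k) (a k.+1)).
  by apply: L2_tens => //; exact: L2_itv_ind.
by have [] := si_suml Hs2 Lt (si0 Hs2).
Qed.

Lemma ip_stepf a : (forall k, L2 lam (a k)) ->
  ip lam2 (stepf a) (stepf a) = \sum_(k < N) h * ip lam (a k.+1) (a k.+1).
Proof.
move=> La; have Lt k : L2 lam2 (tens (cell k) (a k.+1)).
  by apply: L2_tens => //; exact: L2_itv_ind.
have [_ ->] := si_suml Hs2 (fun k : 'I_N => Lt k) (L2_stepf La).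
apply: eq_bigr => k _; rewrite (si_sym Hs2)//; last exact: L2_stepf.
have [_ ->] := si_suml Hs2 (fun k : 'I_N => Lt k) (Lt k).
rewrite (bigD1 k)//= big1 ?addr0.
  rewrite ip_tens//; try exact: L2_itv_ind.
  by rewrite ip_itv_ind_id// -mulrBl -natr1 addrAC subrr add0r mul1r.
move=> l lk; rewrite ip_tens//; try exact: L2_itv_ind.
have [lk'|kl|/val_inj E] := ltngtP l k; last by rewrite E eqxx in lk.
  by rewrite ip_itv_ind ?mul0r// ler_pM2r// ler_nat.
rewrite (si_sym Hs); try exact: L2_itv_ind.
by rewrite ip_itv_ind ?mul0r// ler_pM2r// ler_nat.
Qed.

(** All cells up to the one containing t are counted in full; the last term removes the part of that
    cell beyond t. *)
Lemma ip_stepf_itv a g t : (forall k, L2 lam (a k)) -> L2 lam g ->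
  0 <= t <= N%:R * h ->
  ip lam2 (stepf a) (tens (itv_ind 0 t) g) =
  \sum_(k < idx h t) h * ip lam (a k.+1) g -
  ((idx h t)%:R * h - t) * ip lam (a (idx h t)) g.
Proof.
move=> La Lg /andP[t0 tN]; have Lt k : L2 lam2 (tens (cell k) (a k.+1)).
  by apply: L2_tens => //; exact: L2_itv_ind.
have Ltg : L2 lam2 (tens (itv_ind 0 t) g) by apply: L2_tens => //; exact: L2_itv_ind.
have [_ ->] := si_suml Hs2 (fun k : 'I_N => Lt k) Ltg.
have kh0 k : 0 <= k%:R * h by rewrite mulr_ge0// ltW.
have tE k : ip lam2 (tens (cell k) (a k.+1)) (tens (itv_ind 0 t) g) =
    (\int[lam]_x itv_ind (k%:R * h) (Num.min (k.+1%:R * h) t) x) * ip lam (a k.+1) g.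
  rewrite ip_tens//; try exact: L2_itv_ind.
  by rewrite ip_itv_ind_min.
under eq_bigr do rewrite tE.
have nN : (idx h t <= N)%N by exact: idx_le.
have /andP[i1 i2] := idx_bounds h0 t0; move: (idx h t) nN i1 i2 => n nN i1 i2.
pose F k := (\int[lam]_x itv_ind (k%:R * h) (Num.min (k.+1%:R * h) t) x) *
  ip lam (a k.+1) g.
rewrite -(big_mkord xpredT F) (@big_cat_nat _ _ _ n)//=.
rewrite [X in _ + X]big1_seq ?addr0; last first.
  move=> k; rewrite mem_index_iota => /andP[_ /andP[nk _]].
  rewrite /F int_itv_ind0 ?mul0r// ge_min; apply/orP; right.
  by apply: (le_trans i1); rewrite ler_pM2r// ler_nat.
case: n nN i1 i2 => [|n] nN i1 i2.
  rewrite big_geq// big_ord0 sub0r mul0r sub0r mulNr opprK.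
  have -> : t = 0 by apply/eqP; rewrite eq_le t0 andbT; move: i1; rewrite mul0r.
  by rewrite mul0r.
have nt : n%:R * h < t by move: i2; rewrite -natr1 mulrDl mul1r ltrD2r.
rewrite big_nat_recr//= big_ord_recr/= big_mkord.
have -> : \sum_(i < n) F i = \sum_(i < n) h * ip lam (a i.+1) g.
  apply: eq_bigr => i _; rewrite /F; congr (_ * _).
  have it : i.+1%:R * h <= t.
    by apply: le_trans (ltW nt); rewrite ler_pM2r// ler_nat.
  rewrite min_l// int_itv_ind//.
  by rewrite -mulrBl -natr1 addrAC subrr add0r mul1r.
rewrite /F min_r// int_itv_ind ?(ltW nt)// -natr1.
by move: (\sum_(i < n) _) (ip _ _ _) => A B; ring.
Qed.

End Step.
End Tensor.

Lemma le_geometric (R : realType) (x y C q : R) : 0 < q < 1 ->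
  (forall m, x <= y + C * q ^+ m) -> x <= y.
Proof.
move=> qI H; rewrite -subr_le0; apply: (geometric_le0 (C := C) qI) => m.
by rewrite lerBlDl.
Qed.

(** * Convergence of the scheme *)

Section Halves.
Context {R : realType}.

(** The rate of all limits below: squared distances are O(2^-m), so the distances are O(hq^m). *)
Definition hq : R := Num.sqrt 2^-1.

Lemma hq2 : hq ^+ 2 = 2^-1.
Proof. by rewrite sqr_sqrtr. Qed.

Lemma hqI : 0 < hq < 1.
Proof.
apply/andP; split; first by rewrite sqrtr_gt0.
by rewrite -ltr_sqr ?nnegrE ?sqrtr_ge0// hq2 expr1n invf_lt1// ltr1n.
Qed.

Lemma hq_ge0 : 0 <= hq. Proof. exact: sqrtr_ge0. Qed.

Lemma half_le_hq m : (2^-1 : R) ^+ m <= hq ^+ m.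
Proof.
have /andP[q0 q1] := hqI.
rewrite -hq2; apply: lerXn2r; rewrite ?nnegrE ?exprn_ge0 ?(ltW q0)//.
by rewrite expr2 ler_piMr ?(ltW q0) ?(ltW q1).
Qed.

Lemma sqrt_half (C : R) m : 0 <= C -> Num.sqrt (C * 2^-1 ^+ m) = Num.sqrt C * hq ^+ m.
Proof.
move=> C0; rewrite sqrtrM// -hq2 -exprM mulnC exprM sqrtr_sqr ger0_norm//.
by rewrite exprn_ge0// hq_ge0.
Qed.

End Halves.

Section Limit.
Context {R : realType}.
Notation lam := (leb R).
Notation HsO := (@semi_inner_L2O R).
Notation q := (hq : R).
Notation nrm := (snorm (ip lam)).

Lemma snorm_DG_le_L2 f : L2O f -> nrm (DG f) <= pi * nrm f.
Proof.
move=> Lf; have L1 := L2O_L1O Lf; have LD := DG_L2O L1; have LG := Gop_L2O L1.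
have [->|n0] := eqVneq (nrm (DG f)) 0.
  by rewrite mulr_ge0 ?pi_ge0// snorm_ge0.
have np : 0 < nrm (DG f) by rewrite lt_def n0 snorm_ge0.
rewrite -(ler_pM2r np) -expr2 (sqr_snorm HsO LD) -ip_Gop//.
have := le_trans (ler_norm _) (snorm_cs HsO Lf LG); move/le_trans; apply.
rewrite mulrAC mulrC ler_wpM2r ?snorm_ge0//.
rewrite -ler_sqr ?nnegrE ?mulr_ge0 ?pi_ge0 ?snorm_ge0// exprMn.
by rewrite (sqr_snorm HsO LG) (sqr_snorm HsO LD) Gop_poincare.
Qed.

Variables (rho delta L : R) (phi : R -> R).
Hypotheses (rho0 : 0 < rho) (delta0 : 0 < delta).
Hypotheses (mphi : strongly_monotone delta phi) (lphi : lip L phi) (phi0 : phi 0 = 0).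
Variables (T : R) (y : R -> R).
Hypotheses (T0 : 0 < T) (Ly : L2O y).

Definition mesh m : R := T * 2^-1 ^+ m.

Lemma mesh_gt0 m : 0 < mesh m.
Proof. by rewrite mulr_gt0// exprn_gt0. Qed.

Lemma meshS m : mesh m.+1 = mesh m / 2.
Proof. by rewrite /mesh exprSr mulrA. Qed.

Lemma mesh_le m : mesh m <= T * q ^+ m.
Proof. by rewrite ler_wpM2l ?(ltW T0)// half_le_hq. Qed.

Variable Z : nat -> nat -> R -> R.
Hypothesis HZ : forall m, euler rho phi (mesh m) y (Z m).

Let LZ m k : L2O (Z m k) := euler_L2O (HZ m) k.
Let E : R := Energy rho phi y.
Let E0 : 0 <= E := Energy_ge0 rho0 delta0 mphi lphi phi0 y.

Definition Um m t : R -> R := DG (Z m (idx (mesh m) t)).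

Lemma Um_L2O m t : L2O (Um m t).
Proof. exact/DG_L2O/L2O_L1O. Qed.

Lemma Um_step m t : 0 <= t ->
  ip lam (Um m.+1 t - Um m t) (Um m.+1 t - Um m t) <= 2 * (T * E) * q ^+ 2 ^+ m.
Proof.
move=> t0; rewrite (si_sqBC HsO); [|exact: Um_L2O..].
rewrite /Um (idx_uphalf (mesh_gt0 m) t0) -meshS -DGB; [|exact: L2O_L1O..].
have HZS : euler rho phi (mesh m / 2) y (Z m.+1) by rewrite -meshS.
have := refinement_Hm1 rho0 delta0 mphi lphi phi0 (mesh_gt0 m) (HZ m) HZS
  (idx (mesh m.+1) t).
by rewrite /ih hq2 /mesh -/E -!mulrA [E * _]mulrC.
Qed.

(** The limit is taken at each t separately, but the constant comes from [refinement_Hm1], which is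
    uniform over the nodes. *)
Lemma U_exists : exists U : R -> R -> R, exists C : R, 0 <= C /\
  forall t, 0 <= t <= T -> L2O (U t) /\ forall m, nrm (Um m t - U t) <= C * q ^+ m.
Proof.
pose C := 2 * (T * E) / (1 - q) ^+ 2.
have C0 : 0 <= C by rewrite divr_ge0 ?sqr_ge0// !mulr_ge0// ltW.
have /choice[U HU] (t : R) : exists U : R -> R, 0 <= t <= T ->
    L2O U /\ forall m, nrm (Um m t - U) <= Num.sqrt C * q ^+ m.
  have [tI|nt] := pselect (0 <= t <= T); last by exists 0.
  have /andP[t0 _] := tI.
  have [U [LU UC]] := L2O_complete hqI (fun m => Um_L2O m t) (fun m => Um_step m t0).
  exists U => _; split => // m.
  rewrite -sqrt_half// -hq2 /snorm ler_wsqrtr//; exact: UC.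
exists U, (Num.sqrt C); split; first exact: sqrtr_ge0.
by move=> t tI; exact: HU.
Qed.

Variables (U : R -> R -> R) (C : R).
Hypothesis C0 : 0 <= C.
Hypothesis HU : forall t, 0 <= t <= T ->
  L2O (U t) /\ forall m, nrm (Um m t - U t) <= C * q ^+ m.

(** Mean zero is a closed condition in L^2; it makes [U t] the derivative of an element of H^1_0. *)
Lemma U_prim t : 0 <= t <= T -> prim (U t) pi = 0.
Proof.
move=> tI; have [LU HUm] := HU tI.
have H m : prim (U t) pi ^+ 2 <= pi * C ^+ 2 * (2^-1) ^+ m.
  have Ld := siB HsO (Um_L2O m t) LU.
  have -> : prim (U t) pi ^+ 2 = prim (Um m t - U t) pi ^+ 2.
    rewrite -scaleN1r primD ?primZ; try exact: L2O_L1O.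
    - by rewrite /Um prim_DG_pi ?add0r ?mulN1r ?sqrrN//; exact: L2O_L1O.
    - exact/L2O_L1O/Um_L2O.
    - by apply: L1OZ; exact: L2O_L1O.
  apply: (le_trans (prim_cauchy_schwarz _ Ld)).
  rewrite -mulrA ler_wpM2l ?pi_ge0// -(sqr_snorm HsO Ld) -hq2 (exprAC _ 2 m) -exprMn.
  by rewrite ler_sqr ?nnegrE ?snorm_ge0 ?mulr_ge0 ?exprn_ge0 ?hq_ge0.
apply/eqP; rewrite -sqrf_eq0 eq_le sqr_ge0 andbT.
by apply: (geometric_le0 _ H); rewrite invr_gt0 ltr0n/= invf_lt1// ltr1n.
Qed.

Lemma U0_norm : nrm (U 0) = nrm (DG y).
Proof.
have tI : (0 : R) <= 0 <= T by rewrite lexx ltW.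
have [LU HUm] := HU tI; have LD : L2O (DG y) by exact/DG_L2O/L2O_L1O.
apply/eqP; rewrite -subr_eq0 -normr_le0.
apply: (geometric_le0 hqI (C := C)) => m.
apply: le_trans (HUm m); rewrite distrC; have [Z0 _ _] := HZ m.
have -> : Um m 0 = DG y by rewrite /Um idx0 ?Z0//; exact: mesh_gt0.
exact: (ler_snorm_dist HsO).
Qed.

Lemma U_holder s t : 0 <= s -> s <= t -> t <= T ->
  nrm (U t - U s) <= Num.sqrt E * Num.sqrt (t - s).
Proof.
move=> s0 st tT; have t0 := le_trans s0 st.
have [LUt Ut] := HU (introT andP (conj t0 tT)).
have [LUs Us] := HU (introT andP (conj s0 (le_trans st tT))).
apply: (le_geometric (C := 2 * C + Num.sqrt E * Num.sqrt T) hqI) => m.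
have h0 := mesh_gt0 m.
have H : nrm (Um m t - Um m s) <= Num.sqrt E * Num.sqrt (t - s) +
    Num.sqrt E * Num.sqrt T * q ^+ m.
  have /andP[_ it] := idx_bounds h0 t0.
  have /andP[is' _] := idx_bounds h0 s0.
  have ist := idx_mono h0 s0 st.
  have := euler_holder rho0 delta0 mphi lphi phi0 h0 (HZ m)
    (idx (mesh m) s) (idx (mesh m) t - idx (mesh m) s)%N.
  rewrite subnKC// -/E /ih DGB; [|exact: L2O_L1O..].
  rewrite -/(Um m t) -/(Um m s) mulrA natrB// => Hh.
  have lh : (((idx (mesh m) t)%:R - (idx (mesh m) s)%:R) * mesh m) * E <=
      (t - s + mesh m) * E.
    by apply: ler_wpM2r => //; rewrite mulrBl; lra.
  apply: (@le_trans _ _ (Num.sqrt ((t - s + mesh m) * E))).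
    by rewrite ler_wsqrtr// (le_trans Hh lh).
  have ts0 : 0 <= t - s by rewrite subr_ge0.
  have m0 := ltW h0.
  have -> : Num.sqrt E * Num.sqrt (t - s) + Num.sqrt E * Num.sqrt T * q ^+ m =
      Num.sqrt (E * (t - s)) + Num.sqrt (E * mesh m).
    rewrite /mesh mulrA sqrt_half; last exact: mulr_ge0 E0 (ltW T0).
    by rewrite !(sqrtrM _ E0).
  rewrite mulrC mulrDr -ler_sqr ?nnegrE ?addr_ge0 ?sqrtr_ge0//.
  have a0 := mulr_ge0 E0 ts0; have b0 := mulr_ge0 E0 m0.
  rewrite sqrrD (sqr_sqrtr (addr_ge0 a0 b0)) (sqr_sqrtr a0) (sqr_sqrtr b0).
  by rewrite lerD2r lerDl mulrn_wge0// mulr_ge0// sqrtr_ge0.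
have LUmt := Um_L2O m t; have LUms := Um_L2O m s.
have h1 := ler_snorm_trans HsO LUt LUmt LUs.
have h2 := ler_snorm_trans HsO LUmt LUms LUs.
have h3 := Ut m; have h4 := Us m.
rewrite (snormBC HsO LUmt LUt) in h3.
move: h1 h2 h3 h4 H; rewrite mulrDl -(mulrA 2).
move: (nrm _) (nrm _) (nrm _) (nrm _) (nrm _) (C * _) (_ * Num.sqrt T * _) (_ * Num.sqrt (t - s)).
move=> a1 a2 a3 a4 a5 a6 a7 a8; lra.
Qed.

(** The discrete decay is iterated over the steps between s and t; the maximum with 0 is stable
    under the iteration since the subtracted quantities are nonnegative. *)
Lemma U_decay s t : 0 <= s -> s <= t -> t <= T ->
  nrm (U t) <= Num.max 0 (nrm (U s) - rho * gamma R * (t - s)).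
Proof.
move=> s0 st tT; have t0 := le_trans s0 st.
have [LUt Ut] := HU (introT andP (conj t0 tT)).
have [LUs Us] := HU (introT andP (conj s0 (le_trans st tT))).
have g0 : 0 < rho * gamma R by rewrite mulr_gt0// gamma_gt0.
set g := rho * gamma R in g0 *.
apply: (le_geometric (C := 2 * C + g * T) hqI) => m.
have h0 := mesh_gt0 m.
have /andP[it _] := idx_bounds h0 t0.
have /andP[_ is'] := idx_bounds h0 s0.
have ist := idx_mono h0 s0 st.
(* Rounding may lose up to one step between s and t; that step costs at most g T hq^m. *)
have h3 : (t - s) * g <= (idx (mesh m) t - idx (mesh m) s)%N%:R * mesh m * g + mesh m * g.
  rewrite -mulrDl ler_pM2r// natrB// mulrBl; move: it is'.
  by move: (mesh m) (_ * mesh m) (_ * mesh m) => a b c; lra.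
have h4 : mesh m * g <= g * T * q ^+ m.
  by rewrite mulrC -mulrA ler_pM2l// mesh_le.
have D n l : snorm (@ih R) (Z m (n + l)%N) <=
    Num.max 0 (snorm (@ih R) (Z m n) - l%:R * mesh m * g).
  elim: l => [|l IH]; first by rewrite addn0 !mul0r subr0 le_max lexx orbT.
  rewrite addnS; have := euler_decay rho0 delta0 mphi phi0 h0 (HZ m) (n + l).
  rewrite -/g => H; apply: (le_trans H); rewrite ge_max le_max lexx/=.
  move: IH; rewrite !le_max -natr1 => /orP[IH|IH].
    apply/orP; left; rewrite subr_le0 (le_trans IH)// mulr_ge0// ltW//.
  apply/orP; right; move: IH; move: (snorm _ _) (snorm _ _) (mesh m) => a b c.
  by clearbody g; lra.
have := D (idx (mesh m) s) (idx (mesh m) t - idx (mesh m) s)%N.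
rewrite subnKC// -[snorm _ _]/(nrm (Um m t)) -[snorm _ (Z m _)]/(nrm (Um m s)) => H.
have h1 : nrm (U t) <= nrm (Um m t) + C * q ^+ m.
  have := le_trans (ler_snorm_dist HsO (Um_L2O m t) LUt) (Ut m).
  rewrite ler_norml => /andP[]; move: (nrm _) (nrm _) (C * _) => a b c; lra.
have h2 : nrm (Um m s) <= nrm (U s) + C * q ^+ m.
  have := le_trans (ler_snorm_dist HsO (Um_L2O m s) LUs) (Us m).
  rewrite ler_norml => /andP[]; move: (nrm _) (nrm _) (C * _) => a b c; lra.
have Cq : 0 <= C * q ^+ m := mulr_ge0 C0 (exprn_ge0 m hq_ge0).
have gTq : 0 <= g * T * q ^+ m.
  exact: mulr_ge0 (mulr_ge0 (ltW g0) (ltW T0)) (exprn_ge0 m hq_ge0).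
rewrite mulrDl -(mulrA 2).
move: H; rewrite le_max => /orP[H|H].
  have : 0 <= Num.max 0 (nrm (U s) - g * (t - s)) by rewrite le_max lexx.
  move: H h1 Cq gTq; move: (nrm _) (nrm _) (C * _) (g * T * _) (Num.max _ _).
  by move=> a b c d M; lra.
have : nrm (U s) - g * (t - s) <= Num.max 0 (nrm (U s) - g * (t - s)).
  by rewrite le_max lexx orbT.
move: H h1 h2 h3 h4 Cq gTq; rewrite ![g * (t - s)]mulrC.
move: (nrm _) (nrm _) (nrm _) (nrm _) (C * _) (g * T * _)
  ((t - s) * g) (mesh m * g) (_ * mesh m * g) (Num.max _ _).
by move=> a0 a1 a2 a3 a4 a5 a6 a7 a8 M; lra.
Qed.

End Limit.

Section Preliminaries.
Context {R : realType}.
Notation lam := (leb R).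
Notation lam2 := (leb2 R).
Notation Hs := (semi_inner_L2 lam).
Notation Hs2 := (semi_inner_L2 lam2).

Lemma stepf0 (h : R) N a w : 0 < h -> ~~ (0 < w.1 <= N%:R * h) -> stepf h N a w = 0.
Proof.
move=> h0 wN; rewrite /stepf fct_sumE big1// => k _.
rewrite /tens /cell itv_indE; case: (boolP (_ < _ <= _)) => [/andP[w1 w2]|_]; last by rewrite mul0r.
case/negP: wN; apply/andP; split.
  by apply: le_lt_trans w1; rewrite mulr_ge0// ltW.
by apply: (le_trans w2); rewrite ler_pM2r// ler_nat.
Qed.

Lemma mid_hull_ball d (S : measurableType d) (u : nat -> S -> R) n g x c r :
  mid_hull u n g -> (forall k, (n <= k)%N -> `|u k x - c| <= r) -> `|g x - c| <= r.
Proof.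
move=> H Hu; elim: H => [k nk|f f' _ IH _ IH']; first exact: Hu.
have -> : (2^-1 *: (f + f')) x - c = 2^-1 * ((f x - c) + (f' x - c)).
  by rewrite !pointwiseE; move: (f x) (f' x) => a b; lra.
rewrite normrM ger0_norm ?invr_ge0//; have := ler_normD (f x - c) (f' x - c); lra.
Qed.

(* Off 0 the sign of z_n is eventually constant, so that e_n converges too; at 0
   only |e| <= rho is needed. *)
Lemma Psi_graph_closed (rho L : R) (phi : R -> R) d (S : measurableType d)
    (z_ e_ g_ : nat -> S -> R) (x : S) (z e : R) :
  0 < rho -> lip L phi -> phi 0 = 0 ->
  (forall n, Psi_graph rho phi (z_ n x) (e_ n x)) ->
  (forall n, mid_hull e_ n (g_ n)) ->
  (fun n => z_ n x) @ \oo --> z -> (fun n => g_ n x) @ \oo --> e ->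
  Psi_graph rho phi z e.
Proof.
move=> rho0 lphi phi0 Hg hg cz ce; have L0 := lip_ge0 lphi.
have L1 : 0 < L + 1 by rewrite ltr_wpDl.
(* Balls are convex: an eventual bound on the e_k passes to the hull elements g_n and then to their
   limit. *)
have lim c r : (forall eps, 0 < eps -> \forall k \near \oo, `|e_ k x - c| <= r + eps) ->
    `|e - c| <= r.
  move=> H; apply/ler_addgt0Pr => eps eps0.
  have [N _ HN] := H _ eps0.
  have cg : (fun n => `|g_ n x - c|) @ \oo --> `|e - c|.
    by apply: cvg_norm; apply: cvgB => //; exact: cvg_cst.
  rewrite -(cvg_lim _ cg)//; apply: limr_le; first by apply/cvg_ex; eexists; exact: cg.
  exists N => // n /= Nn; apply: (mid_hull_ball (hg n)) => k nk.
  exact/HN/(leq_trans Nn).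
have phi_near eps : 0 < eps -> \forall k \near \oo, `|phi (z_ k x) - phi z| <= eps.
  move=> eps0; have /cvgrPdist_lt/(_ (eps / (L + 1))) := cz.
  rewrite divr_gt0// => /(_ isT); apply: filterS => k zk.
  apply: (le_trans (lphi _ _)); rewrite distrC.
  apply: (@le_trans _ _ ((L + 1) * `|z - z_ k x|)).
    by rewrite ler_wpM2r// lerDl.
  by rewrite -ler_pdivlMl// mulrC ltW.
have [z0|zn0] := eqVneq z 0.
  have er : `|e| <= rho.
    rewrite -(subr0 e); apply: lim => eps eps0.
    apply: filterS (phi_near _ eps0) => k; rewrite z0 phi0 !subr0 => Hk.
    have /Psi_graphP[s [sI _ ->]] := Hg k.
    apply: (le_trans (ler_normD _ _)); apply: lerD => //.
    by rewrite normrM (ger0_norm (ltW rho0)) ler_piMr ?(ltW rho0)// ler_norml.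
  apply/Psi_graphP; exists (e / rho); split.
  - by rewrite -ler_norml normf_div (gtr0_norm rho0) ler_pdivrMr// mul1r.
  - by rewrite z0 mulr0 normr0.
  - by rewrite z0 phi0 addr0 mulrC divfK// gt_eqF.
have nz : 0 < `|z| by rewrite normr_gt0.
apply/Psi_graphP; exists (z / `|z|); split.
- by rewrite -ler_norml normf_div normr_id divff// gt_eqF.
- by rewrite mulrAC -expr2 -[z ^+ 2]real_normK ?num_real// expr2 mulfK// gt_eqF.
apply/eqP; rewrite -subr_eq0 -normr_le0; apply: lim => eps eps0.
have /cvgrPdist_lt/(_ _ nz) := cz.
apply: filterS2 (phi_near _ eps0) => k Hk zk; rewrite add0r.
have /Psi_graphP[s [sI sz ->]] := Hg k.
suff -> : s = z / `|z|.
  by rewrite opprD addrACA subrr add0r.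
(* Once |z - z_k| < |z|, both have the same strict sign, which determines s. *)
have zz : 0 < z * z_ k x.
  have : z * z_ k x = z ^+ 2 - z * (z - z_ k x) by rewrite expr2; move: (z_ k x) => b; ring.
  move=> ->; rewrite subr_gt0 (le_lt_trans (ler_norm _))// normrM.
  by rewrite -[z ^+ 2]real_normK ?num_real// expr2 ltr_pM2l.
have zkn : z_ k x != 0 by apply/eqP => E; move: zz; rewrite E mulr0 ltxx.
apply: (mulIf zkn); rewrite sz; apply: (mulfI (lt0r_neq0 nz)).
rewrite -normrM (gtr0_norm zz) mulrA; congr (_ * _).
by rewrite mulrCA divff ?mulr1// gt_eqF.
Qed.

Definition itv_oo (a b : R) : R -> R := \1_(`]a, b[).

(** Fubini's theorem for the integral in [solution]. The open time interval there and the half-open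
    cells of the step functions differ by the null set {t}. *)
Lemma iterated_integral (f : R * R -> R) (g : R -> R) (t : R) :
  L2 lam2 f -> L2 lam g -> 0 <= t ->
  \int[lam]_(s in `]0, t[) \int[lam]_xi (f (s, xi) * g xi) =
  ip lam2 f (tens (itv_ind 0 t) g).
Proof.
move=> Lf Lg t0.
have Lo : L2 lam (itv_oo 0 t).
  apply: (L2_le _ (L2_itv_ind 0 t)); first exact: measurable_indic.
  move=> x; rewrite /itv_oo indicE mem_setE in_itv itv_indE/=.
  have [/andP[x0 xt]|_] := boolP (0 < x < t); first by rewrite x0 (ltW xt) lexx.
  by rewrite expr0n sqr_ge0.
have Lto := L2_tens Lo Lg; have Lti := L2_tens (L2_itv_ind 0 t) Lg.
have -> : ip lam2 f (tens (itv_ind 0 t) g) = ip lam2 f (tens (itv_oo 0 t) g).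
  apply/eqP; rewrite -subr_eq0 -(si_subr Hs2)//.
  have Ld : L2 lam (itv_ind 0 t - itv_oo 0 t) := siB Hs (L2_itv_ind 0 t) Lo.
  have -> : tens (itv_ind 0 t) g - tens (itv_oo 0 t) g = tens (itv_ind 0 t - itv_oo 0 t) g.
    by apply/funext => w; rewrite /tens !pointwiseE; move: (itv_ind _ _ _) (itv_oo _ _ _) (g _) => a b c; ring.
  have LT := L2_tens Ld Lg; rewrite -normr_le0.
  apply: (le_trans (snorm_cs Hs2 Lf LT)).
  have -> : snorm (ip lam2) (tens (itv_ind 0 t - itv_oo 0 t) g) = 0.
    rewrite /snorm ip_tens//.
    have -> : ip lam (itv_ind 0 t - itv_oo 0 t) (itv_ind 0 t - itv_oo 0 t) = 0.
      transitivity (\int[lam]_x ((fun=> 0 : R) x)); last by rewrite /Rintegral integral0.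
      congr fine; apply: ae_eq_integral => //.
        by have /integrableP[] := L2_integrableM Ld Ld.
      exists [set t]; split => //; first exact: lebesgue_measure_set1.
      move=> x /=; apply: contra_notP => /eqP xt _; congr EFin.
      rewrite pointwiseE itv_indE /itv_oo indicE mem_setE in_itv/=.
      by rewrite le_eqVlt (negbTE xt)/= subrr mul0r.
    by rewrite mul0r sqrtr0.
  by rewrite mulr0.
have If := L2_integrableM Lf Lto.
pose F s := (\int[lam]_xi (f (s, xi) * tens (itv_oo 0 t) g (s, xi))%:E)%E.
have IF : lam.-integrable setT F := integrable_fubini_F If.
transitivity (fine (\int[lam]_s F s)%E).
  2: by congr fine; exact: (integral12_prod_meas1 If).
rewrite Rintegral_mkcond; congr fine.
(* The inner integral is finite for almost every s only, whereas the real-valued integral applies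
   [fine] for all s. *)
transitivity (\int[lam]_s (fine (F s))%:E)%E.
  apply: eq_integral => s _; congr EFin; rewrite patchE mem_setE in_itv/= /F.
  have [st|nst] := boolP (0 < s < t).
    congr fine; apply: eq_integral => xi _; congr EFin.
    by rewrite /tens/= /itv_oo indicE mem_setE in_itv/= st mul1r.
  rewrite [X in fine X](_ : _ = 0%E)//; apply: integral0_eq => xi _.
  by rewrite /tens/= /itv_oo indicE mem_setE in_itv/= (negbTE nst) mul0r mulr0.
have mF := measurable_int lam IF.
apply: ae_eq_integral => //.
  by apply/measurable_EFinP; exact: (measurableT_comp (fine_measurable measurableT)).
have := integrable_ae measurableT IF; apply: ae_impl => s /(_ I) Fs _.
by rewrite fineK.
Qed.

End Preliminaries.

Section Solution.
Context {R : realType}.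
Notation lam := (leb R).
Notation lam2 := (leb2 R).
Notation HsO := (@semi_inner_L2O R).
Notation Hs := (semi_inner_L2 lam).
Notation Hs2 := (semi_inner_L2 lam2).
Notation q := (hq : R).
Notation nrm := (snorm (ip lam)).

Variables (rho delta L : R) (phi : R -> R).
Hypotheses (rho0 : 0 < rho) (delta0 : 0 < delta).
Hypotheses (mphi : strongly_monotone delta phi) (lphi : lip L phi) (phi0 : phi 0 = 0).
Variables (T : R) (y : R -> R).
Hypotheses (T0 : 0 < T) (Ly : L2O y).
Variable Z : nat -> nat -> R -> R.
Hypothesis HZ : forall m, euler rho phi (mesh T m) y (Z m).
Variables (U : R -> R -> R) (C : R).
Hypothesis C0 : 0 <= C.
Hypothesis HU : forall t, 0 <= t <= T ->
  L2O (U t) /\ forall m, nrm (Um T Z m t - U t) <= C * q ^+ m.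

Let h0 m : 0 < mesh T m := mesh_gt0 T0 m.
Let LZ m k : L2O (Z m k) := euler_L2O (HZ m) k.
Let E : R := Energy rho phi y.
Let E0 : 0 <= E := Energy_ge0 rho0 delta0 mphi lphi phi0 y.

Let gridE m : (2 ^ m)%:R * mesh T m = T.
Proof. by rewrite /mesh natrX mulrCA -exprMn divff ?expr1n ?mulr1// pnatr_eq0. Qed.

Definition zs m : R * R -> R := stepf (mesh T m) (2 ^ m) (Z m).
(** The shift [k.-1] undoes that of [stepf]: the cell k carries flux k, an element of Psi at the
    value [Z k.+1] of [zs] there. *)
Definition es m : R * R -> R :=
  stepf (mesh T m) (2 ^ m) (fun k => flux (mesh T m) (Z m) k.-1).

Let Lflux m k : L2O (flux (mesh T m) (Z m) k) := flux_L2O (HZ m) k.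

Let L2zs m : L2 lam2 (zs m).
Proof. by apply: L2_stepf => // k; case: (LZ m k). Qed.

Let L2es m : L2 lam2 (es m).
Proof. by apply: L2_stepf => // k; case: (Lflux m k.-1). Qed.

Let zsE m w : 0 < w.1 <= T -> zs m w = Z m (idx (mesh T m) w.1) w.2.
Proof. by move=> wT; apply: stepfE => //; rewrite gridE. Qed.

Lemma zs_graph m w : Psi_graph rho phi (zs m w) (es m w).
Proof.
have [wT|nw] := boolP (0 < w.1 <= T); last first.
  rewrite /zs /es !stepf0// ?gridE//; apply/Psi_graphP; exists 0.
  by rewrite phi0 !mulr0 normr0 addr0 lerN10 ler01.
have -> : es m w = flux (mesh T m) (Z m) (idx (mesh T m) w.1).-1 w.2.
  by rewrite /es stepfE ?gridE.
rewrite zsE//; have /andP[w0 _] := wT.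
have : (0 < idx (mesh T m) w.1)%N.
  rewrite lt0n; apply/eqP => i0.
  have /andP[+ _] := idx_bounds (h0 m) (ltW w0).
  by rewrite i0 mul0r leNgt w0.
by case: (idx _ _) => // n _; have [_ _] := HZ m.
Qed.

Lemma zs_step m : ip lam2 (zs m.+1 - zs m) (zs m.+1 - zs m) <=
  T * (E / delta) * q ^+ 2 ^+ m.
Proof.
pose a k := Z m.+1 k - Z m (uphalf k).
have La k : L2 lam (a k) by apply: (siB Hs); [case: (LZ m.+1 k)|case: (LZ m (uphalf k))].
have -> : zs m.+1 - zs m = stepf (mesh T m.+1) (2 ^ m.+1) a.
  apply/funext => w; rewrite subfE; have [wT|nw] := boolP (0 < w.1 <= T).
    have /andP[w0 _] := wT.
    rewrite !zsE// stepfE ?gridE// (idx_uphalf (h0 m) (ltW w0)) -meshS.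
    by rewrite /a subfE.
  by rewrite /zs !stepf0 ?gridE// subrr.
rewrite (ip_stepf _ (h0 m.+1) La).
have HZS : euler rho phi (mesh T m / 2) y (Z m.+1) by rewrite -meshS.
have := refinement_L2 rho0 delta0 mphi lphi phi0 (h0 m) (HZ m) HZS (2 ^ m.+1).
have -> : T * (E / delta) * q ^+ 2 ^+ m = mesh T m * (E / delta).
  by rewrite hq2 /mesh mulrAC.
apply: le_trans; rewrite le_eqVlt; apply/orP; left; apply/eqP; apply: eq_bigr => k _.
by rewrite meshS; congr (_ * _); exact: (si_sqBC HsO).
Qed.

(** It carries the constant rho of the growth bound, which is not square integrable on the plane;
    off this rectangle [es] vanishes. *)
Let one := tens (itv_ind 0 T) (ind : R -> R).
Let L2one : L2 lam2 one.
Proof. by apply: L2_tens; [exact: L2_itv_ind|exact: L2O_ind.1]. Qed.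

Let one_ge0 w : 0 <= one w.
Proof. by rewrite /one /tens itv_indE /ind indicE mulr_ge0. Qed.

Lemma es_bound m : ip lam2 (es m) (es m) <=
  2 * rho ^+ 2 * ip lam2 one one + 2 * L ^+ 2 * ip lam2 (zs m) (zs m).
Proof.
have L0 := lip_ge0 lphi.
have L1 : L2 lam2 (rho *: one) := siZ Hs2 rho L2one.
pose az w := L * `|zs m w|.
have mz := L2_measurable (L2zs m).
have L2' : L2 lam2 az.
  apply: (L2_le _ (siZ Hs2 L (L2zs m))).
    by apply: measurable_funM => //; exact: measurableT_comp.
  by move=> w; rewrite scalefE /az !exprMn real_normK ?num_real.
have Lsum := siD Hs2 L1 L2'.
apply: (@le_trans _ _ (ip lam2 (rho *: one + az) (rho *: one + az))).
  apply: le_ip => // w; rewrite -!expr2.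
  have oz : 0 <= (rho *: one + az) w.
    by rewrite !pointwiseE addr_ge0 ?mulr_ge0 ?(ltW rho0).
  rewrite -[leLHS]real_normK ?num_real// ler_sqr ?nnegrE ?normr_ge0//.
  rewrite !pointwiseE /az.
  have [wT|nw] := boolP (0 < w.1 <= T); last first.
    by rewrite {1}/es stepf0 ?gridE// normr0 addr_ge0 ?mulr_ge0 ?(ltW rho0).
  have [xO|xO] := pselect (OO w.2); last first.
    have -> : es m w = 0.
      by rewrite /es stepfE ?gridE//; have [_ ->] := Lflux m (idx (mesh T m) w.1).-1.
    by rewrite normr0 addr_ge0 ?mulr_ge0 ?(ltW rho0).
  rewrite /one /tens itv_indE wT indE// !mulr1.
  exact: (Psi_graph_growth (ltW rho0) lphi phi0 (zs_graph m w)).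
apply: (le_trans (si_sqD_le Hs2 L1 L2')).
rewrite (si_sqZ Hs2 rho L2one) -!mulrA lerD2l ler_pM2l//.
rewrite mulrA -expr2 -(si_sqZ Hs2 L (L2zs m)).
have LLz := siZ Hs2 L (L2zs m).
apply: le_ip => // w; rewrite scalefE /az -!expr2 !exprMn real_normK ?num_real//.
Qed.

(** The discrete weak equation is exact at the end of the cell containing t. The overshoot beyond t
    costs at most the pairing with one increment, of norm sqrt(h E), and replacing [Um] by U costs C
    hq^m. *)
Lemma weak_error m j t : 0 <= t <= T ->
  `|ip lam2 (es m) (tens (itv_ind 0 t) (e2O j)) -
    (ip lam (U t) (e1O j) - ip lam (DG y) (e1O j))| <=
  (C + Num.sqrt (T * E)) * nrm (e1O j) * q ^+ m.
Proof.
move=> tI; have /andP[t0 tT] := tI; have [LU HUm] := HU tI.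
have Le1 := e1O_L2O j (R := R).
rewrite ip_stepf_itv//; last 3 first.
- by move=> k; case: (Lflux m k.-1).
- by case: (e2O_L2O j (R := R)).
- by rewrite gridE.
have W := euler_weak (h0 m) (HZ m) j (idx (mesh T m) t).
set S := \sum_(i < _) _ in W; set S' := \sum_(k < _) _.
have -> : S' = S by apply: eq_bigr => i _; rewrite /=.
have -> : S = ip lam (Um T Z m t) (e1O j) - ip lam (DG y) (e1O j).
  by rewrite /Um W addrAC subrr add0r.
have LUm : L2O (Um T Z m t) by exact: Um_L2O.
have h1 : `|ip lam (Um T Z m t) (e1O j) - ip lam (U t) (e1O j)| <= C * q ^+ m * nrm (e1O j).
  rewrite -(si_subl HsO)//; have Ld := siB HsO LUm LU.
  apply: (le_trans (snorm_cs HsO Ld Le1)); rewrite ler_wpM2r ?snorm_ge0//.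
have h2 : `|((idx (mesh T m) t)%:R * mesh T m - t) *
    ip lam (flux (mesh T m) (Z m) (idx (mesh T m) t).-1) (e2O j)| <=
    Num.sqrt (T * E) * q ^+ m * nrm (e1O j).
  set n := (idx _ _).-1.
  have /andP[i1 i2] := idx_bounds (h0 m) t0.
  have i3 : 0 <= (idx (mesh T m) t)%:R * mesh T m - t by rewrite subr_ge0.
  rewrite normrM (ger0_norm i3).
  apply: (@le_trans _ _ (mesh T m * `|ip lam (flux (mesh T m) (Z m) n) (e2O j)|)).
    by rewrite ler_wpM2r// lerBlDl ltW.
  rewrite -{1}(gtr0_norm (h0 m)) -normrM.
  have L1d := L2O_L1O (incr_L2O (HZ m) n).
  have -> : mesh T m * ip lam (flux (mesh T m) (Z m) n) (e2O j) =
      ip lam (DG (incr (Z m) n)) (e1O j).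
    rewrite ip_e1O_DG// (fluxE (HZ m)) (si_scalel HsO).
    - by rewrite mulrA mulrN divff ?mulN1r// gt_eqF.
    - exact: Gop_L2O.
    - exact: e2O_L2O.
  apply: (le_trans (snorm_cs HsO (DG_L2O L1d) Le1)); rewrite ler_wpM2r ?snorm_ge0//.
  rewrite -sqrt_half ?(mulr_ge0 (ltW T0) E0)// /snorm ler_wsqrtr//.
  have := ih_incr_le rho0 delta0 mphi lphi phi0 (h0 m) (HZ m) n.
  by rewrite -/E mulrAC.
move: h1 h2.
move: (ip lam (Um T Z m t) (e1O j)) (ip lam (U t) (e1O j)) (ip lam (DG y) (e1O j)) (_ * ip lam _ (e2O j)).
move=> a b c e h1 h2.
have -> : a - c - e - (b - c) = (a - b) - e by ring.
apply: (le_trans (ler_normB _ _)).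
have -> : (C + Num.sqrt (T * E)) * nrm (e1O j) * q ^+ m =
  C * q ^+ m * nrm (e1O j) + Num.sqrt (T * E) * q ^+ m * nrm (e1O j) by ring.
exact: lerD.
Qed.

Lemma limits_exist : exists z eta : R * R -> R, exists C2 : R,
  [/\ L2 lam2 z, L2 lam2 eta,
      (forall m, ip lam2 (zs m - z) (zs m - z) <= C2 * 2^-1 ^+ m),
      {ae lam2, forall w, Psi_graph rho phi (z w) (eta w)} &
      forall j t, 0 <= t <= T ->
        ip lam2 eta (tens (itv_ind 0 t) (e2O j)) =
        ip lam (U t) (e1O j) - ip lam (DG y) (e1O j)].
Proof.
have [z [Lz cz zb]] := L2_complete hqI L2zs zs_step.
set C2 := _ / (1 - q) ^+ 2 in zb.
have C20 : 0 <= C2.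
  by rewrite divr_ge0 ?sqr_ge0// mulr_ge0 ?(ltW T0)// divr_ge0 ?(ltW delta0).
pose M := 2 * rho ^+ 2 * ip lam2 one one + 2 * L ^+ 2 * (2 * ip lam2 z z + 2 * C2).
have esM m : ip lam2 (es m) (es m) <= M.
  have Ld : L2 lam2 (zs m - z) := siB Hs2 (L2zs m) Lz.
  have C2m : C2 * q ^+ 2 ^+ m <= C2.
    by rewrite ler_piMr// hq2 exprn_ile1// ?invr_ge0// invf_le1// ler1n.
  have zb' : ip lam2 (zs m) (zs m) <= 2 * ip lam2 z z + 2 * C2.
    have := si_sqD_le Hs2 Lz Ld; rewrite addrC subrK => /le_trans; apply.
    by rewrite lerD2l ler_pM2l// (le_trans (zb m)).
  apply: (le_trans (es_bound m)); rewrite lerD2l.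
  by apply: ler_wpM2l zb'; rewrite mulr_ge0// sqr_ge0.
have [g [Hg gb]] := mid_hull_cauchy Hs2 L2es esM.
have Lg n : L2 lam2 (g n) := mid_hull_in Hs2 L2es (Hg n).
have gb' n : ip lam2 (g n.+1 - g n) (g n.+1 - g n) <= 8 * q ^+ 2 ^+ n by rewrite hq2.
have [eta [Leta ceta etab]] := L2_complete hqI Lg gb'.
exists z, eta, C2; split => //.
- by move=> m; rewrite -hq2.
- have := ae_and cz ceta; apply: ae_impl => w [czw cew].
  exact: (Psi_graph_closed rho0 lphi phi0 (fun n => zs_graph n w) Hg czw cew).
move=> j t tI; have /andP[t0 tT] := tI.
set tau := (_ - _); set w := tens _ _.
have Lw : L2 lam2 w by apply: L2_tens; [exact: L2_itv_ind|case: (e2O_L2O j (R := R))].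
pose K := (C + Num.sqrt (T * E)) * nrm (e1O j).
have K0 : 0 <= K by rewrite mulr_ge0 ?snorm_ge0// addr_ge0// sqrtr_ge0.
have /andP[q0 q1] := hqI (R := R).
(* The pairing with w is linear, so the error bound for the terms of index at least n is inherited
   by their convex combinations. *)
have hull n f : mid_hull es n f -> L2 lam2 f /\ `|ip lam2 f w - tau| <= K * q ^+ n.
  elim=> [k nk|f1 f2 _ [L1 H1] _ [L2' H2]].
    split; first exact: L2es.
    apply: (le_trans (weak_error k j tI)); rewrite -/K ler_wpM2l//.
    by rewrite -(subnK nk) exprD ler_piMl ?exprn_ge0 ?(ltW q0)// exprn_ile1 ?(ltW q0) ?(ltW q1).
  split; first by apply: (siZ Hs2); exact: (siD Hs2).
  rewrite (si_scalel Hs2)//; last exact: (siD Hs2).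
  rewrite (si_addl Hs2)//.
  have -> : 2^-1 * (ip lam2 f1 w + ip lam2 f2 w) - tau =
      2^-1 * ((ip lam2 f1 w - tau) + (ip lam2 f2 w - tau)).
    by move: (ip _ _ _) (ip _ _ _) (tau) => a b c; lra.
  rewrite normrM ger0_norm ?invr_ge0//.
  have := ler_normD (ip lam2 f1 w - tau) (ip lam2 f2 w - tau); lra.
pose D := 8 / (1 - q) ^+ 2.
have D0 : 0 <= D by rewrite divr_ge0 ?sqr_ge0.
apply/eqP; rewrite -subr_eq0 -normr_le0.
apply: (geometric_le0 (C := Num.sqrt D * snorm (ip lam2) w + K) hqI) => n.
have [_ H] := hull n _ (Hg n).
have Ld := siB Hs2 (Lg n) Leta.
have h1 : `|ip lam2 (g n) w - ip lam2 eta w| <= Num.sqrt D * q ^+ n * snorm (ip lam2) w.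
  rewrite -(si_subl Hs2)//; apply: (le_trans (snorm_cs Hs2 Ld Lw)).
  rewrite ler_wpM2r ?snorm_ge0// -sqrt_half// /snorm ler_wsqrtr// -hq2.
  exact: etab.
rewrite -(subrKA (ip lam2 (g n) w)) (le_trans (ler_normD _ _))//.
rewrite distrC mulrDl mulrAC; exact: lerD.
Qed.

End Solution.

Lemma L2_restrict d (S : measurableType d) (R : realType)
    (mu : {measure set S -> \bar R}) (D : set S) (f : S -> R) :
  measurable D -> L2 mu f -> L2 mu (f \_ D).
Proof.
move=> mD Lf; have mf := L2_measurable Lf; apply: (L2_le _ Lf).
  by apply/(measurable_restrictT f mD); exact: measurable_funTS.
by move=> x; rewrite patchE; case: ifP => // _; rewrite expr0n sqr_ge0.
Qed.

(** * The limit is a solution *)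

Section Existence.
Context {R : realType}.
Notation lam := (leb R).
Notation lam2 := (leb2 R).
Notation HsO := (@semi_inner_L2O R).
Notation Hs := (semi_inner_L2 lam).
Notation Hs2 := (semi_inner_L2 lam2).
Notation q := (hq : R).
Notation nrm := (snorm (ip lam)).

Variables (rho delta L : R) (phi : R -> R).
Hypotheses (rho0 : 0 < rho) (delta0 : 0 < delta).
Hypotheses (mphi : strongly_monotone delta phi) (lphi : lip L phi) (phi0 : phi 0 = 0).
Variables (T : R) (y : R -> R).
Hypotheses (T0 : 0 < T) (Ly : L2O y).
Variable Z : nat -> nat -> R -> R.
Hypothesis HZ : forall m, euler rho phi (mesh T m) y (Z m).
Variables (U : R -> R -> R) (C : R).
Hypothesis C0 : 0 <= C.
Hypothesis HU : forall t, 0 <= t <= T ->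
  L2O (U t) /\ forall m, nrm (Um T Z m t - U t) <= C * q ^+ m.

Let LZ m k : L2O (Z m k) := euler_L2O (HZ m) k.
Let E : R := Energy rho phi y.
Let E0 : 0 <= E := Energy_ge0 rho0 delta0 mphi lphi phi0 y.

Let LUm m t : L2O (Um T Z m t) := Um_L2O HZ m t.

Definition Zs t : dual R := fun v => ip lam (U t) (wd v).

Lemma represented_Zs t : 0 <= t <= T -> represented (Zs t) (U t).
Proof.
by move=> tI; have [LU _] := HU tI; split => //; exact: (U_prim HZ C0 HU).
Qed.

Lemma normH_Zs t : 0 <= t <= T -> normH (Zs t) = nrm (U t).
Proof. by move=> tI; exact: (normH_represented (represented_Zs tI)). Qed.

Section Slices.
Variables (z : R * R -> R) (C2 : R).
Hypothesis Lz : L2 lam2 z.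
Hypothesis zC : forall m, ip lam2 (zs T Z m - z) (zs T Z m - z) <= C2 * 2^-1 ^+ m.

Let sq m (w : R * R) : \bar R := (((zs T Z m - z) w) ^+ 2)%:E.

Let L2d m : L2 lam2 (zs T Z m - z).
Proof.
apply: (siB Hs2) => //; apply: L2_stepf => k; by case: (LZ m k).
Qed.

Let msq m : measurable_fun setT (sq m).
Proof. by apply/measurable_EFinP/measurable_funX; exact: L2_measurable (L2d m). Qed.

Let sq0 m w : (0 <= sq m w)%E. Proof. by rewrite lee_fin sqr_ge0. Qed.

Let slices : {ae lam, forall t, exists K : R, forall m,
  (\int[lam]_x sq m (t, x) <= (K * q ^+ m)%:E)%E}.
Proof.
apply: (@ae_geometric_bound _ _ R lam (fun m t => \int[lam]_x sq m (t, x))%E C2 q hqI).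
- by move=> m; exact: (measurable_fun_fubini_tonelli_F (m2 := lam) (sq m) (msq m) (sq0 m)).
- by move=> m t; apply: integral_ge0 => x _; rewrite lee_fin sqr_ge0.
move=> m; rewrite hq2 -[leLHS](fubini_tonelli1 (m1 := lam) (m2 := lam) (sq m) (msq m) (sq0 m)).
by rewrite (L2_ip_fin (L2d m)) lee_fin.
Qed.

(** Convergence in L^2 of the space-time cylinder gives, by [ae_geometric_bound] in the time
    variable, L^2 convergence of the slices for almost every t. Since DG is bounded on L^2, the
    derivative of G z(t, .) is the limit [U t]. *)
Lemma represents_Zs : represents T z Zs.
Proof.
apply: ae_impl slices => t [K HK] tI; have /andP[t0 tT] := tI.
have tI' : 0 <= t <= T by rewrite !ltW.
pose zt x := z (t, x); pose a m := Z m (idx (mesh T m) t).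
have La m : L2O (a m) by exact: LZ.
have zsE m x : zs T Z m (t, x) = a m x.
  rewrite /zs stepfE//; first exact: mesh_gt0.
  by rewrite /mesh natrX mulrCA -exprMn divff ?expr1n ?mulr1 ?t0 ?(ltW tT)// pnatr_eq0.
have mzt : measurable_fun setT zt.
  by apply: (measurableT_comp (L2_measurable Lz)); exact: pair1_measurable.
have Lazt m : L2 lam (a m - zt).
  apply: L2I; first by apply: measurable_funB => //; exact: L2_measurable (La m).1.
  apply: le_lt_trans (ltry (K * q ^+ m)); apply: le_trans (HK m).
  by under eq_integral do rewrite subfE -zsE.
have Lzt : L2 lam zt.
  by have := siB Hs (La 0%N).1 (Lazt 0%N); rewrite opprB addrC subrK.
pose w := zt \_ OO.
have Lw : L2O w.
  split; [apply: (L2_restrict _ Lzt); exact: measurable_OO|exact: restrict_supp0].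
have L1w := L2O_L1O Lw.
have Law m : ip lam (a m - w) (a m - w) <= K * q ^+ m.
  apply: (@le_trans _ _ (ip lam (a m - zt) (a m - zt))); last first.
    rewrite -lee_fin -(L2_ip_fin (Lazt m)); apply: le_trans (HK m).
    by under eq_integral do rewrite subfE -zsE.
  have Ld := siB HsO (La m) Lw.
  apply: le_ip; [exact: Ld.1|exact: Ld.1|exact: Lazt|exact: Lazt|move=> x].
  have [xO|xO] := pselect (OO x).
    by rewrite !subfE /w restrictE indE// mulr1.
  by rewrite Ld.2// mul0r -expr2 sqr_ge0.
have [LU HUm] := HU tI'; have LDw := DG_L2O L1w.
have LUw := siB HsO LU LDw.
have Uw : ip lam (U t - DG w) (U t - DG w) = 0.
  apply/eqP; rewrite eq_le (si_ge0 HsO LUw) andbT.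
  apply: (geometric_le0 (C := 2 * C ^+ 2 + 2 * (pi ^+ 2 * K)) hqI) => m.
  have /andP[q0 q1] := hqI (R := R).
  have L1 := siB HsO (LUm m t) LU; have L2a := siB HsO (La m) Lw.
  have L1a := L2O_L1O L2a; have LD := DG_L2O L1a.
  have UE : U t - DG w = DG (a m - w) - (Um T Z m t - U t).
    rewrite (DGB (L2O_L1O (La m)) L1w) -/(Um T Z m t).
    apply/funext => x; rewrite !pointwiseE.
    by move: (U t x) (DG w x) (Um T Z m t x) => b c d; ring.
  have h1 : ip lam (Um T Z m t - U t) (Um T Z m t - U t) <= C ^+ 2 * q ^+ m.
    rewrite -(sqr_snorm HsO L1).
    apply: (@le_trans _ _ ((C * q ^+ m) ^+ 2)).
      by rewrite ler_sqr ?nnegrE ?snorm_ge0 ?mulr_ge0 ?exprn_ge0 ?hq_ge0.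
    rewrite exprMn ler_wpM2l ?sqr_ge0// expr2 ler_piMr ?exprn_ge0 ?hq_ge0//.
    by rewrite exprn_ile1 ?hq_ge0 ?(ltW q1).
  have h2 : ip lam (DG (a m - w)) (DG (a m - w)) <= pi ^+ 2 * K * q ^+ m.
    rewrite -mulrA -(sqr_snorm HsO LD).
    apply: (@le_trans _ _ ((pi * nrm (a m - w)) ^+ 2)).
      rewrite ler_sqr ?nnegrE ?snorm_ge0 ?mulr_ge0 ?pi_ge0 ?snorm_ge0//.
      exact: snorm_DG_le_L2.
    by rewrite exprMn (sqr_snorm HsO L2a) ler_wpM2l ?sqr_ge0.
  rewrite UE; apply: (le_trans (si_sqB_le HsO LD L1)).
  apply: (@le_trans _ _ (2 * (pi ^+ 2 * K * q ^+ m) + 2 * (C ^+ 2 * q ^+ m))).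
    by apply: lerD; rewrite ler_pM2l.
  rewrite le_eqVlt; apply/orP; left; apply/eqP.
  by move: (q ^+ m) (pi : R) => b c; ring.
split; first by apply/Lp_on1P.
move=> v Hv; have [Lv _ _] := H10_elim Hv.
rewrite -(toH_restrict zt) -/w toHE// /Zs; apply/eqP.
rewrite -subr_eq0 -(si_subl HsO LU LDw Lv) -normr_le0.
apply: (le_trans (snorm_cs HsO LUw Lv)).
by rewrite /snorm Uw sqrtr0 mul0r.
Qed.

End Slices.

Let N_mono s t : 0 <= s -> s <= t -> t <= T -> nrm (U t) <= nrm (U s).
Proof.
move=> s0 st tT.
have := U_decay rho0 delta0 mphi phi0 T0 HZ C0 HU s0 st tT.
move/le_trans; apply; rewrite ge_max snorm_ge0 lerBlDr lerDl.
by rewrite mulr_ge0 ?subr_ge0// mulr_ge0 ?(ltW rho0)// ltW// gamma_gt0.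
Qed.

(** Measurability in t comes from monotonicity: by [U_decay] the norm is nonincreasing on [0, T],
    and clamping t to [0, T] extends it to the line. *)
Lemma normH_Zs_L2 : Lp_on lam `]0, T[ 2 (normH \o Zs).
Proof.
pose cl t : R := Num.max 0 (Num.min T t).
pose N t := nrm (U (cl t)).
have clI t : 0 <= cl t <= T.
  by rewrite /cl le_max lexx/= ge_max (ltW T0) ge_min lexx.
have mN : measurable_fun setT N.
  apply: nonincreasing_measurable => // s t st; have /andP[s0 sT] := clI s.
  have /andP[t0 tT] := clI t; apply: N_mono => //.
  by rewrite /cl ge_max !le_max lexx/= le_min !ge_min lexx/= st orbT orbT.
have tI0 : (0 : R) <= 0 <= T by rewrite lexx ltW.
apply: (L2_le _ (siZ Hs (nrm (U 0)) (L2_itv_ind 0 T))).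
  have -> : (normH \o Zs) \_ `]0, T[ = N \_ `]0, T[.
    apply/funext => t; rewrite !patchE; case: ifPn => // /set_mem/=.
    rewrite in_itv/= => /andP[t0 tT]; rewrite /= normH_Zs ?ltW// /N /cl.
    by rewrite (min_idPr (ltW tT)) (max_idPr (ltW t0)).
  by apply/(measurable_restrictT N) => //; exact: measurable_funTS.
move=> t; rewrite scalefE patchE itv_indE mem_setE in_itv/=.
have [/andP[t0 tT]|_] := boolP (0 < t < T); last by rewrite expr0n sqr_ge0.
have tI' : 0 <= t <= T by rewrite !ltW.
rewrite t0 (ltW tT) mulr1 normH_Zs// ler_sqr ?nnegrE ?snorm_ge0//.
by apply: N_mono => //; exact: ltW.
Qed.

Lemma Zs_continuous t : 0 <= t <= T ->
  normH (subH (Zs s) (Zs t)) @[s --> within `[0, T] (nbhs t)] --> (0 : R).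
Proof.
move=> tI; have rt := represented_Zs tI; have /andP[t0 tT] := tI.
apply/cvgrPdist_lt => e e0.
pose k : R := Num.sqrt E + 1; have k0 : 0 < k by rewrite ltr_wpDl ?sqrtr_ge0.
have r0 : 0 < (e / k) ^+ 2 by rewrite exprn_gt0// divr_gt0.
apply: (filterS _ (nbhsx_ballx t _ r0)) => s ts; rewrite /= in_itv/= => sI.
have /andP[s0 sT] := sI; have rs := represented_Zs sI.
rewrite sub0r normrN (normH_represented (represented_sub rs rt)) ger0_norm ?snorm_ge0//.
have H : nrm (U s - U t) <= Num.sqrt E * Num.sqrt `|t - s|.
  have [LUs _] := HU sI; have [LUt _] := HU tI.
  have [ts'|st] := leP t s.
    rewrite distrC ger0_norm ?subr_ge0//.
    exact: (U_holder rho0 delta0 mphi lphi phi0 T0 HZ HU).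
  rewrite ger0_norm ?subr_ge0 ?(ltW st)// (snormBC HsO LUs LUt).
  exact: (U_holder rho0 delta0 mphi lphi phi0 T0 HZ HU s0 (ltW st) tT).
apply: (le_lt_trans H).
apply: (@le_lt_trans _ _ (k * Num.sqrt `|t - s|)).
  by rewrite ler_wpM2r ?sqrtr_ge0// lerDl.
rewrite -ltr_pdivlMl// mulrC -ltr_sqr ?nnegrE ?sqrtr_ge0 ?divr_ge0 ?ltW//.
by rewrite sqr_sqrtr.
Qed.

Lemma solution_Zs : solution (Psi_graph rho phi) T (toH y) Zs.
Proof.
have [z [eta [C2 [Lz Leta zC Hae Hj]]]] :=
  limits_exist rho0 delta0 mphi lphi phi0 T0 HZ C0 HU.
have mc : measurable (cylinder T : set (R * R)).
  by apply: measurableX; [exact: measurable_itv|exact: measurable_OO].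
split; first by move=> t tI; exact: represented_Hm1 (represented_Zs tI).
split; first exact: Zs_continuous.
split; first exact: normH_Zs_L2.
exists 2; split; first by rewrite ler1n.
exists z, eta; split.
- exact: (L2_restrict (mu := lam2) mc Lz).
- exact: represents_Zs Lz zC.
- exact: (L2_restrict (mu := lam2) mc Leta).
- by apply: ae_impl Hae => w Hw _.
move=> j t _ tI; have /andP[t0 tT] := tI; have [LU _] := HU tI.
have [He _] := H10_e j (R := R); have LD := DG_L2O (L2O_L1O Ly).
rewrite /Zs ip_wd_e// toHE//; last exact: L2O_L1O.
rewrite ip_wd_e// -[LHS](subrK (ip lam (DG y) (e1O j))) addrC -Hj//.
congr (_ + _); rewrite -iterated_integral//; last by case: (e2O_L2O j (R := R)).
apply: eq_Rintegral => s _; rewrite [RHS]Rintegral_mkcond.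
by apply: eq_Rintegral => x _; rewrite restrictE derive2_e mulrA.
Qed.

End Existence.

(** The decay is stated from an arbitrary time s, not only from 0, so that it also shows that a
    vanishing norm stays zero. *)
Theorem solution_exists (R : realType) (rho delta L : R) (phi : R -> R)
    (T : R) (y : R -> R) :
  0 < rho -> 0 < delta -> strongly_monotone delta phi -> lip L phi -> phi 0 = 0 ->
  0 < T -> L2O y ->
  exists Z : R -> dual R, [/\ solution (Psi_graph rho phi) T (toH y) Z,
    normH (Z 0) = normH (toH y) &
    forall s t, 0 <= s -> s <= t -> t <= T ->
      normH (Z t) <= Num.max 0 (normH (Z s) - rho * gamma R * (t - s))].
Proof.
move=> rho0 delta0 mphi lphi phi0 T0 Ly.
have /choice[Z HZ] (m : nat) : exists Z, euler rho phi (mesh T m) y Z.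
  exact: (euler_exists rho0 delta0 mphi lphi phi0 (mesh_gt0 T0 m) Ly).
have [U [C [C0 HU]]] := U_exists rho0 delta0 mphi lphi phi0 T0 HZ.
exists (Zs U); split.
- exact: (solution_Zs rho0 delta0 mphi lphi phi0 T0 Ly HZ C0 HU).
- rewrite (normH_Zs HZ C0 HU) ?lexx ?ltW// (U0_norm T0 Ly HZ HU).
  by rewrite (normH_represented (represented_toH (L2O_L1O Ly))).
move=> s t s0 st tT; have t0 := le_trans s0 st; have sT := le_trans st tT.
rewrite !(normH_Zs HZ C0 HU) ?s0 ?t0//.
exact: (U_decay rho0 delta0 mphi phi0 T0 HZ C0 HU).
Qed.

(** * Integrability of the datum and the extinction time *)

Lemma Lp_on_L2O (R : realType) (p : R) (f : R -> R) : 2 <= p ->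
  Lp_on (leb R) OO p f -> L2O (f \_ OO).
Proof.
move=> p2 Lf; have p1 : 1 <= p by apply: le_trans p2; rewrite ler1n.
split; last exact: restrict_supp0.
set g := f \_ OO; have mg : measurable_fun setT g.
  by move: Lf; rewrite /Lp_on inE => /andP[/[!inE]].
have Ig := Lfun_integrable p1 Lf.
have [Ii _] := L2O_L1O (L2O_ind (R := R)).
apply: L2I => //.
have : (leb R).-integrable setT ((EFin \o ind) \+ (fun x => (`|g x| `^ p)%:E))%E.
  exact: integrableD.
move=> /integrableP[mI]; apply: le_lt_trans.
apply: ge0_le_integral => //.
- by move=> x _; rewrite lee_fin sqr_ge0.
- by apply/measurable_EFinP; exact: measurable_funX.
- exact: measurableT_comp.
move=> x _ /=; rewrite lee_fin.
have [xO|xO] := pselect (OO x); last first.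
  by rewrite /g restrictE ind0// mulr0 expr0n/= normr_ge0.
rewrite (le_trans _ (ler_norm _))// indE// -[g x ^+ 2]real_normK ?num_real//.
(* On the bounded interval g^2 <= 1 + |g|^p, according to whether |g| is at most 1 or not. *)
have [g1|g1] := leP `|g x| 1.
  by rewrite -[leLHS]addr0 lerD ?powR_ge0// exprn_ile1.
apply: (@le_trans _ _ (`|g x| `^ p)); last by rewrite lerDr.
rewrite -powR_mulrn//; apply: ler_powR => //; exact: ltW.
Qed.

(** At the time N0 / c the decay from 0 forces the norm to vanish. By the decay from a zero of the
    norm, no time of positive norm lies after it, so the supremum is at most the infimum. *)
Lemma extinction_time (R : realType) (Z : R -> dual R) (c N0 : R) : 0 < c ->
  normH (Z 0) = N0 ->
  (forall s t, 0 <= s -> s <= t -> normH (Z t) <= Num.max 0 (normH (Z s) - c * (t - s))) ->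
  tau_inf Z = tau_sup Z /\ (tau_inf Z <= (N0 / c)%:E)%E.
Proof.
move=> c0 ZN decay; have N_ge0 t : 0 <= normH (Z t) by exact: sqrtr_ge0.
have N00 : 0 <= N0 by rewrite -ZN.
have stop : (tau_inf Z <= (N0 / c)%:E)%E.
  apply: ereal_inf_lbound; exists (N0 / c) => //; split; first by rewrite divr_ge0// ltW.
  apply/eqP; rewrite eq_le N_ge0 andbT.
  apply: (le_trans (decay 0 _ (lexx _) _)); first by rewrite divr_ge0// ltW.
  by rewrite ZN subr0 mulrC divfK ?gt_eqF// subrr maxxx.
split => //; apply/eqP; rewrite eq_le; apply/andP; split; last first.
  apply: ge_ereal_sup => _ [->|[s [s0 sN] <-]]; apply: le_ereal_inf_tmp => _ [t [t0 tN] <-].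
    by rewrite lee_fin.
  rewrite lee_fin leNgt; apply/negP => ts.
  have := decay t s t0 (ltW ts); rewrite tN sub0r max_l.
    by rewrite leNgt sN.
  by rewrite oppr_le0 mulr_ge0 ?subr_ge0 ?(ltW c0) ?(ltW ts).
rewrite leNgt; apply/negP => lt.
have b0 : (0 <= tau_sup Z)%E by apply: ereal_sup_ubound; left.
case Eb : (tau_sup Z) b0 lt => [b| |] // b0; last by rewrite ltNge leey.
case Ea : (tau_inf Z) stop => [a| |] // _; rewrite lte_fin => ba.
(* A time strictly between the supremum and the infimum could have neither zero nor positive
   norm. *)
rewrite lee_fin in b0; pose r := (a + b) / 2.
have r0 : 0 <= r by rewrite /r; lra.
have [rN|rN] := eqVneq (normH (Z r)) 0.
  have : (tau_inf Z <= r%:E)%E by apply: ereal_inf_lbound; exists r.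
  by rewrite Ea lee_fin /r; lra.
have : (r%:E <= tau_sup Z)%E.
  by apply: ereal_sup_ubound; right; exists r => //; split => //; rewrite lt_def rN N_ge0.
by rewrite Eb lee_fin /r; lra.
Qed.

Theorem corollary7 (R : realType) (xc rho delta p : R) (Psit : R -> R)
    (x : R -> R) (X : R -> dual R)
    (rho_gt0 : 0 < rho)
    (Psi00 : Psi_graph rho Psit 0 0)
    (Psit0 : Psit 0 = 0)
    (Psit_lip : lipschitz Psit)
    (Psit_C1 : forall r, r != 0 ->
       derivable Psit r 1 /\ {for r, continuous (derive1 Psit)})
    (delta_gt0 : 0 < delta)
    (Psit_delta : forall r, r != 0 -> delta <= derive1 Psit r)
    (p_ge4 : 4 <= p)
    (x_Lp : Lp_on (leb R) OO p x)
    (X_sol : forall T, 0 < T ->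
       unique_solution (Psi_graph rho Psit) T (toH (fun xi => x xi - xc))
         (fun t => subH (X t) (toH (cst xc)))) :
  let Z := fun t => subH (X t) (toH (cst xc)) in
  0 < gamma R /\
  tau_inf Z = tau_sup Z /\
  (tau_inf Z <= (normH (toH (fun xi => x xi - xc)) / (rho * gamma R))%:E)%E.
Proof.
set f := fun xi => x xi - xc; move=> Z; split; first exact: gamma_gt0.
have [L lL] := lipschitz_lip Psit_lip.
have mP := derive_strongly_monotone Psit_lip
  (fun r r0 => (Psit_C1 r r0).1) Psit_delta.
have [y yE Ly] : exists2 y, toH y = toH f & L2O y.
  (* The scheme works with data vanishing off (0, pi); the cut-off leaves the functional
     unchanged. *)
  exists (f \_ OO); first exact: toH_restrict.
  have p2 : 2 <= p by apply: le_trans p_ge4; rewrite ler_nat.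
  have -> : f \_ OO = x \_ OO - xc *: ind.
    by apply/funext => xi; rewrite !pointwiseE !restrictE mulrBl.
  apply: (siB (@semi_inner_L2O R)); first exact: Lp_on_L2O p2 x_Lp.
  by apply: (siZ (@semi_inner_L2O R)); exact: L2O_ind.
(* The constructed solution depends on T and agrees with Z as functionals on [H10]; by [eqH_normH]
   this transfers the norms. *)
have N T : 0 < T -> exists Z' : R -> dual R,
    [/\ forall t, 0 <= t <= T -> normH (Z t) = normH (Z' t), normH (Z' 0) = normH (toH f) &
    forall s t, 0 <= s -> s <= t -> t <= T ->
      normH (Z' t) <= Num.max 0 (normH (Z' s) - rho * gamma R * (t - s))].
  move=> T0; have [_ uniq] := X_sol T T0.
  have [Z' [sZ Z0 decay]] := solution_exists rho_gt0 delta_gt0 mP lL Psit0 T0 Ly.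
  rewrite yE in sZ Z0; exists Z'; split=> [t tI| |]; [|exact: Z0|exact: decay].
  by apply/esym/eqH_normH; exact: uniq sZ t tI.
apply: extinction_time; first by rewrite mulr_gt0// gamma_gt0.
  by have [Z' [ZE Z0 _]] := N 1 ltr01; rewrite ZE ?Z0// lexx ler01.
move=> s t s0 st; have t0 := le_trans s0 st.
(* The horizon t + 1 is positive also for t = 0. *)
have t1 : 0 < t + 1 by rewrite ltr_wpDl.
have tt : t <= t + 1 by rewrite lerDl.
have [Z' [ZE _ decay]] := N _ t1.
rewrite !ZE ?s0 ?t0 ?(le_trans st)//; exact: decay.
Qed.
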